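(* For $g=(R,S;k)\in\vec{T}$, let $n$ be the number of leaves in $R$, and let $V^{\mathbb{A}}_{\mathcal{L}}(t)$ denote the Jones polynomial of an annular link $\mathcal{L}$, where unknotted curves wrapping once around $\mathbb{A}$ are equal to $-t^{-1/2}-t^{1/2}$. Define $V_g^{\mathbb{A}}(t):\vec{T}\to\mathbb{C}$ by $$V_g^{\mathbb{A}}(t):=V^{\mathbb{A}}_{\mathcal{L}_{\mathbb{A}}(R,S;k)}(t)\,\bigl(-t^{-1/2}-t^{1/2}\bigr)^{-n+1}.$$ Then, for $t\in\{1,i,e^{\pm \pi i/3}\}$, $V_g^{\mathbb{A}}(t)$ is a function of positive type on $\vec{T}$, and consequently the Jones polynomial of $\mathcal{L}_{\mathbb{A}}(g)$, evaluated at $t\in\{1,i,e^{\pm \pi i/3}\}$, arises as the coefficient of a unitary representation of $\vec{T}$.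
   Context: **Annulus.** $\mathbb{A}$ is the unit disc in $\mathbb{R}^2$ (taken open) minus the origin, $I=[0,1]$. An edge-signed graph is a finite graph with a sign $+$ or $-$ on every edge. Annular links are links in $\mathbb{A}\times I$, given by link diagrams in $\mathbb{A}$. **The link of a graph.** For an edge-signed graph $\Gamma\hookrightarrow\mathbb{A}$, $L_{\mathbb{A}}(\Gamma)$ is the annular link with Tait graph $\Gamma$: take a small disc around each vertex and a half-twisted band along each edge. The boundary of this surface (the checkerboard surface) gives a diagram in $\mathbb{A}$ with one crossing for each edge. The sign of the edge determines which of the two possible crossings is used. The two types of crossings are distinguished by whether rotating the over-strand counterclockwise onto the under-strand sweeps out the two regions containing the ends of the edge or the other two regions. A bijection between $\{+,-\}$ and the two types is fixed once and for all. **Thompson's group $T$.** $T$ is the group of piecewise-linear orientation-preserving self-homeomorphisms of $S^1=[0,1]/(0\sim 1)$ whose derivatives are powers of $2$ and whose points of non-differentiability are dyadic rationals (preserving the set of dyadic points). A planar rooted binary tree with $n\ge 1$ leaves encodes a partition of $[0,1]$ into $n$ standard dyadic intervals $[\frac{a}{2^b},\frac{a+1}{2^b}]$, one for each leaf, from left to right. A triple $(R,S;k)$ consists of two such trees $R,S$ with the same number $n$ of leaves and an integer $1\le k\le n$. It determines the element of $T$ mapping the $i$-th interval of $R$ affinely onto the $j$-th interval of $S$, $j\equiv i+k-1 \pmod n$. A cancelling caret is a pair of leaves $i,i+1$ of $R$ that are the two children of one node of $R$, such that the corresponding leaves of $S$ are the left and right children of one node of $S$. A triple is reduced if it has no cancelling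 caret. Every $g\in T$ is determined by a unique reduced triple, and $g=(R,S;k)$ means that $(R,S;k)$ is this reduced triple. **The graph $\Gamma(R)$.** For a planar rooted binary tree $R$ with $n$ leaves, $\Gamma(R)$ has vertices $1,\dots,n$ on a horizontal line. It has one edge for each edge of $R$ going from an interior node down to its left child: if the leaves below the left child are $a,\dots,b$, the edge of $\Gamma(R)$ joins vertices $a$ and $b+1$. The edges are drawn as non-crossing arcs above the line. **The graph $\Gamma_{\mathbb{A}}(g)$ and the link $\mathcal{L}_{\mathbb{A}}(g)$.** Given $g=(R,S;k)$ with $n$ leaves, place points $p_1<\dots<p_n$ on the $x$-axis in $\mathbb{A}$ so that exactly $p_1,\dots,p_{k-1}$ are to the left of the origin. For every edge of $\Gamma(S)$ joining $a$ and $b$, draw an edge with sign $-$ joining $p_a$ and $p_b$ with interior in the lower half-plane. Identify vertex $i$ of $\Gamma(R)$ with $p_j$, $j\equiv i+k-1\pmod n$. For every edge of $\Gamma(R)$ draw an edge with sign $+$ joining the corresponding points with interior in the upper half-plane. All edges are pairwise non-crossing. The result is $\Gamma_{\mathbb{A}}(g)$, and $\mathcal{L}_{\mathbb{A}}(g)=\mathcal{L}_{\mathbb{A}}(R,S;k):=L_{\mathbb{A}}(\Gamma_{\mathbb{A}}(g))$. $\Gamma(g)$ denotes the image of $\Gamma_{\mathbb{A}}(g)$ under the inclusion $\mathbb{A}\hookrightarrow\mathbb{R}^2$. **Oriented subgroup.** $\vec{T}:=\{g\in T : \mathrm{Chr}_{\Gamma(g)}(2)=2\}$, where $\mathrm{Chr}$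 is the chromatic polynomial; it is a subgroup of $T$. For $g\in\vec{T}$ the checkerboard surface of $\mathcal{L}_{\mathbb{A}}(g)$ is orientable. Orient it so that the disc of the leftmost vertex is positively oriented, and give $\mathcal{L}_{\mathbb{A}}(g)$ the boundary orientation. **Annular Jones polynomial.** Put $t=A^{-4}$, $t^{1/2}=A^{-2}$ (a square root $t^{1/2}$ being fixed when evaluating at a number) and $\delta=-A^2-A^{-2}=-t^{1/2}-t^{-1/2}$. The Kauffman bracket $\langle D\rangle$ of a diagram $D\subset\mathbb{A}$ is computed with the usual skein relation (crossing $=A\cdot$($A$-smoothing)$+A^{-1}\cdot$($B$-smoothing)), with contractible circles replaced by $\delta$, essential circles (wrapping once around $\mathbb{A}$) also replaced by $\delta$, and $\langle\emptyset\rangle=1$. Then $V^{\mathbb{A}}_{\mathcal{L}}(t)=\delta^{-1}(-A^3)^{-w(D)}\langle D\rangle$ with $w(D)$ the writhe, so that the trivial unknot has value $1$. **Positive type and coefficients.** A function $\varphi:G\to\mathbb{C}$ on a group is of positive type if for all $m$, $g_1,\dots,g_m\in G$ and $c_1,\dots,c_m\in\mathbb{C}$ one has $\sum_{i,j}\overline{c_i}c_j\,\varphi(g_i^{-1}g_j)\ge 0$. A coefficient of a unitary representation $\pi$ of $G$ on a Hilbert space $H$ is a function $g\mapsto\langle\pi(g)\xi,\eta\rangle$ with $\xi,\eta\in H$.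
   Formalization: The final clause is proved for the normalized function V_g^A(t), so the Jones polynomial of L_A(g) equals (-t^{-1/2}-t^{1/2})^{n-1} times a coefficient; unnormalized, the Jones polynomial is unbounded on the oriented subgroup and cannot itself be a coefficient. *)

(* Defs.v *)
From HB Require Import structures.
From mathcomp Require Import all_boot all_order all_algebra complex.
From mathcomp Require Import all_classical all_reals all_analysis.

Set Implicit Arguments.
Unset Strict Implicit.
Unset Printing Implicit Defensive.

Import Order.TTheory GRing.Theory Num.Theory numFieldNormedType.Exports.
Local Open Scope ring_scope.

(** A diagram is a graph on the annulus with 4-valent vertices (the crossings)
    and 2-valent vertices (the markers).  Every crossing is drawn with its four
    ends pointing to NE, NW, SW and SE; the end [(c, (east, north))] is NE for
    [(true, true)], NW for [(false, true)], SW for [(false, false)] and SE for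
    [(true, false)].  The two strands are the diagonals, and [rising c] says
    that NE-SW is the over-strand.  A marker is a point on a strand; its two
    sides are [(m, false)] and [(m, true)].  [arc] maps an end to the other end
    of the arc issuing from it.  The markers satisfying [on_ray] are the points
    where the diagram meets a fixed ray from the puncture to the outer boundary
    of the annulus. *)
Record adiagram := ADiagram {
  crossing : finType;
  marker : finType;
  rising : crossing -> bool;
  on_ray : pred marker;
  arc : crossing * (bool * bool) + marker * bool ->
        crossing * (bool * bool) + marker * bool;
  arcK : involutive arc;
  arc_neq : forall x, arc x != x
}.

Notation dend D := (crossing D * (bool * bool) + marker D * bool)%type.

Definition opposite (D : adiagram) (x : dend D) : dend D :=
  match x with
  | inl (c, (e, n)) => inl (c, (~~ e, ~~ n))
  | inr (m, b) => inr (m, ~~ b)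
  end.

(** [s c = true] stands for the A-smoothing of [c], the one merging the two
    regions swept out when the over-strand rotates counterclockwise onto the
    under-strand.  If [c] is rising these are the northern and the southern
    regions, so that NE is joined to SE and NW to SW. *)
Definition smooth (D : adiagram) (s : {ffun crossing D -> bool})
    (x : dend D) : dend D :=
  match x with
  | inl (c, (e, n)) =>
      if s c == rising c then inl (c, (e, ~~ n)) else inl (c, (~~ e, n))
  | inr (m, b) => inr (m, ~~ b)
  end.

Definition state_rel (D : adiagram) (s : {ffun crossing D -> bool}) :
    rel (dend D) :=
  [rel x y | (y == arc x) || (y == smooth s x)].

(** A simple closed curve in the annulus is essential iff it meets the ray an
    odd number of times. *)
Definition essential (D : adiagram) (s : {ffun crossing D -> bool})
    (x : dend D) : bool :=
  odd #|[pred m | on_ray m && connect (state_rel s) x (inr (m, false))]|.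

Section JonesPolynomial.
Variable (F : fieldType).

Definition loop_value (A : F) : F := - A ^+ 2 - A ^- 2.

(** The circles of a state are the connected components of [state_rel s];
    [d] is the value of a contractible circle, [z] that of an essential one. *)
Definition kauffman_bracket (D : adiagram) (A d z : F) : F :=
  \sum_(s : {ffun crossing D -> bool})
    (\prod_(c : crossing D) (if s c then A else A^-1)) *
    \prod_(x : dend D | roots (state_rel s) x) (if essential s x then z else d).

(** [out x] says that the strand through the end [x] leaves the crossing or
    marker there. *)
Definition is_orientation (D : adiagram) (out : dend D -> bool) : Prop :=
  forall x, out (arc x) = ~~ out x /\ out (opposite x) = ~~ out x.

(** A rising crossing is positive iff its strands are both oriented upwards or
    both downwards, that is, iff they agree at NE and NW. *)
Definition crossing_sign (D : adiagram) (out : dend D -> bool)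
    (c : crossing D) : int :=
  if (out (inl (c, (true, true))) == out (inl (c, (false, true)))) == rising c
  then 1 else -1.

Definition writhe (D : adiagram) (out : dend D -> bool) : int :=
  \sum_(c : crossing D) crossing_sign out c.

(** The value at [t = A ^- 4], with [t ^ (1/2) = A ^- 2]. *)
Definition annular_jones (D : adiagram) (out : dend D -> bool) (A : F) : F :=
  (loop_value A)^-1 * (- A ^+ 3) ^ (- writhe out) *
  kauffman_bracket D A (loop_value A) (loop_value A).

End JonesPolynomial.

(** An embedded graph is given by its rotation system.  The discs around the
    vertices are part of the data: [rotation v] lists, in the counterclockwise
    order, what is met on the boundary of the disc of [v]: the edge-ends
    [inl (e, b)] and some marked points [inr m], among which are all points of
    the fixed ray from the puncture to the outer boundary.  The ray does not
    meet the edges outside of the discs. *)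
Record agraph := AGraph {
  vertex : finType;
  edge : finType;
  mark : finType;
  positive : edge -> bool;
  mark_on_ray : pred mark;
  base : edge * bool + mark -> vertex;
  rotation : vertex -> seq (edge * bool + mark);
  rotation_uniq : forall v, uniq (rotation v);
  mem_rotation : forall v s, (s \in rotation v) = (base s == v);
  rotation_neq0 : forall v, rotation v != [::]
}.

Notation site G := (edge G * bool + mark G)%type.

Definition proper_coloring (G : agraph) (C : finType)
    (c : {ffun vertex G -> C}) : bool :=
  [forall e : edge G, c (base (inl (e, false))) != c (base (inl (e, true)))].

(** The value of the chromatic polynomial at a number [q] of colours. *)
Definition chromatic (G : agraph) (q : nat) : nat :=
  #|[pred c : {ffun vertex G -> 'I_q} | proper_coloring c]|.

Section CheckerboardSurface.
Variable G : agraph.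

(** A site [s] has two sides on the boundary of its disc: seen from the centre
    of the disc, a right one [(s, false)], and a left one [(s, true)]; the
    counterclockwise boundary comes from the left side of a site to the right
    side of the next one.  The crossing on an edge [e] is drawn with the end
    [(e, false)] of the edge in the west and [(e, true)] in the east, so that
    the right corner of [(e, true)] is NE, the left corner of [(e, false)] is
    NW, and so on. *)
Definition side_end (x : site G * bool) :
    edge G * (bool * bool) + mark G * bool :=
  match x with
  | (inl (e, b), l) => inl (e, (b, b != l))
  | (inr m, l) => inr (m, l)
  end.

Definition end_side (x : edge G * (bool * bool) + mark G * bool) :
    site G * bool :=
  match x with
  | inl (e, (b, h)) => (inl (e, b), b != h)
  | inr (m, l) => (inr m, l)
  end.

Lemma side_endK : cancel side_end end_side.
Proof. by move=> [[[e b]|m] l] //=; case: b; case: l. Qed.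

Lemma end_sideK : cancel end_side side_end.
Proof. by move=> [[e [b h]]|[m l]] //=; case: b; case: h. Qed.

Definition next_site (s : site G) : site G := next (rotation (base s)) s.
Definition prev_site (s : site G) : site G := prev (rotation (base s)) s.

Lemma base_next s : base (next_site s) = base s.
Proof. by apply/eqP; rewrite -mem_rotation mem_next mem_rotation. Qed.

Lemma base_prev s : base (prev_site s) = base s.
Proof. by apply/eqP; rewrite -mem_rotation mem_prev mem_rotation. Qed.

Lemma next_siteK : cancel next_site prev_site.
Proof.
by move=> s; rewrite /prev_site base_next prev_next // rotation_uniq.
Qed.

Lemma prev_siteK : cancel prev_site next_site.
Proof.
by move=> s; rewrite /next_site base_prev next_prev // rotation_uniq.
Qed.

Definition surface_arc (x : edge G * (bool * bool) + mark G * bool) :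
    edge G * (bool * bool) + mark G * bool :=
  let: (s, l) := end_side x in
  side_end (if l then (next_site s, false) else (prev_site s, true)).

Lemma surface_arcK : involutive surface_arc.
Proof.
move=> x; rewrite /surface_arc -{2}(end_sideK x).
case: (end_side x) => s []; rewrite side_endK.
  by rewrite next_siteK.
by rewrite prev_siteK.
Qed.

Lemma surface_arc_neq x : surface_arc x != x.
Proof.
rewrite /surface_arc -{2}(end_sideK x).
by case: (end_side x) => s []; rewrite (can_eq side_endK) xpair_eqE andbF.
Qed.

(** A crossing on an edge is rising iff rotating the over-strand
    counterclockwise onto the under-strand sweeps out the two regions that do
    not contain the ends of the edge.  [conv] is the choice of a bijection
    between the signs and the two types of crossings. *)
Definition link_diagram (conv : bool) : adiagram :=
  {| crossing := edge G; marker := mark G;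
     rising := fun e => positive e == conv;
     on_ray := @mark_on_ray G;
     arc := surface_arc; arcK := surface_arcK; arc_neq := surface_arc_neq |}.

(** An orientation of the discs extends over the half-twisted bands iff it
    alternates along the edges.  [disc_orientation v0 v] says that the disc of
    [v] is positively oriented, for the orientation of the surface (supposed to
    be connected and orientable) which is positive at [v0]. *)
Definition disc_orientation (v0 : vertex G) : {ffun vertex G -> bool} :=
  odflt [ffun=> true]
    [pick o : {ffun vertex G -> bool} | proper_coloring o && o v0].

(** The boundary of a positively oriented disc runs counterclockwise, so it
    goes out of a site by its left side. *)
Definition boundary_orientation (conv : bool) (v0 : vertex G)
    (x : dend (link_diagram conv)) : bool :=
  let: (s, l) := end_side x in disc_orientation v0 (base s) == l.

Lemma boundary_orientationP (conv : bool) (v0 : vertex G) :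
  (exists o : {ffun vertex G -> bool}, proper_coloring o) ->
  is_orientation (boundary_orientation (conv := conv) v0).
Proof.
case=> o po.
have := po; rewrite /proper_coloring => /forallP pf.
rewrite /boundary_orientation /disc_orientation.
case: pickP => [c' /andP[/forallP po1 _]|/= no]; last first.
  have := no (if o v0 then o else [ffun v => ~~ o v]).
  case: ifP => ov0; rewrite ?po ?ov0 // ?ffunE ov0 andbT => /negP[].
  by apply/forallP => e; rewrite !ffunE (inj_eq negb_inj) pf.
move=> x /=; split.
  rewrite /surface_arc; case: (end_side x) => s []; rewrite side_endK.
    by rewrite base_next; case: (c' _).
  by rewrite base_prev; case: (c' _).
case: x => [[e [b h]]|[m l]] /=; last by case: (c' _); case: l.
by have := po1 e; case: b; case: h => /=; case: (c' _); case: (c' _).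
Qed.

End CheckerboardSurface.

Inductive btree := Leaf | Node of btree & btree.

Fixpoint leaves (t : btree) : nat :=
  if t is Node l r then (leaves l + leaves r)%N else 1%N.

Lemma leaves_gt0 t : (0 < leaves t)%N.
Proof. by elim: t => //= l lpos r _; rewrite addn_gt0 lpos. Qed.

(** [(a, b)] encodes the interval [a / 2 ^ b, (a + 1) / 2 ^ b]. *)
Fixpoint dyadic_intervals (t : btree) (a b : nat) : seq (nat * nat) :=
  if t is Node l r then
    dyadic_intervals l a.*2 b.+1 ++ dyadic_intervals r a.*2.+1 b.+1
  else [:: (a, b)].

Definition tree_intervals (t : btree) : seq (nat * nat) :=
  dyadic_intervals t 0 0.

(** In the next two functions the leaves of [t] are numbered from [i]. *)

Fixpoint tree_edges (t : btree) (i : nat) : seq (nat * nat) :=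
  if t is Node l r then
    (i, i + leaves l)%N :: tree_edges l i ++ tree_edges r (i + leaves l)
  else [::].

(** The leaves [j] such that [j] and [j.+1] are the children of one node. *)
Fixpoint carets (t : btree) (i : nat) : seq nat :=
  match t with
  | Leaf => [::]
  | Node Leaf Leaf => [:: i]
  | Node l r => carets l i ++ carets r (i + leaves l)
  end.

Record triple := Triple { dom : btree; cod : btree; shift : nat }.

HB.instance Definition _ := gen_eqMixin triple.
HB.instance Definition _ := gen_choiceMixin triple.

Definition wf_triple (p : triple) : bool :=
  (leaves (dom p) == leaves (cod p)) && (0 < shift p <= leaves (dom p))%N.

(** Leaves and vertices are numbered from 0 whereas [shift] ranges over 1..n:
    the leaf [i] of [dom] corresponds to the leaf [i + shift - 1] of [cod],
    modulo [n]. *)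
Definition leaf_match (p : triple) (i : nat) : nat :=
  ((i + (shift p).-1) %% leaves (dom p))%N.

Definition reduced (p : triple) : bool :=
  all (fun i => leaf_match p i \notin carets (cod p) 0) (carets (dom p) 0).

Section ThompsonGraph.
Variable p : triple.
Local Notation n := (leaves (dom p)).
Local Notation upper := (tree_edges (dom p) 0).
Local Notation lower := (tree_edges (cod p) 0).

Definition pt (i : nat) : 'I_n := Ordinal (ltn_pmod i (leaves_gt0 (dom p))).

(** Upper edges come from [dom], lower ones from [cod].  The marks
    [(j, true)] and [(j, false)] are the points of the x-axis immediately to
    the east and to the west of [pt j]; the ray is the positive x-axis. *)
Local Notation tedge := ('I_(size upper) + 'I_(size lower))%type.
Local Notation tmark := ('I_n * bool)%type.

Definition edge_point (d : tedge * bool) : 'I_n :=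
  match d with
  | (inl e, b) => let: (x, y) := nth (0, 0)%N upper e in
                  pt (leaf_match p (if b then y else x))
  | (inr e, b) => let: (x, y) := nth (0, 0)%N lower e in
                  pt (if b then y else x)
  end.

Definition tbase (s : tedge * bool + tmark) : 'I_n :=
  match s with inl d => edge_point d | inr m => m.1 end.

(** In the upper half-plane, the non-crossing edges issuing from a vertex
    reach, when counted counterclockwise, first the vertices to its right, the
    nearest first, and then those to its left, the farthest first; this is the
    order of the difference of indices modulo [n].  In the lower half-plane the
    order is reversed. *)
Definition turn (d : tedge * bool) : nat :=
  ((edge_point (d.1, ~~ d.2) + n - edge_point d) %% n)%N.

Definition is_upper (d : tedge * bool) : bool :=
  if d.1 is inl _ then true else false.

Definition upper_ends (v : 'I_n) : seq (tedge * bool) :=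
  sort (fun d1 d2 => turn d1 <= turn d2)%N
    [seq d <- enum {: tedge * bool} | is_upper d && (edge_point d == v)].

Definition lower_ends (v : 'I_n) : seq (tedge * bool) :=
  sort (fun d1 d2 => turn d2 <= turn d1)%N
    [seq d <- enum {: tedge * bool} | ~~ is_upper d && (edge_point d == v)].

Definition trotation (v : 'I_n) : seq (tedge * bool + tmark) :=
  inr (v, true) :: map inl (upper_ends v) ++
  inr (v, false) :: map inl (lower_ends v).

Lemma mem_upper_ends v d :
  (d \in upper_ends v) = is_upper d && (edge_point d == v).
Proof. by rewrite mem_sort mem_filter mem_enum inE andbT. Qed.

Lemma mem_lower_ends v d :
  (d \in lower_ends v) = ~~ is_upper d && (edge_point d == v).
Proof. by rewrite mem_sort mem_filter mem_enum inE andbT. Qed.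

Lemma mem_trotation v s : (s \in trotation v) = (tbase s == v).
Proof.
rewrite !(inE, mem_cat); case: s => [d|[j b]] /=.
  have inl_inj : injective (@inl (tedge * bool) tmark) by move=> x y [].
  rewrite !mem_map // mem_upper_ends mem_lower_ends.
  by case: is_upper; rewrite ?orbF.
have nin (r : seq (tedge * bool)) :
    ((inr (j, b) : tedge * bool + tmark) \in map inl r) = false.
  by apply/negbTE/negP => /mapP[].
rewrite !nin orbF /= /eq_op /= !xpair_eqE.
by case: b {nin}; rewrite ?andbT ?andbF ?orbF.
Qed.

Lemma trotation_uniq v : uniq (trotation v).
Proof.
have inl_inj : injective (@inl (tedge * bool) tmark) by move=> x y [].
have nin b (r : seq (tedge * bool)) :
    ((inr (v, b) : tedge * bool + tmark) \in map inl r) = false.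
  by apply/negbTE/negP => /mapP[].
have uends (P : pred (tedge * bool)) :
    uniq [seq d <- enum {: tedge * bool} | P d].
  exact/filter_uniq/enum_uniq.
rewrite /= mem_cat !inE cat_uniq /= !nin !map_inj_uniq // !sort_uniq !uends /=.
rewrite orbF andbT; apply/andP; split.
  by rewrite /eq_op /= xpair_eqE andbF.
apply/hasPn => s /mapP[d + ->]; rewrite /= mem_map //.
by rewrite mem_upper_ends mem_lower_ends => /andP[/negbTE->].
Qed.

Lemma trotation_neq0 v : trotation v != [::].
Proof. by []. Qed.

Definition thompson_graph : agraph :=
  {| vertex := 'I_n; edge := tedge; mark := tmark;
     positive := fun e => if e is inl _ then true else false;
     mark_on_ray := fun m => ((shift p).-1 <= m.1)%N;
     base := tbase; rotation := trotation;
     rotation_uniq := trotation_uniq; mem_rotation := mem_trotation;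
     rotation_neq0 := trotation_neq0 |}.

Definition leftmost : vertex thompson_graph := pt 0.

End ThompsonGraph.

Section SelfBijections.
Variable X : choiceType.

Record selfbij := SelfBij {
  fwd :> X -> X;
  bwd : X -> X;
  fwdK : cancel fwd bwd;
  bwdK : cancel bwd fwd
}.

HB.instance Definition _ := gen_eqMixin selfbij.
HB.instance Definition _ := gen_choiceMixin selfbij.

Lemma selfbijP (f g : selfbij) : fwd f =1 fwd g -> f = g.
Proof.
case: f g => [f f' fK f'K] [g g' gK g'K] /= /funext efg.
subst g; have e : f' = g' by apply/funext => x; rewrite -{1}(g'K x) fK.
by subst g'; congr SelfBij; exact: Prop_irrelevance.
Qed.

Definition sb_one : selfbij := @SelfBij id id (fun=> erefl) (fun=> erefl).
Definition sb_inv (f : selfbij) : selfbij := SelfBij (@bwdK f) (@fwdK f).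
Definition sb_mul (f g : selfbij) : selfbij :=
  SelfBij (can_comp (@fwdK f) (@fwdK g)) (can_comp (@bwdK g) (@bwdK f)).

Lemma sb_mulA : associative sb_mul.
Proof. by move=> f g h; apply: selfbijP. Qed.
Lemma sb_mul1 : left_id sb_one sb_mul.
Proof. by move=> f; apply: selfbijP. Qed.
Lemma sb_mulr1 : right_id sb_one sb_mul.
Proof. by move=> f; apply: selfbijP. Qed.
Lemma sb_mulV : left_inverse sb_one sb_inv sb_mul.
Proof. by move=> f; apply: selfbijP => x /=; rewrite fwdK. Qed.
Lemma sb_mulrV : right_inverse sb_one sb_inv sb_mul.
Proof. by move=> f; apply: selfbijP => x /=; rewrite bwdK. Qed.

HB.instance Definition _ :=
  isGroup.Build selfbij sb_mulA sb_mul1 sb_mulr1 sb_mulV sb_mulrV.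

End SelfBijections.

Section Thompson.
Variable R : realType.

(** The circle [0,1]/(0~1), by its fundamental domain. *)
Record circle := Circle { cval : R; _ : 0 <= cval < 1 }.
HB.instance Definition _ := [isSub for cval].
HB.instance Definition _ := [Choice of circle by <:].

Definition dyadic (x : R) : Prop :=
  exists (a : int) (b : nat), x = a%:~R / 2 ^+ b.

(** [F] is a lift to the line of an orientation-preserving homeomorphism [f] of
    the circle. *)
Definition is_lift (f : circle -> circle) (F : R -> R) : Prop :=
  [/\ continuous F,
      {homo F : x y / x < y},
      (forall x, F (x + 1) = F x + 1) &
      forall x : circle, exists m : int, F (cval x) = cval (f x) + m%:~R].

(** [F] is affine with slope a power of 2 on every subinterval of [0,1] with no
    element of the finite set [B] of dyadic numbers in its interior. *)
Definition piecewise_dyadic (F : R -> R) : Prop :=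
  exists B : seq R, (forall x, x \in B -> dyadic x) /\
    forall a b : R, 0 <= a -> a < b -> b <= 1 ->
      (forall x, x \in B -> ~~ (a < x < b)) ->
      exists m : int, forall x, a <= x <= b -> F x = F a + 2 ^ m * (x - a).

Definition thompsonT : set (selfbij circle) :=
  [set g | (forall x : circle, dyadic (cval x) <-> dyadic (cval (g x))) /\
           exists2 F, is_lift g F & piecewise_dyadic F].

Definition represents (p : triple) (g : selfbij circle) : Prop :=
  forall i, (i < leaves (dom p))%N ->
    let: (a, b) := nth (0, 0)%N (tree_intervals (dom p)) i in
    let: (c, d) := nth (0, 0)%N (tree_intervals (cod p)) (leaf_match p i) in
    forall x : circle, a%:R / 2 ^+ b <= cval x < a.+1%:R / 2 ^+ b ->
      cval (g x) = c%:R / 2 ^+ d + (2 ^+ b / 2 ^+ d) * (cval x - a%:R / 2 ^+ b).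

(** The unique reduced triple of an element of [thompsonT]. *)
Definition reduced_triple (g : selfbij circle) : triple :=
  xget (Triple Leaf Leaf 1)
    [set p | [/\ wf_triple p, reduced p & represents p g]].

Definition nleaves (g : selfbij circle) : nat := leaves (dom (reduced_triple g)).

Definition orientedT : set (selfbij circle) :=
  [set g | thompsonT g /\ chromatic (thompson_graph (reduced_triple g)) 2 = 2%N].

Definition link_jones (conv : bool) (A : R[i]) (g : selfbij circle) : R[i] :=
  let G := thompson_graph (reduced_triple g) in
  annular_jones
    (boundary_orientation (conv := conv) (leftmost (reduced_triple g))) A.

Definition normalized_jones (conv : bool) (A : R[i]) (g : selfbij circle) :
    R[i] :=
  link_jones conv A g * loop_value A ^ (1 - (nleaves g)%:Z).

End Thompson.

(** The group [K] is given as a subset of an ambient group. *)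
Definition positive_type (R : realType) (G : groupType) (K : set G)
    (phi : G -> R[i]) : Prop :=
  forall (m : nat) (g : 'I_m -> G) (c : 'I_m -> R[i]), (forall i, K (g i)) ->
    0 <= \sum_(i < m) \sum_(j < m)
           Num.conj (c i) * c j * phi ((g i)^-1 * g j)%g.

Record hilbert (R : realType) := Hilbert {
  hcar :> lmodType R[i];
  hdot : {dot hcar for Num.conj};
  hcomplete : forall u : nat -> hcar,
    (forall e : R[i], 0 < e -> exists N, forall i j, (N <= i)%N -> (N <= j)%N ->
       hdot (u i - u j) (u i - u j) < e) ->
    exists l, forall e : R[i], 0 < e -> exists N, forall i, (N <= i)%N ->
       hdot (u i - l) (u i - l) < e
}.

Definition unitary (R : realType) (H : hilbert R) (U : H -> H) : Prop :=
  [/\ linear U,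
      (forall x y, hdot H (U x) (U y) = hdot H x y) &
      forall y, exists x, U x = y].

Definition unitary_representation (R : realType) (G : groupType) (K : set G)
    (H : hilbert R) (rho : G -> H -> H) : Prop :=
  [/\ (forall g, K g -> unitary (rho g)),
      rho 1%g =1 id &
      forall g h, K g -> K h -> rho (g * h)%g =1 rho g \o rho h].

Definition expi (R : realType) (a : R) : R[i] := (cos a +i* sin a)%C.

(* Main.v *)
From HB Require Import structures.
Require Import Defs.
From mathcomp Require Import all_boot all_order all_algebra complex.
From mathcomp Require Import fingroup perm sesquilinear zify ring lra.
From mathcomp Require Import all_classical all_reals all_analysis.

Set Implicit Arguments.
Unset Strict Implicit.
Unset Printing Implicit Defensive.

Import Order.TTheory GRing.Theory Num.Theory.
Local Open Scope ring_scope.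

(** Essential circles have the same value [d = loop_value A] as contractible
    ones, so that the polynomial is a planar Kauffman bracket, and the proof
    rests on the relation between this bracket and the Potts model.

    Smoothing the crossing on an edge either merges or separates the discs at
    its ends.  If [F] is the set of merged edges, planarity gives
    [d ^ circles = d ^ (2 k(F) + #|F| - n)] for a graph with [n] vertices, and
    [d ^ (2 k(F)) = q ^ k(F)] counts the [q]-colorings constant on the edges of
    [F] when [d ^ 2 = q].  At the four values of [t] the number
    [d ^ 2 = t + t^-1 + 2] is the integer 4, 2 or 3, and so [d ^ n] times the
    bracket is the partition function of a [q]-state Potts model
    (bracket_potts).  Since [A] has modulus 1, the weights of this model have
    modulus 1, and those of a positive and of a negative edge are conjugate.
    For an oriented element the writhe vanishes (thompson_writhe), whence the
    normalized polynomial is the average over all [q]-colorings of the product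
    of the weights.

    The planarity of the Thompson graph is obtained by counting its faces: a
    tree drawn above a line cuts the half-plane into faces each of which touches
    exactly one gap between consecutive vertices, and so does the tree below.
    Hence there are [n] faces (thompson_circles), one for each of the [n] gaps.

    The vertices of the graph of a tree are the left ends of its dyadic
    intervals, and its edges join every dyadic point [(2 u + 1) / 2 ^ (v + 1)]
    to [u / 2 ^ v], its parent: there is one infinite tree containing all the
    finite ones.  An element [g] of [T] commutes with the map [parent] outside
    a finite set, since an affine map between standard dyadic intervals
    commutes with it inside of them.  Consider the functions of finitely many
    coordinates of a [q]-coloring of the circle, with the scalar product given
    by the uniform product measure.  On them [g] acts unitarily by
    [f |-> (c |-> J_g(c) f(c o g))], where [J_g(c)] is the finite product of
    the ratios between the weights of the edges carried by [g] and those of the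
    edges at their images; [J] is a cocycle.  The Potts average above is the
    mean of [J_g], that is [<g 1, 1>] (mean_cocycle_potts): it is a coefficient
    of the representation on the completion (cocycle_representation), hence of
    positive type.

    Two facts about Thompson's group are needed.  Every [g] has a reduced triple
    (reduced_triple_exists): its leaves are the maximal standard intervals on
    which [g] is affine onto a standard interval.  The oriented elements generate
    only elements whose graph can be colored with two colors, because [g] is
    oriented iff it preserves or exchanges the two classes of the bipartite tree
    of dyadic points (colorable_alternating, alternating_chromatic). *)

(** * Circles of a state and the Potts model *)

Section StateCircles.
Variable G : agraph.
Implicit Types (l : seq (edge G)) (x : site G).

Definition cross_bands l x : site G :=
  match x with
  | inl (e, b) => inl (e, b (+) (e \in l))
  | inr m => inr m
  end.

Lemma cross_bandsK l : involutive (cross_bands l).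
Proof. by case=> [[e b]|m] //=; rewrite addbK. Qed.

Definition cross_perm l : {perm site G} := perm (can_inj (cross_bandsK l)).
Definition turn_perm : {perm site G} := perm (can_inj (@next_siteK G)).

(** An edge in [l] stands for an untwisted band, along which one crosses from
    one disc to the other.  The orbits are the boundary circles of the surface
    made of the discs and of these bands, each site representing its right
    side. *)
Definition face_perm l : {perm site G} := (cross_perm l * turn_perm)%g.

Lemma face_permE l x : face_perm l x = next_site (cross_bands l x).
Proof. by rewrite permM !permE. Qed.

Definition circles l := #|porbits (face_perm l)|.

(** Adding a band composes the permutation with a transposition, which cuts or
    joins cycles. *)
Lemma circles_cons e l : e \notin l ->
  (circles (e :: l) +
   (inl (e, false) \notin porbit (face_perm l) (inl (e, true))).*2 =
   circles l + 1)%N.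
Proof.
move=> el; rewrite /circles.
have := porbits_mul_tperm (face_perm l) (inl (e, false)) (inl (e, true)).
have ne : (inl (e, false) : site G) != inl (e, true).
  by rewrite /eq_op /= xpair_eqE andbF.
rewrite /= ne => <-; congr (#|_| + _)%N; congr porbits.
rewrite /face_perm mulgA; congr (_ * _)%g; apply/permP => x.
rewrite permM [LHS]permE [RHS]permE /=; case: tpermP => [->|->|].
- by rewrite /= inE eqxx (negbTE el).
- by rewrite /= inE eqxx (negbTE el).
case: x => [[e' b]|m] //= h1 h2; rewrite inE.
by case: eqP => // ee; subst e'; case: b h1 h2.
Qed.

(** Without bands, the circles are the boundaries of the discs. *)
Lemma circles_nil : (circles [::] <= #|vertex G|)%N.
Proof.
rewrite /circles -[leqRHS]cardsT.
have faceE x : face_perm [::] x = next_site x.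
  by rewrite face_permE; case: x => [[e c]|m] //=; rewrite addbF.
have base_iter i x : base ((face_perm [::] ^+ i)%g x) = base x.
  by elim: i => [|i IH]; rewrite ?expg0 ?perm1 // expgSr permM faceE base_next.
pose b (o : {set site G}) := [set base x | x in o].
have bE x : b (porbit (face_perm [::]) x) = [set base x].
  apply/setP => v; rewrite inE; apply/imsetP/eqP => [[y]|->]; last first.
    by exists x => //; rewrite porbit_id.
  by case/porbitP => i -> ->; rewrite base_iter.
rewrite -(card_in_imset (f := b)); last first.
  move=> _ _ /imsetP[x _ ->] /imsetP[y _ ->]; rewrite !bE => /set1_inj xy.
  apply/eqP; rewrite eq_porbit_mem porbit_sym.
  have : fconnect (next (rotation (base x))) x y.
    rewrite (fconnect_cycle (p := rotation (base x))) ?mem_rotation ?xy //.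
    exact/cycle_next/rotation_uniq.
  case/iter_findex; move: (findex _ _ _) => i <- {xy}.
  suff -> : iter i (next (rotation (base x))) x = (face_perm [::] ^+ i)%g x.
    exact: mem_porbit.
  elim: i => [|i /= ->]; first by rewrite expg0 perm1.
  by rewrite expgSr permM faceE /next_site base_iter.
rewrite -(card_imset _ (@set1_inj (vertex G))) subset_leq_card //.
apply/fintype.subsetP => _ /imsetP[_ /imsetP[x _ ->] ->]; rewrite bE.
by rewrite imset_f.
Qed.

End StateCircles.

Definition constant_on (G : agraph) (q : nat) (l : seq (edge G))
    (c : {ffun vertex G -> 'I_q}) : bool :=
  all (fun e => c (base (inl (e, false))) == c (base (inl (e, true)))) l.

Definition ncolorings (G : agraph) (q : nat) (l : seq (edge G)) : nat :=
  #|[pred c : {ffun vertex G -> 'I_q} | constant_on l c]|.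

(** If some coloring constant on [l] separates the ends of [e], its color
    class at one end is a union of components not containing the other end;
    shifting the colors cyclically on that class shows that the color
    difference along [e] is equidistributed. *)
Lemma ncolorings_split (G : agraph) (q : nat) (e : edge G) l
    (c0 : {ffun vertex G -> 'I_q.+1}) : constant_on l c0 ->
  c0 (base (inl (e, false))) != c0 (base (inl (e, true))) ->
  ncolorings q.+1 l = (q.+1 * ncolorings q.+1 (e :: l))%N.
Proof.
move=> c0l /negbTE c0e; rewrite /ncolorings.
set u := base (inl (e, false)) in c0e *; set v := base (inl (e, true)) in c0e *.
rewrite -sum1_card.
rewrite (partition_big (fun c : {ffun vertex G -> 'I_q.+1} => c u - c v) predT) //=.
rewrite -[X in (X * _)%N]card_ord -sum_nat_const; apply: eq_bigr => j _.
rewrite -sum1_card.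
pose h (k : 'I_q.+1) (c : {ffun vertex G -> 'I_q.+1}) : {ffun vertex G -> 'I_q.+1} :=
  [ffun x => c x + (if c0 x == c0 u then k else 0)].
have hK k : cancel (h k) (h (- k)).
  by move=> c; apply/ffunP => x; rewrite !ffunE; case: ifP => _;
    rewrite ?addr0 // addrK.
have hK' k : cancel (h (- k)) (h k).
  by move=> c; apply/ffunP => x; rewrite !ffunE; case: ifP => _;
    rewrite ?addr0 // addrNK.
have hl k c : constant_on l c -> constant_on l (h k c).
  move=> /allP cl; apply/allP => e' e'l; rewrite !ffunE.
  by rewrite (eqP (cl _ e'l)) (eqP (allP c0l _ e'l)).
rewrite (reindex (h j)) /=; last first.
  by exists (h (- j)) => c _; [exact: hK|exact: hK'].
apply: eq_bigl => c; rewrite !inE -/u -/v.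
have -> : constant_on l (h j c) = constant_on l c.
  by apply/idP/idP => [/(hl (- j))|/(hl j)//]; rewrite hK.
rewrite andbC; congr (_ && _).
rewrite !ffunE eqxx [c0 v == _]eq_sym c0e addr0.
by rewrite -addrA [j - _]addrC addrA -subr_eq0 addrK subr_eq0.
Qed.

Section Colorings.
Variables (G : agraph) (q : nat).
Hypothesis q_gt1 : (1 < q)%N.
Implicit Types (l : seq (edge G)) (c : {ffun vertex G -> 'I_q}).
Local Notation ncolorings := (@ncolorings G q).

Lemma constant_on_orbit l c x y :
  constant_on l c -> x \in porbit (face_perm l) y -> c (base x) = c (base y).
Proof.
move=> /allP mono /porbitP[i ->]; elim: i => [|i IH].
  by rewrite expg0 perm1.
rewrite expgSr permM face_permE base_next -{}IH.
set z := ((_ ^+ i)%g : {perm _}) y; case: z => [[e b]|m] //=.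
case: (boolP (e \in l)) => [/mono/eqP ce|_]; last by rewrite addbF.
by case: b; rewrite /= ce.
Qed.

Lemma ncolorings_gt0 l : (0 < ncolorings l)%N.
Proof.
apply/card_gt0P; exists [ffun=> Ordinal (ltnW q_gt1)].
by apply/allP => e _; rewrite !ffunE.
Qed.

Lemma ncolorings_nil : ncolorings [::] = (q ^ #|vertex G|)%N.
Proof. by rewrite /ncolorings eq_cardT // -cardT card_ffun card_ord. Qed.

(** The quantity [2 k + size l - circles l], with [q ^ k] colorings constant
    on [l], is twice the genus up to a constant.  Adding an edge joining two
    components merges two circles and divides the number of colorings by
    [q]; adding any other edge keeps the number of colorings and creates at
    most one new circle.  So the quantity does not decrease. *)
Lemma genus_step e l k : e \notin l -> ncolorings l = (q ^ k)%N ->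
  exists2 k', ncolorings (e :: l) = (q ^ k')%N &
    (k.*2 + circles (e :: l) <= k'.*2 + 1 + circles l)%N.
Proof.
move=> el Nl; have ce := circles_cons el.
case: (boolP [exists c0 : {ffun vertex G -> 'I_q}, constant_on l c0 &&
   (c0 (base (inl (e, false))) != c0 (base (inl (e, true))))]); last first.
  move=> /existsPn no; exists k; last by lia.
  rewrite -Nl; apply: eq_card => c; rewrite !inE /= andbC.
  have := no c; rewrite negb_and.
  by case: (boolP (constant_on l c)) => //= _ /negbNE->.
case/existsP => c0 /andP[c0l c0e].
have : ncolorings l = (q * ncolorings (e :: l))%N.
  move: c0 c0l c0e; rewrite -[q]prednK ?(ltnW q_gt1) // => c0.
  exact: ncolorings_split.
rewrite Nl.
case: k Nl => [|k] Nl E.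
  have := ncolorings_gt0 (e :: l); nia.
exists k; first by apply/eqP; rewrite -(@eqn_pmul2l q) ?(ltnW q_gt1) // -E expnS.
move: ce; have -> : inl (e, false) \notin porbit (face_perm l) (inl (e, true)).
  by apply: contraNN c0e => /(constant_on_orbit c0l)->.
lia.
Qed.

Lemma genus_chain l1 l2 k1 : uniq (l2 ++ l1) -> ncolorings l1 = (q ^ k1)%N ->
  exists2 k2, ncolorings (l2 ++ l1) = (q ^ k2)%N &
    (k1.*2 + circles (l2 ++ l1) <= k2.*2 + size l2 + circles l1)%N.
Proof.
move=> + N1; elim: l2 => [|e l2 IH] /=; first by exists k1 => //; lia.
move=> /andP[el /IH[k2 N2 h2]].
have [k N h] := genus_step el N2; exists k => //.
by move: (circles _) (circles _) (circles _) h h2 => x y z; lia.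
Qed.

Hypothesis connected : forall c, constant_on (enum (edge G)) c ->
  forall x y, c x = c y.
(** The circles of the list of all the edges are the faces, so this says that
    the Euler characteristic is at least 2. *)
Hypothesis euler :
  (#|edge G| + 2 <= circles (enum (edge G)) + #|vertex G|)%N.
Hypothesis inhabited : (0 < #|vertex G|)%N.

(** From the empty list to the list of all the edges the genus increases weakly
    through [l], but it is nonnegative at the beginning and nonpositive at the
    end. *)
Lemma genus0 l : uniq l ->
  exists2 k, ncolorings l = (q ^ k)%N &
    (circles l + #|vertex G| = k.*2 + size l)%N.
Proof.
move=> ul.
have [||k Nk hk] := @genus_chain [::] l #|vertex G|; rewrite ?cats0 //.
  exact: ncolorings_nil.
rewrite !cats0 in Nk hk.
pose l' := [seq e <- enum (edge G) | e \notin l].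
have ull' : uniq (l' ++ l).
  rewrite cat_uniq ul filter_uniq ?enum_uniq // andbT /=.
  by apply/hasPn => e el; rewrite mem_filter el.
have pl : perm_eq (l' ++ l) (enum (edge G)).
  apply: uniq_perm => //; first exact: enum_uniq.
  by move=> e; rewrite mem_cat mem_filter mem_enum /= andbT inE orNb.
have [k' Nk' hk'] := genus_chain ull' Nk.
have cl : circles (l' ++ l) = circles (enum (edge G)).
  congr #|porbits _|; congr (_ * _)%g; apply/permP => -[[e b]|m];
    by rewrite !permE //= (perm_mem pl).
have k'1 : k' = 1%N.
  suff : ncolorings (l' ++ l) = q.
    rewrite Nk' => E; apply/eqP; rewrite -(@eqn_exp2l q) // E expn1 //.
  have [v _] := card_gt0P inhabited.
  rewrite -[RHS]card_ord /ncolorings.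
  have inj : injective (fun j : 'I_q => [ffun _ : vertex G => j]).
    by move=> i j /ffunP/(_ v); rewrite !ffunE.
  rewrite -(card_codom inj); apply: eq_card => c; rewrite !inE.
  have -> : constant_on (l' ++ l) c = constant_on (enum (edge G)) c.
    exact: perm_all.
  apply/idP/codomP => [/connected cc|[j ->]].
    by exists (c v); apply/ffunP => x; rewrite ffunE.
  by apply/allP => e _; rewrite !ffunE.
have := perm_size pl; rewrite size_cat -cardE => sl.
have c0 := circles_nil G; exists k => //.
rewrite cl k'1 in hk'; move: sl (circles _) (circles _) (circles _) hk hk' c0 euler.
move: (size l) (size _) #|edge G| #|vertex G| => a b c d sl x y z; lia.
Qed.

End Colorings.

Section Bracket.
Variables (G : agraph) (conv : bool).
Local Notation D := (link_diagram G conv).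
Implicit Types (s : {ffun crossing D -> bool}) (x : site G).

(** The edges whose smoothing joins the discs at their ends. *)
Definition merged s : seq (edge G) :=
  [seq e <- enum (edge G) | s e != (positive e == conv)].

Lemma mem_merged s e : (e \in merged s) = (s e != (positive e == conv)).
Proof. by rewrite mem_filter mem_enum inE andbT. Qed.

Lemma smoothE s x l : @smooth D s (side_end (x, l)) =
  side_end (cross_bands (merged s) x, ~~ l).
Proof.
case: x => [[e b]|m] //=; rewrite mem_merged.
by case: (s e == _); case: b; case: l.
Qed.

(** Along a circle of a state the right and the left sides of sites alternate;
    its right sides form an orbit of the permutation. *)
Lemma card_state_circles s :
  #|[pred x | roots (@state_rel D s) x]| = circles (merged s).
Proof.
pose h x : dend D := side_end (x, false).
pose h' (y : dend D) (_ : y \in predT) : site G :=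
  let: (x, l) := end_side y in if l then next_site x else x.
have state_sym : connect_sym (@state_rel D s).
  apply: sym_connect_sym => y z; rewrite /state_rel /=.
  have arcC : (z == @Defs.arc D y) = (y == @Defs.arc D z).
    by apply/eqP/eqP => ->; rewrite arcK.
  have smoothC : (z == smooth s y) = (y == smooth s z).
    rewrite -(end_sideK y) -(end_sideK z).
    case: (end_side y) (end_side z) => [u k] [v l]; rewrite !smoothE.
    rewrite !(can_eq (@side_endK G)) !xpair_eqE.
    rewrite [v == _]eq_sym (can2_eq (cross_bandsK _) (cross_bandsK _)).
    by case: k; case: l.
  by rewrite arcC smoothC.
have face_sym : connect_sym (frel (face_perm (merged s))).
  exact/fconnect_sym/perm_inj.
have arcE x l : @Defs.arc D (side_end (x, l)) =
    side_end (if l then (next_site x, false) else (prev_site x, true)).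
  by rewrite -[LHS]/(surface_arc (side_end (x, l))) /surface_arc side_endK.
have adj : rel_adjunction h (@state_rel D s) (frel (face_perm (merged s))) predT.
  apply: (@intro_adjunction _ _ h _ _ face_sym predT _ h') => // y yP.
    rewrite -{1 3}(end_sideK y) /h'.
    case: (end_side y) => x l; split.
      case: l => //; apply: connect1; rewrite /state_rel /=.
      by rewrite /h -(arcE x true) eqxx.
    move=> z _ /orP[]/eqP->; rewrite ?arcE ?smoothE side_endK.
      by case: l => //; rewrite prev_siteK.
    case: l => /=; last first.
      by apply: connect1; rewrite /= face_permE.
    rewrite face_sym; apply: connect1.
    by rewrite /= face_permE cross_bandsK.
  rewrite /h' /h side_endK; split=> // z /eqP <-.
  apply: (connect_trans (y := smooth s (h y))).
    by apply: connect1; rewrite /state_rel /= eqxx orbT.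
  rewrite /h smoothE face_permE; apply: connect1.
  by apply/orP; left; rewrite arcE.
have := adjunction_n_comp h state_sym face_sym _ adj.
rewrite (_ : n_comp (@state_rel D s) _ = #|roots (@state_rel D s)|); last first.
  by apply: eq_card => x; rewrite !inE andbT.
move=> -> //.
set f := face_perm _.
have porbitE x y : (y \in porbit f x) = fconnect f x y.
  apply/porbitP/idP => [[i ->]|/iter_findex <-].
    by rewrite permX fconnect_iter.
  by exists (findex f x y); rewrite permX.
rewrite /circles -/f /n_comp_mem -(card_in_imset (f := porbit f)).
  apply: eq_card => o; apply/imsetP/imsetP => [[x _ ->]|[x _ ->]].
    by exists x.
  exists (froot f x); first by rewrite inE /= !inE roots_root.
  by apply/eqP; rewrite eq_porbit_mem porbit_sym porbitE connect_root.
move=> x y; rewrite !inE /= !andbT => /eqP rx /eqP ry /eqP.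
by rewrite eq_porbit_mem porbitE => /(fingraph.rootP face_sym); rewrite rx ry.
Qed.

(** [B] is the coefficient of the smoothing separating the ends of the edge.
    For equal colors the merging smoothing adds [B^-1 * loop_value A], and
    [B + B^-1 * loop_value A = - B ^- 3]. *)
Definition potts_weight (F : fieldType) (A : F) (p eqc : bool) : F :=
  let B := if p then A else A^-1 in if eqc then - B ^- 3 else B.

(** The Fortuin-Kasteleyn expansion: expanding the product of the weights over
    the set [F] of merged edges, the sum over the colors gives [q] to the number
    of components of [F], which by [genus0] is the power of [loop_value A] due
    to the circles. *)
Lemma bracket_potts (F : fieldType) (A : F) (q : nat) :
  (1 < q)%N -> A != 0 -> loop_value A != 0 -> loop_value A ^+ 2 = q%:R ->
  (forall c : {ffun vertex G -> 'I_q}, constant_on (enum (edge G)) c ->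
     forall u v : vertex G, c u = c v) ->
  (#|edge G| + 2 <= circles (enum (edge G)) + #|vertex G|)%N ->
  (0 < #|vertex G|)%N ->
  loop_value A ^+ #|vertex G| *
    kauffman_bracket D A (loop_value A) (loop_value A) =
  \sum_(c : {ffun vertex G -> 'I_q}) \prod_(e : edge G)
    potts_weight A (positive e == conv)
      (c (base (inl (e, false))) == c (base (inl (e, true)))).
Proof.
move=> q_gt1 A0 d0 d2 conn euler inh; set d := loop_value A in d0 d2 *.
pose a (b : bool) := if b then A else A^-1.
pose m (e : edge G) (b : bool) := b != (positive e == conv).
pose same (c : {ffun vertex G -> 'I_q}) (e : edge G) :=
  c (base (inl (e, false))) == c (base (inl (e, true))).
transitivity (\sum_(s : {ffun edge G -> bool}) \sum_(c : {ffun vertex G -> 'I_q})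
  \prod_(e : edge G) (a (s e) * (if m e (s e) then d * (same c e)%:R else 1))).
  rewrite /kauffman_bracket mulr_sumr; apply: eq_bigr => s _.
  have -> : \prod_(x : dend D | roots (state_rel s) x)
      (if essential s x then loop_value A else loop_value A) =
      d ^+ circles (merged s).
    rewrite -card_state_circles -prodr_const.
    by apply: eq_bigr => x _; case: ifP.
  rewrite mulrCA -exprD addnC.
  have um : uniq (merged s) by rewrite filter_uniq ?enum_uniq.
  have [k Nk ->] := genus0 q_gt1 conn euler inh um.
  rewrite (eq_bigr (fun c => (\prod_e a (s e)) *
      (d ^+ size (merged s) * (constant_on (merged s) c)%:R))) => [|c _].
    rewrite -mulr_sumr; congr (_ * _); rewrite -mulr_sumr -natr_sum.
    rewrite exprD -muln2 mulnC exprM d2 mulrC; congr (_ * _).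
    rewrite -natrX -Nk /ncolorings -sum1_card big_mkcond; congr (_ %:R).
  rewrite big_split /=; congr (_ * _).
  have -> : \prod_e (if m e (s e) then d * (same c e)%:R else 1) =
      \prod_(e <- merged s) (d * (same c e)%:R).
    rewrite -big_mkcond big_filter big_enum_cond.
    by apply: eq_bigl => e; rewrite inE.
  elim: (merged s) => [|e l IH] /=; first by rewrite big_nil mulr1.
  rewrite big_cons IH exprS -/(same c e) /constant_on /=.
  by case: (same c e); case: (all _ l); rewrite ?mulr1 ?mulr0 ?mul0r.
rewrite exchange_big; apply: eq_bigr => c _.
rewrite -(bigA_distr_bigA (fun e b =>
  a b * (if m e b then d * (same c e)%:R else 1))).
apply: eq_bigr => e _; rewrite big_bool /= /m /a /potts_weight -/(same c e).
rewrite /d /loop_value; move: A0.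
case: (positive e == conv); case: (same c e) => A0 /=;
  by field; rewrite ?oner_eq0 ?A0.
Qed.
End Bracket.

(** * Faces of the graph of a tree *)

(** A node of the tree covering the leaves [i <= x < k], whose right child
    begins at the leaf [j], is recorded as [(i, j, k)]: it yields the edge
    [(i, j)] of the graph.  If [x] denotes the gap between the leaves [x - 1]
    and [x], the two faces along this edge are those of the gap [j], below the
    edge, and of the gap [k], above it. *)
Fixpoint tree_nodes (t : btree) (i : nat) : seq (nat * nat * nat) :=
  if t is Node l r then
    (i, i + leaves l, i + leaves l + leaves r)%N ::
      tree_nodes l i ++ tree_nodes r (i + leaves l)
  else [::].

Lemma tree_edgesE t i : tree_edges t i = map fst (tree_nodes t i).
Proof. by elim: t i => //= l IHl r IHr i; rewrite map_cat IHl IHr. Qed.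

Lemma size_tree_nodes t i : (size (tree_nodes t i)).+1 = leaves t.
Proof.
elim: t i => //= l IHl r IHr i; rewrite size_cat.
have := IHl i; have := IHr (i + leaves l)%N; lia.
Qed.

Lemma tree_nodes_bound t i N : N \in tree_nodes t i ->
  [/\ i <= N.1.1, N.1.1 < N.1.2, N.1.2 < N.2 & N.2 <= i + leaves t]%N.
Proof.
elim: t i => //= l IHl r IHr i; have := leaves_gt0 l; have := leaves_gt0 r.
rewrite inE mem_cat => r0 l0 /orP[/eqP->|/orP[/IHl|/IHr] []] /=; split; lia.
Qed.

(** Every leaf but the first one begins the right subtree of one node. *)
Lemma tree_nodes_inner t i : perm_eq [seq N.1.2 | N <- tree_nodes t i]
  (iota i.+1 (leaves t).-1).
Proof.
elim: t i => //= l IHl r IHr i; rewrite map_cat.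
have l0 := leaves_gt0 l; have r0 := leaves_gt0 r.
have -> : (leaves l + leaves r).-1 = ((leaves l).-1 + (1 + (leaves r).-1))%N.
  by lia.
rewrite !iotaD (_ : i.+1 + (leaves l).-1 = i + leaves l)%N; last by lia.
rewrite [iota _ 1]/= -cat1s perm_sym perm_catCA perm_sym perm_cat2l addn1.
exact: perm_cat.
Qed.

Definition node_end : Type := (nat * nat * nat * bool)%type.

Definition npoint (d : node_end) : nat := if d.2 then d.1.1.2 else d.1.1.1.
Definition nother (d : node_end) : nat := if d.2 then d.1.1.1 else d.1.1.2.
Definition rgap (d : node_end) : nat := if d.2 then d.1.2 else d.1.1.2.
Definition lgap (d : node_end) : nat := if d.2 then d.1.1.2 else d.1.2.
Definition nturn (n : nat) (d : node_end) : nat :=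
  ((nother d + n - npoint d) %% n)%N.

(** The ends at the leaf [v], in the counterclockwise order. *)
Fixpoint fan (t : btree) (i v : nat) : seq node_end :=
  if t is Node l r then
    let j := (i + leaves l)%N in
    if (v < j)%N then
      fan l i v ++ if v == i then [:: (i, j, j + leaves r, false)%N] else [::]
    else
      fan r j v ++ if v == j then [:: (i, j, j + leaves r, true)%N] else [::]
  else [::].

Lemma mem_fan t i v d : (i <= v < i + leaves t)%N ->
  (d \in fan t i v) = (d.1 \in tree_nodes t i) && (npoint d == v).
Proof.
case: d => [[[a1 a2] a3] b]; rewrite /npoint /=.
elim: t i v => //= l IHl r IHr i v /andP[iv vt].
have l0 := leaves_gt0 l; have r0 := leaves_gt0 r.
rewrite inE mem_cat; case: ltnP => vj.
  rewrite mem_cat IHl ?iv // andb_orl andb_orl orbC; congr (_ || _).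
    case: (v == i) / eqP => [->|vi].
      rewrite inE xpair_eqE; case: eqP => //= -[-> -> _].
      by case: b {IHl IHr}; lia.
    rewrite in_nil; apply/esym/negbTE/negP => /andP[/eqP[-> -> _]].
    by case: b {IHl IHr} => /eqP; lia.
  rewrite [X in _ || X](_ : _ = false) ?orbF //.
  apply/negP => /andP[/tree_nodes_bound[/= h1 h2 h3 h4] /eqP].
  by case: b {IHl IHr}; lia.
rewrite mem_cat IHr; last by lia.
rewrite andb_orl andb_orl orbC; congr (_ || _).
  case: (v == _) / eqP => [->|vi].
    rewrite inE xpair_eqE; case: eqP => //= -[-> -> _].
    by case: b {IHl IHr}; lia.
  rewrite in_nil; apply/esym/negbTE/negP => /andP[/eqP[-> -> _]].
  by case: b {IHl IHr} => /eqP; lia.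
rewrite [X in X || _](_ : _ = false) //.
apply/negP => /andP[/tree_nodes_bound[/= h1 h2 h3 h4] /eqP].
by case: b {IHl IHr}; lia.
Qed.

(** The face on the left of each end is the face on the right of the next
    one. *)
Fixpoint gap_chain (a : nat) (s : seq node_end) (b : nat) : bool :=
  if s is d :: s' then (rgap d == a) && gap_chain (lgap d) s' b else a == b.

Lemma gap_chain_cat a s1 b s2 c :
  gap_chain a s1 b -> gap_chain b s2 c -> gap_chain a (s1 ++ s2) c.
Proof.
by elim: s1 a => /= [a /eqP-> //|d s IH a /andP[-> /IH]] /[apply].
Qed.

(** Turning around the leaf [v] from east to west one goes from the gap
    [v + 1] to the gap [v], or to the last gap if [v] is the first leaf. *)
Lemma fan_chain t i v : (i <= v < i + leaves t)%N ->
  gap_chain v.+1 (fan t i v) (if v == i then i + leaves t else v)%N.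
Proof.
elim: t i v => /= [|l IHl r IHr] i v /andP[iv vt].
  have -> : v = i by lia.
  by rewrite eqxx addn1.
case: ltnP => vj.
  apply: gap_chain_cat (IHl _ _ _) _; first by rewrite iv.
  by case: eqP => //= _; rewrite /rgap /lgap /= eqxx addnA eqxx.
apply: gap_chain_cat (IHr _ _ _) _; first by lia.
have -> : (v == i) = false by have := leaves_gt0 l; lia.
by case: eqP => //= ->; rewrite /rgap /lgap /= eqxx eqxx.
Qed.

(** The index of the other end of an edge, relative to [v] and modulo [n],
    increases along the fan. *)
Lemma fan_sorted t i v n : (i <= v < i + leaves t)%N -> (i + leaves t <= n)%N ->
  pairwise (fun d1 d2 => nturn n d1 < nturn n d2)%N (fan t i v).
Proof.
elim: t i v => //= l IHl r IHr i v /andP[iv vt] tn.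
have l0 := leaves_gt0 l; have r0 := leaves_gt0 r.
case: ltnP => vj; rewrite pairwise_cat.
  rewrite IHl ?iv //=; last by lia.
  case: eqP => [vi|]; rewrite ?allrel0r //= andbT allrel1r.
  apply/allP => -[N b]; rewrite mem_fan ?iv // => /andP[/tree_nodes_bound[]].
  rewrite /npoint /nturn /nother /=; case: N => [[a1 a2] a3] /=.
  case: b => /= h1 h2 h3 h4 /eqP h5; first by lia.
  have -> : (a2 + n - a1 = (a2 - a1) + n)%N by lia.
  have -> : (i + leaves l + n - i = leaves l + n)%N by lia.
  by rewrite !modnDr !modn_small; lia.
rewrite IHr //=; try lia.
case: eqP => [vi|]; rewrite ?allrel0r //= andbT allrel1r.
apply/allP => -[N b]; rewrite mem_fan; last by lia.
case/andP => /tree_nodes_bound[].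
rewrite /npoint /nturn /nother /=; case: N => [[a1 a2] a3] /=.
case: b => /= h1 h2 h3 h4 /eqP h5; first by lia.
have -> : (a2 + n - a1 = (a2 - a1) + n)%N by lia.
have -> : (i + n - (i + leaves l) = n - leaves l)%N by lia.
by rewrite modnDr !modn_small; lia.
Qed.

(** * Planarity of the graph of a triple *)

Lemma gap_chain_rcons a s d b :
  gap_chain a (rcons s d) b = gap_chain a s (rgap d) && (lgap d == b).
Proof.
by elim: s a => //= [|x s IH] a; rewrite ?IH ?andbA // eq_sym.
Qed.

Lemma pairwise_key_inj (T : eqType) (key : T -> nat) (s : seq T) :
  pairwise (fun x y => key x < key y)%N s -> {in s &, injective key}.
Proof.
elim: s => //= a s IH /andP[/allP h /IH inj] x y.
rewrite !inE => /orP[/eqP->|xs] /orP[/eqP->|ys] // E; last exact: inj.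
  by have := h _ ys; rewrite E ltnn.
by have := h _ xs; rewrite E ltnn.
Qed.

Lemma pairwise_rev (T : Type) (r : rel T) (s : seq T) :
  pairwise r (rev s) = pairwise (fun x y => r y x) s.
Proof.
by elim: s => //= x s IH; rewrite rev_cons pairwise_rcons all_rev IH.
Qed.

Lemma sort_key (T : eqType) (key : T -> nat) (s1 s2 : seq T) :
  pairwise (fun x y => key x < key y)%N s2 -> perm_eq s1 s2 ->
  sort (fun x y => key x <= key y)%N s1 = s2.
Proof.
move=> lt2 s12; have inj := pairwise_key_inj lt2.
apply: (sorted_eq_in (leT := fun x y => key x <= key y)%N).
- by move=> x y z _ _ _; apply: leq_trans.
- move=> x y; rewrite !mem_sort !(perm_mem s12) => xs ys xy.
  by apply: inj => //; apply/eqP; rewrite eqn_leq.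
- by apply: sort_sorted => x y; apply: leq_total.
- apply: (sub_sorted (e := fun x y => key x < key y)%N).
    by move=> x y; apply: ltnW.
  exact: pairwise_sorted.
by rewrite (permPl (permEl (perm_sort _ _))).
Qed.

Lemma nth_tree_edges t e : (e < size (tree_edges t 0))%N ->
  nth (0, 0)%N (tree_edges t 0) e = (nth (0, 0, 0)%N (tree_nodes t 0) e).1.
Proof. by rewrite tree_edgesE size_map => h; rewrite (nth_map (0, 0, 0)%N). Qed.

Section Planarity.
Variable p : triple.
Hypothesis wf : wf_triple p.
Local Notation n := (leaves (dom p)).
Local Notation s := (Defs.shift p).-1.
Local Notation G := (thompson_graph p).
Local Notation tend := (('I_(size (tree_edges (dom p) 0)) +
                         'I_(size (tree_edges (cod p) 0))) * bool)%type.

Let leaves_cod : leaves (cod p) = n.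
Proof. by case/andP: wf => /eqP. Qed.

Let n_gt0 : (0 < n)%N := leaves_gt0 _.

Lemma pt_mod x : pt p (x %% n)%N = pt p x.
Proof. by apply: val_inj; rewrite /= modn_mod. Qed.

Lemma pt_id (v : 'I_n) : pt p v = v.
Proof. by apply: val_inj; rewrite /= modn_small. Qed.

Lemma pt_inj x y k : (x < n)%N -> (y < n)%N -> pt p (x + k)%N = pt p (y + k)%N ->
  x = y.
Proof.
move=> xn yn /(congr1 val) /= /eqP.
by rewrite eqn_modDr !modn_small // => /eqP.
Qed.

Lemma pt_shift k (v : 'I_n) : exists2 x, (x < n)%N & pt p (x + k)%N = v.
Proof.
exists ((v + (n - k %% n)) %% n)%N; first by rewrite ltn_pmod.
apply: val_inj; rewrite /= modnDml -modnDmr -addnA subnK; last first.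
  by rewrite ltnW // ltn_pmod.
by rewrite modnDr modn_small.
Qed.

Definition node_of (d : tend) : node_end :=
  (match d.1 with
   | inl e => nth (0, 0, 0)%N (tree_nodes (dom p) 0) e
   | inr e => nth (0, 0, 0)%N (tree_nodes (cod p) 0) e
   end, d.2).

Definition offset (d : tend) : nat := if is_upper d then s else 0%N.

Lemma node_of_mem d : (node_of d).1 \in
  if is_upper d then tree_nodes (dom p) 0 else tree_nodes (cod p) 0.
Proof.
case: d => -[e|e] b /=; apply: mem_nth; case: e => /= e;
  by rewrite tree_edgesE size_map.
Qed.

Lemma node_of_bound d (N := (node_of d).1) :
  [/\ N.1.1 < N.1.2, N.1.2 < N.2 & N.2 <= n]%N.
Proof.
have := node_of_mem d; case: ifP => _ /tree_nodes_bound[_ ? ? ?]; split=> //.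
by rewrite -leaves_cod.
Qed.

Lemma npoint_lt d : (npoint (node_of d) < n)%N.
Proof. by have [] := node_of_bound d; rewrite /npoint; case: ifP => _; lia. Qed.

Lemma nother_lt d : (nother (node_of d) < n)%N.
Proof. by have [] := node_of_bound d; rewrite /nother; case: ifP => _; lia. Qed.

Lemma edge_pointE d : edge_point d = pt p (npoint (node_of d) + offset d)%N.
Proof.
case: d => -[e|e] b; rewrite /edge_point /npoint /node_of /offset /=;
  rewrite (nth_tree_edges (ltn_ord e)); case: (nth _ _ _) => -[x y] z /=.
  by rewrite /leaf_match pt_mod; case: b.
by rewrite addn0; case: b.
Qed.

Lemma turnE d : turn d = nturn n (node_of d).
Proof.
rewrite /turn /nturn !edge_pointE /=.
have -> : npoint (node_of (d.1, ~~ d.2)) = nother (node_of d).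
  by rewrite /npoint /nother /node_of /=; case: d.2.
have -> : offset (d.1, ~~ d.2) = offset d by [].
have xn := npoint_lt d; have yn := nother_lt d.
move: (npoint _) (nother _) (offset d) xn yn => x y k xn yn.
have kn : ((x + k) %% n <= n)%N by rewrite ltnW // ltn_pmod.
apply/eqP; rewrite -(eqn_modDr ((x + k) %% n)) subnK; last first.
  exact: leq_trans kn (leq_addl _ _).
rewrite modnDr modn_mod modnDmr.
have -> : (y + n - x + (x + k) = y + k + n)%N by lia.
by rewrite modnDr.
Qed.

Lemma node_of_inj d1 d2 : is_upper d1 = is_upper d2 ->
  node_of d1 = node_of d2 -> d1 = d2.
Proof.
have un t i : uniq (tree_nodes t i).
  apply: (@map_uniq _ _ (fun N => N.1.2)).
  by rewrite (perm_uniq (tree_nodes_inner _ _)) iota_uniq.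
case: d1 d2 => [[e1|e1] b1] [[e2|e2] b2] //= _ [] /eqP + ->;
  rewrite nth_uniq //; try (by case: (e1) => /= e; rewrite tree_edgesE size_map);
  try (by case: (e2) => /= e; rewrite tree_edgesE size_map);
  by move=> /eqP/val_inj ->.
Qed.

(** As [turn] increases strictly along the fan, this determines the sorted lists
    of ends. *)
Lemma perm_fan (up : bool) v : (v < n)%N ->
  perm_eq [seq node_of d | d <- [seq d <- enum {: tend} |
              (is_upper d == up) && (edge_point d == pt p (v + offset d)%N)]]
    (fan (if up then dom p else cod p) 0 v).
Proof.
set t := if up then _ else _; move=> vn.
have tn : leaves t = n by rewrite /t; case: ifP.
apply: uniq_perm.
- rewrite map_inj_in_uniq; first exact/filter_uniq/enum_uniq.
  move=> d1 d2.
  rewrite !mem_filter => /andP[/andP[/eqP u1 _] _] /andP[/andP[/eqP u2 _] _].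
  by apply: node_of_inj; rewrite u1 u2.
- apply: (pairwise_uniq (r := fun d1 d2 => nturn n d1 < nturn n d2)%N).
    by move=> d; rewrite /= ltnn.
  by apply: fan_sorted; rewrite ?add0n tn //.
move=> d; rewrite mem_fan ?add0n ?tn //.
apply/mapP/andP => [[x]|[dt /eqP dv]].
  rewrite mem_filter edge_pointE => /andP[/andP[/eqP xu /eqP/pt_inj xv] _] ->.
  rewrite xv ?npoint_lt // eqxx; split=> //.
  by have := node_of_mem x; rewrite xu /t; case: ifP.
have it : (index d.1 (tree_nodes t 0) < size (tree_edges t 0))%N.
  by rewrite tree_edgesE size_map index_mem.
have [x xu xd] : exists2 x, is_upper x = up & node_of x = d.
  move: dt it; rewrite /t {t tn}; case: up => dt it.
    exists (inl (Ordinal it), d.2) => //.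
    by rewrite /node_of /= nth_index //; case: (d).
  exists (inr (Ordinal it), d.2) => //.
  by rewrite /node_of /= nth_index //; case: (d).
by exists x; rewrite // mem_filter xu eqxx edge_pointE xd dv eqxx mem_enum.
Qed.

Lemma fan_sorted0 t v : leaves t = n -> (v < n)%N ->
  pairwise (fun d1 d2 => nturn n d1 < nturn n d2)%N (fan t 0 v).
Proof. by move=> tn vn; apply: fan_sorted; rewrite add0n tn. Qed.

Lemma upper_endsE v : (v < n)%N ->
  [seq node_of d | d <- upper_ends (pt p (v + s)%N)] = fan (dom p) 0 v.
Proof.
move=> vn; rewrite /upper_ends.
pose le d1 d2 := (nturn n d1 <= nturn n d2)%N.
have leE : (fun d1 d2 : tend => turn d1 <= turn d2)%N = relpre node_of le.
  by apply/funext => d1; apply/funext => d2; rewrite /= !turnE.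
rewrite leE -sort_map; apply: (sort_key (key := nturn n)).
  exact: fan_sorted0.
have := perm_fan true vn; congr (perm_eq (map _ _) _).
apply: eq_filter => d; rewrite eqb_id /offset; by case: is_upper.
Qed.

Lemma lower_endsE v : (v < n)%N ->
  [seq node_of d | d <- lower_ends (pt p v)] = rev (fan (cod p) 0 v).
Proof.
move=> vn; rewrite /lower_ends.
pose key d := (n - nturn n d)%N.
have leE : (fun d1 d2 : tend => turn d2 <= turn d1)%N =
    relpre node_of (fun d1 d2 => key d1 <= key d2)%N.
  apply/funext => d1; apply/funext => d2; rewrite /= !turnE /key.
  have lt d : (nturn n d < n)%N by rewrite ltn_pmod.
  by have := lt (node_of d1); have := lt (node_of d2); lia.
rewrite leE -sort_map; apply: sort_key.
  rewrite pairwise_rev; apply: sub_pairwise (fan_sorted0 leaves_cod vn).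
  by move=> d1 d2; rewrite /key /nturn; have := ltn_pmod (nother d2 + n - npoint d2) n_gt0; lia.
rewrite perm_sym perm_rev perm_sym.
have := perm_fan false vn; congr (perm_eq (map _ _) _).
apply: eq_filter => d; rewrite eqbF_neg /offset.
by case: is_upper; rewrite ?addn0.
Qed.
End Planarity.

Section Faces.
Variable p : triple.
Hypothesis wf : wf_triple p.
Local Notation n := (leaves (dom p)).
Local Notation s := (Defs.shift p).-1.
Local Notation G := (thompson_graph p).

Let leaves_cod : leaves (cod p) = n.
Proof. by case/andP: wf => /eqP. Qed.

(** The gap, modulo [n], belonging to the face on the left or on the right of
    a site.  This labels the faces of the graph, since a tree drawn above a
    line cuts the upper half-plane into faces each touching one gap. *)
Definition side_gap (x : site G) (l : bool) : 'I_n :=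
  match x with
  | inl d => pt p ((if l == is_upper d then lgap (node_of d)
                    else rgap (node_of d)) + offset d)%N
  | inr (v, b) => pt p (v + b)%N
  end.

Local Notation adj := (fun x y : site G => side_gap x true == side_gap y false).

Lemma upper_path ds a b x y r : all (@is_upper p) ds ->
  gap_chain a (map (@node_of p) ds) b ->
  side_gap x true = pt p (a + s)%N -> side_gap y false = pt p (b + s)%N ->
  path adj x (map inl ds ++ y :: r) = path adj y r.
Proof.
elim: ds a x => /= [|d ds IH] a x; first by move=> _ /eqP-> -> ->; rewrite eqxx.
case/andP=> ud uds /andP[/eqP rd ch] xa yb.
by rewrite xa (IH _ _ uds ch) //= /offset ud ?rd ?eqxx.
Qed.

Lemma lower_path ds a b x y r : all (fun d => ~~ @is_upper p d) ds ->
  gap_chain a (rev (map (@node_of p) ds)) b ->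
  side_gap x true = pt p b -> side_gap y false = pt p a ->
  path adj x (map inl ds ++ y :: r) = path adj y r.
Proof.
elim: ds b x => /= [|d ds IH] b x; first by move=> _ /eqP-> -> ->; rewrite eqxx.
rewrite rev_cons gap_chain_rcons.
case/andP=> ud uds /andP[ch /eqP lb] xb ya.
by rewrite xb (IH _ _ uds ch) //= /offset (negbTE ud) addn0 ?lb ?eqxx.
Qed.

(** Turning counterclockwise around [v] from east to west, one passes from the
    gap [v + 1] to the gap [v] above the axis, and back below it. *)
Lemma rotation_gaps (v : 'I_n) : path.cycle adj (trotation v).
Proof.
have vE : pt p v = v by exact: pt_id.
have [v0 v0n v0v] := pt_shift s v.
rewrite /trotation /= rcons_cat rcons_cons -cats1.
have first_gap k : pt p ((if k == 0 then 0 + n else k) + 0)%N = pt p k.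
  by case: eqP => [->|]; rewrite addn0 // -pt_mod add0n modnn.
rewrite (@upper_path _ v0.+1 (if v0 == 0 then 0 + n else v0)%N) //=.
- rewrite (@lower_path _ v.+1 (if v == 0 :> nat then 0 + n else v)%N) //=.
  + by apply/allP => d; rewrite mem_lower_ends => /andP[].
  + have := lower_endsE wf (ltn_ord v); rewrite vE => ->; rewrite revK.
    have := @fan_chain (cod p) 0 v; rewrite leaves_cod; apply.
    by rewrite add0n ltn_ord.
  + by have := first_gap v; rewrite !addn0 => ->.
  + by rewrite addn1.
- by apply/allP => d; rewrite mem_upper_ends => /andP[].
- have := upper_endsE wf v0n; rewrite v0v => ->.
  by apply: fan_chain; exact: v0n.
- by rewrite -{1}v0v -pt_mod /= modnDml pt_mod; congr pt; lia.
- rewrite addn0 vE -v0v; apply: val_inj => /=.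
  by case: eqP => [->|//]; rewrite !add0n modnDl.
Qed.

Lemma side_gap_next x : side_gap (next_site x) false = side_gap x true.
Proof.
have := next_cycle (rotation_gaps (base x)) _ => /(_ x).
by rewrite mem_trotation eqxx => /(_ isT)/eqP->.
Qed.

Lemma side_gap_face l x : l =i enum (edge G) ->
  side_gap (face_perm l x) false = side_gap x false.
Proof.
move=> lE; rewrite face_permE side_gap_next.
case: x => [[e b]|[v b]] //; rewrite /cross_bands lE mem_enum addbT.
rewrite /side_gap /= /offset; congr (pt p (_ + _)).
by rewrite /lgap /rgap; case: e => e; case: b.
Qed.

(** The [n] marks on the west of the vertices lie in faces with distinct
    labels. *)
Lemma thompson_circles : (n <= circles (enum (edge G)))%N.
Proof.
set f := face_perm (enum (edge G)).
pose o (v : 'I_n) := porbit f (inr (v, false) : site G).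
have o_inj : injective o.
  move=> u v /eqP; rewrite eq_porbit_mem => /porbitP uv; case: uv => i.
  move/(congr1 (side_gap^~ false)); rewrite /side_gap addn0 pt_id => ->.
  rewrite -[RHS](pt_id v) -(addn0 v).
  rewrite -[RHS]/(side_gap (inr (v, false)) false).
  elim: i => [|i IH]; first by rewrite expg0 perm1.
  by rewrite expgSr permM -IH; apply: side_gap_face.
rewrite -[n in (n <= _)%N]card_ord -(card_imset _ o_inj) subset_leq_card //.
by apply/fintype.subsetP => _ /imsetP[v _ ->]; apply: imset_f.
Qed.

Lemma card_tedge : (#|edge G| + 2 = n + n)%N.
Proof.
rewrite card_sum !card_ord !tree_edgesE !size_map.
have := size_tree_nodes (dom p) 0; have := size_tree_nodes (cod p) 0.
rewrite leaves_cod; lia.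
Qed.

Lemma thompson_connected q (c : {ffun vertex G -> 'I_q}) :
  constant_on (enum (edge G)) c -> forall u v, c u = c v.
Proof.
move=> /allP cc.
suff c0 x : (x < n)%N -> c (pt p x) = c (pt p 0).
  by move=> u v; rewrite -(pt_id u) -(pt_id v) !c0.
elim: x {-2}x (leqnn x) => [|m IH] x xm xn.
  by move: xm; rewrite leqn0 => /eqP->.
case: (posnP x) => [->//|x0].
have : x \in [seq N.1.2 | N <- tree_nodes (cod p) 0].
  rewrite (perm_mem (tree_nodes_inner _ _)) mem_iota leaves_cod x0 /=; lia.
case/mapP => N NL xN; have [_ N12 _ _] := tree_nodes_bound NL.
have it : (index N (tree_nodes (cod p) 0) < size (tree_edges (cod p) 0))%N.
  by rewrite tree_edgesE size_map index_mem.
have := cc (inr (Ordinal it)) (mem_enum _ _).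
rewrite /= !(nth_tree_edges it) nth_index //.
case: N NL xN N12 it => -[a b] k /= _ xb ab _ /eqP.
by rewrite -xb => <-; apply: IH; lia.
Qed.

Lemma thompson_euler :
  (#|edge G| + 2 <= circles (enum (edge G)) + #|vertex G|)%N.
Proof. by rewrite card_tedge card_ord leq_add2r thompson_circles. Qed.

End Faces.

(** * The writhe *)

Section Writhe.
Variables (G : agraph) (conv : bool) (v0 : vertex G).
Hypothesis colorable : exists o : {ffun vertex G -> bool}, proper_coloring o.

Lemma disc_orientation_proper : proper_coloring (disc_orientation v0).
Proof.
case: colorable => o po; rewrite /disc_orientation.
case: pickP => [c' /andP[]//|/= no].
have := no (if o v0 then o else [ffun v => ~~ o v]).
case: ifP => ov0; rewrite ?po ?ov0 // ?ffunE ov0 andbT => /negP[].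
apply/forallP => e; rewrite !ffunE (inj_eq negb_inj).
by have /forallP := po; apply.
Qed.

(** The two ends of a band bear opposite orientations, so both strands of its
    crossing run in the same direction across the band: the sign of the
    crossing is that of the edge. *)
Lemma edge_crossing_sign (e : edge G) :
  crossing_sign (boundary_orientation (conv := conv) v0) e =
  if positive e == conv then 1 else -1.
Proof.
have /forallP/(_ e) := disc_orientation_proper.
rewrite /crossing_sign /boundary_orientation /=.
by do 2!case: (disc_orientation v0 _).
Qed.

End Writhe.

Lemma thompson_writhe (p : triple) (conv : bool) : wf_triple p ->
  (exists o : {ffun vertex (thompson_graph p) -> bool}, proper_coloring o) ->
  writhe (boundary_orientation (conv := conv) (leftmost p)) = 0.
Proof.
case/andP=> /eqP lE _ col; rewrite /writhe.
rewrite (eq_bigr _ (fun e _ => edge_crossing_sign conv (leftmost p) col e)).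
rewrite big_sumType /= !sumr_const !card_ord.
have -> : size (tree_edges (dom p) 0) = size (tree_edges (cod p) 0).
  have := size_tree_nodes (dom p) 0; have := size_tree_nodes (cod p) 0.
  by rewrite !tree_edgesE !size_map lE => <- [->].
by case: conv; rewrite -mulrnDl ?subrr ?addNr mul0rn.
Qed.

(** * Hilbert space completion *)

Section ComplexLimits.
Import numFieldNormedType.Exports.
Variable R : realType.
Local Notation C := R[i].

Lemma normc_real (x : R) : `|x%:C%C| = `|x|%:C%C :> C.
Proof. by rewrite normc_def /= expr0n addr0 sqrtr_sqr. Qed.

Lemma normci : `|'i%C| = 1 :> C.
Proof. by rewrite normc_def /= expr0n add0r expr1n sqrtr1. Qed.

Definition clim (u : nat -> C) (l : C) : Prop :=
  forall e, 0 < e -> exists N, forall n, (N <= n)%N -> `|u n - l| < e.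

Lemma clim_unique u l l' : clim u l -> clim u l' -> l = l'.
Proof.
move=> ul ul'; apply/eqP; rewrite -subr_eq0 -normr_le0.
apply/negPn/negP => /negP h.
have h0 : 0 < `|l - l'| by rewrite lt_neqAle eq_sym normr_ge0 andbT;
  apply: contraPneq h => ->; rewrite lexx.
have h2 : 0 < `|l - l'| / 2 by rewrite divr_gt0.
have [N1 H1] := ul _ h2; have [N2 H2] := ul' _ h2.
have := ltrD (H1 _ (leq_maxl N1 N2)) (H2 _ (leq_maxr N1 N2)).
rewrite -splitr [`|u _ - l|]distrC => /lt_le_trans/(_ (le_trans _ (lexx _))).
have := ler_normD (l - u (maxn N1 N2)) (u (maxn N1 N2) - l').
rewrite addrA subrK => h3 /(_ _ h3); by rewrite ltxx.
Qed.

Lemma clim_cst l : clim (fun=> l) l.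
Proof. by move=> e e0; exists 0 => n _; rewrite subrr normr0. Qed.

Lemma clim_lin a u v l m : clim u l -> clim v m ->
  clim (fun n => a * u n + v n) (a * l + m).
Proof.
move=> ul vm e e0.
have a0 : 0 < `|a| + 1 by rewrite ltr_wpDl.
have e1 : 0 < e / 2 / (`|a| + 1) by rewrite !divr_gt0.
have e2 : 0 < e / 2 by rewrite divr_gt0.
have [N1 H1] := ul _ e1; have [N2 H2] := vm _ e2.
exists (maxn N1 N2) => n; rewrite geq_max => /andP[n1 n2].
have -> : a * u n + v n - (a * l + m) = a * (u n - l) + (v n - m) by ring.
apply: le_lt_trans (ler_normD _ _) _; rewrite [e]splitr ler_ltD ?H2 //.
rewrite normrM; have := H1 _ n1; rewrite ltr_pdivlMr // mulrC => h.
apply: le_trans (ltW h); apply: ler_wpM2r => //; by rewrite lerDl.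
Qed.

Lemma clim_conj u l : clim u l -> clim (fun n => Num.conj (u n)) (Num.conj l).
Proof.
move=> ul e /ul[N H]; exists N => n /H.
by rewrite -rmorphB /= norm_conjC.
Qed.

Lemma clim_ge0 u l : clim u l -> (forall n, 0 <= u n) -> 0 <= l.
Proof.
move=> ul u0; have lR : l \is Num.real.
  have cl := clim_conj ul; apply/CrealP; apply: clim_unique ul; move: cl.
  by congr clim; apply/funext => n; apply/CrealP/ger0_real.
case/real_ge0P: lR => // l0.
have [|N /(_ N (leqnn _))] := ul (- l); first by rewrite oppr_gt0.
rewrite ger0_norm; last by rewrite addr_ge0 // oppr_ge0 ltW.
by rewrite gtrDr => /lt_geF; rewrite u0.
Qed.

Lemma clim_exists (u : nat -> C) :
  (forall e, 0 < e -> exists N, forall i j, (N <= i)%N -> (N <= j)%N ->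
     `|u i - u j| < e) -> exists l, clim u l.
Proof.
move=> cu.
have lim_part (f : C -> R) : (forall x y, f (x - y) = f x - f y) ->
    (forall z, `|f z|%:C%C <= `|z|) ->
    exists l : R, forall e : R, 0 < e -> exists N, forall n, (N <= n)%N ->
      `|f (u n) - l| < e.
  move=> fB fle.
  have : cvg ((f \o u) @ \oo)%classic.
    apply/cauchy_cvgP/cauchy_exP => e e0.
    have [N H] := cu e%:C%C ltac:(by rewrite ltcR).
    exists (f (u N)); exists N => // n /= Nn.
    rewrite /ball /= -fB -ltcR; apply: le_lt_trans (fle _) _.
    exact: H.
  move=> /cvg_ex[l /cvgrPdist_lt cl]; exists l => e /cl[N _ H].
  by exists N => n /H /=; rewrite distrC.
have [||a Ha] := lim_part (@complex.Re R).
- by move=> [x1 x2] [y1 y2].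
- exact: normc_ge_Re.
have [||b Hb] := lim_part (@complex.Im R).
- by move=> [x1 x2] [y1 y2].
- move=> z; have := normc_ge_Re (z * 'i%C).
  by rewrite ReiNIm normrN normrM normci mulr1.
exists (a +i* b)%C => e e0.
have [e1 e1E] : exists e1 : R, e = e1%:C%C.
  by exists (complex.Re e); rewrite RRe_real // gtr0_real.
have e1_0 : 0 < e1 / 2 by rewrite divr_gt0 // -ltcR -e1E.
have [N1 H1] := Ha _ e1_0; have [N2 H2] := Hb _ e1_0.
exists (maxn N1 N2) => n; rewrite geq_max => /andP[/H1 n1 /H2 n2].
move: n1 n2; case: (u n) => x y /= n1 n2.
rewrite [_ - _](_ : _ = (x - a)%:C%C + 'i%C * (y - b)%:C%C); last first.
  by rewrite [LHS]complexE.
apply: le_lt_trans (ler_normD _ _) _; rewrite normrM normci mul1r !normc_real.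
by rewrite e1E -rmorphD /= ltcR [e1]splitr ltrD.
Qed.
End ComplexLimits.

Record prehilbert (R : realType) := PreHilbert {
  pcar :> lmodType R[i];
  pdot : pcar -> pcar -> R[i];
  pdot_lin : forall a u v w,
    pdot (a *: u + v) w = a * pdot u w + pdot v w;
  pdot_herm : forall u v, pdot u v = Num.conj (pdot v u);
  pdot_ge0 : forall u, 0 <= pdot u u
}.

Section PreHilbertTheory.
Variables (R : realType) (V : prehilbert R).
Local Notation C := R[i].
Local Notation B := (@pdot R V).
Local Notation q u := (B u u).
Implicit Types u v w x y : V.

Lemma pdotZl a u w : B (a *: u) w = a * B u w.
Proof.
have B0 : B 0 w = 0.
  have := pdot_lin 1 0 0 w; rewrite scaler0 addr0 mul1r => /eqP.
  by rewrite -subr_eq0 opprD addrA subrr sub0r oppr_eq0 => /eqP.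
by have := pdot_lin a u 0 w; rewrite addr0 B0 addr0.
Qed.

Lemma pdotDl u v w : B (u + v) w = B u w + B v w.
Proof. by have := pdot_lin 1 u v w; rewrite scale1r mul1r. Qed.

Lemma pdotBl u v w : B (u - v) w = B u w - B v w.
Proof. by rewrite pdotDl -scaleN1r pdotZl mulN1r. Qed.

Lemma pdotDr u v w : B w (u + v) = B w u + B w v.
Proof. by rewrite pdot_herm pdotDl rmorphD /= -!pdot_herm. Qed.

Lemma pdotZr a u w : B w (a *: u) = Num.conj a * B w u.
Proof. by rewrite pdot_herm pdotZl rmorphM /= -pdot_herm. Qed.

Lemma pdotBr u v w : B w (u - v) = B w u - B w v.
Proof. by rewrite pdot_herm pdotBl rmorphB /= -!pdot_herm. Qed.

Lemma norm_pdotC u v : `|B u v| = `|B v u|.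
Proof. by rewrite pdot_herm norm_conjC. Qed.

(** The form may be degenerate.  If [v] is a null vector and [<u, v> = c] is not
    zero, subtracting from [u] a large multiple of [v] would give a negative
    square. *)
Lemma pdot_cauchy_schwarz u v : `|B u v| ^+ 2 <= q u * q v.
Proof.
set c := B u v.
have exp (a b : C) : 0 <= a -> q (a *: u - b *: v) =
    a ^+ 2 * q u - (a * (Num.conj b * c) + a * (b * Num.conj c)) +
    `|b| ^+ 2 * q v.
  move=> a0; rewrite !(pdotBl, pdotBr, pdotZl, pdotZr) -/c (pdot_herm v u) -/c.
  rewrite (CrealP (ger0_real a0)) normCK; ring.
have [v0|v0] := eqVneq (q v) 0; last first.
  have qv : 0 < q v by rewrite lt_def v0 pdot_ge0.
  have := pdot_ge0 (q v *: u - c *: v).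
  rewrite exp ?pdot_ge0 //.
  have -> : q v ^+ 2 * q u - (q v * (Num.conj c * c) + q v * (c * Num.conj c)) +
      `|c| ^+ 2 * q v = q v * (q u * q v - `|c| ^+ 2).
    by rewrite normCK; ring.
  by rewrite pmulr_rge0 // subr_ge0.
have [->|c0] := eqVneq c 0; first by rewrite normr0 expr0n mulr_ge0 ?pdot_ge0.
have nc : 0 < `|c| ^+ 2 by rewrite exprn_gt0 // normr_gt0.
have := pdot_ge0 (1 *: u - ((q u + 1) / `|c| ^+ 2 * c) *: v).
rewrite exp // v0 mulr0 addr0 expr1n !mul1r rmorphM /=.
have cr : Num.conj ((q u + 1) / `|c| ^+ 2) = (q u + 1) / `|c| ^+ 2.
  by apply/CrealP/ger0_real; rewrite divr_ge0 ?addr_ge0 ?pdot_ge0 // ltW.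
rewrite cr [X in 0 <= X](_ : _ = - (1 + (q u + 1))); last first.
  transitivity (q u - ((q u + 1) / `|c| ^+ 2 * `|c| ^+ 2 +
                       (q u + 1) / `|c| ^+ 2 * `|c| ^+ 2)).
    by rewrite [in X in _ * X + _ * X]normCK; ring.
  by rewrite divfK ?gt_eqF //; ring.
move=> h; have : 0 < 1 + (q u + 1) :> C.
  by rewrite ltr_pwDl // addr_ge0 // pdot_ge0.
by rewrite -oppr_lt0 => /lt_geF; rewrite h.
Qed.

Lemma pdot_parallelogram u v : q (u + v) + q (u - v) = 2 * (q u + q v).
Proof. rewrite !(pdotBl, pdotBr, pdotDl, pdotDr); ring. Qed.

Lemma pdot_add_le u v : q (u + v) <= 2 * (q u + q v).
Proof. by rewrite -pdot_parallelogram lerDl pdot_ge0. Qed.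

(** Continuity of the form on bounded sets, without square roots. *)
Lemma pdot_small (e M : C) : 0 < e -> 0 <= M -> exists2 d, 0 < d &
  forall x y, q x < d -> q y <= M -> `|B x y| < e.
Proof.
move=> e0 M0; have M1 : 0 < M + 1 by rewrite ltr_wpDl.
exists (e ^+ 2 / (M + 1)); first by rewrite divr_gt0 ?exprn_gt0.
move=> x y xd yM; rewrite -(@ltr_pXn2r _ 2) ?nnegrE ?(ltW e0) //.
apply: le_lt_trans (pdot_cauchy_schwarz x y) _.
rewrite ltr_pdivlMr // in xd; apply: le_lt_trans xd.
by rewrite ler_wpM2l ?pdot_ge0 // (le_trans yM) // lerDl.
Qed.

Definition vcauchy (u : nat -> V) : Prop :=
  forall e : C, 0 < e -> exists N, forall i j, (N <= i)%N -> (N <= j)%N ->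
    q (u i - u j) < e.

Lemma vcauchy_bounded (u : nat -> V) : vcauchy u -> exists2 M, 0 <= M &
  exists N, forall n, (N <= n)%N -> q (u n) <= M.
Proof.
move=> /(_ 1 ltr01)[N H]; exists (2 * (1 + q (u N))).
  by rewrite mulr_ge0 // addr_ge0 // pdot_ge0.
exists N => n Nn; rewrite -[u n](subrK (u N)).
apply: le_trans (pdot_add_le _ _) _; rewrite ler_wpM2l // lerD2r.
exact/ltW/H.
Qed.

End PreHilbertTheory.

Section Completion.
Variables (R : realType) (V : prehilbert R).
Local Notation C := R[i].
Local Notation B := (@pdot R V).
Local Notation q u := (B u u).

(** A point of the completion is represented by the functional
    [fun v => lim <u n, v>] for a Cauchy sequence [u]: so no quotient of the
    space of Cauchy sequences is needed. *)
Definition represented (u : nat -> V) (f : V -> C) : Prop :=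
  vcauchy u /\ forall v, clim (fun n => B (u n) v) (f v).

Definition in_completion : {pred V -> C^o} :=
  fun f => `[< exists u, represented u f >].

Lemma represented_lin a u w f g : represented u f -> represented w g ->
  represented (fun n => a *: u n + w n) (fun v => a * f v + g v).
Proof.
move=> [cu uf] [cw wg]; split; last first.
  move=> v; have := clim_lin a (uf v) (wg v).
  by congr clim; apply/funext => n; rewrite pdot_lin.
move=> e e0.
have a0 : 0 < `|a| ^+ 2 + 1 by rewrite ltr_wpDl // exprn_ge0.
have e1 : 0 < e / 4 / (`|a| ^+ 2 + 1) by rewrite !divr_gt0 // ltr0n.
have e2 : 0 < e / 4 by rewrite divr_gt0 // ltr0n.
have [N1 H1] := cu _ e1; have [N2 H2] := cw _ e2.
exists (maxn N1 N2) => i j; rewrite !geq_max => /andP[i1 i2] /andP[j1 j2].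
rewrite (_ : _ - _ = a *: (u i - u j) + (w i - w j)); last first.
  by rewrite scalerBr opprD addrACA.
apply: le_lt_trans (pdot_add_le _ _) _.
rewrite [q (a *: _)](_ : _ = `|a| ^+ 2 * q (u i - u j)); last first.
  by rewrite pdotZl pdotZr mulrA normCK.
have h1 := H1 _ _ i1 j1; have h2 := H2 _ _ i2 j2.
rewrite ltr_pdivlMr // in h1.
have h3 : `|a| ^+ 2 * q (u i - u j) < e / 4.
  apply: le_lt_trans h1; rewrite mulrC ler_wpM2l ?pdot_ge0 //.
  by rewrite lerDl.
have -> : e = 2 * (e / 4 + e / 4) by field.
by rewrite ltr_pM2l ?ltr0n // ltrD.
Qed.

Lemma represented_cst v : represented (fun=> v) (B v).
Proof.
split=> [e e0|w]; last exact: clim_cst.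
by exists 0%N => i j _ _; rewrite subrr (_ : q 0 = 0) // -(scale0r (0 : V)) pdotZl mul0r.
Qed.

Lemma in_completion_submod : GRing.submod_closed in_completion.
Proof.
split.
  apply/asboolP; exists (fun=> 0); have := represented_cst 0.
  congr (represented _ _); apply/funext => v.
  by rewrite -(scale0r (0 : V)) pdotZl mul0r.
move=> a f g /asboolP[u uf] /asboolP[w wg]; apply/asboolP.
by exists (fun n => a *: u n + w n); exact: represented_lin.
Qed.

HB.instance Definition _ :=
  GRing.isSubmodClosed.Build C (V -> C^o) in_completion in_completion_submod.

Record completion := Completion {
  functional : V -> C^o; _ : functional \in in_completion }.
HB.instance Definition _ := [isSub for functional].
HB.instance Definition _ := gen_eqMixin completion.
HB.instance Definition _ := gen_choiceMixin completion.
HB.instance Definition _ := [SubChoice_isSubLmodule of completion by <:].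
End Completion.

Section CompletionDot.
Variables (R : realType) (V : prehilbert R).
Local Notation C := R[i].
Local Notation B := (@pdot R V).
Local Notation q u := (B u u).
Local Notation H := (completion V).
Implicit Types (f g : H) (u w : nat -> V).

Lemma rep_exists f : exists u, represented u (functional f).
Proof. by apply/asboolP; case: f. Qed.

Definition rep f : nat -> V := sval (cid (rep_exists f)).

Lemma repP f : represented (rep f) (functional f).
Proof. exact: svalP (cid (rep_exists f)). Qed.

Definition null_seq u : Prop :=
  forall e : C, 0 < e -> exists N, forall n, (N <= n)%N -> q (u n) < e.

(** A Cauchy sequence converging weakly to 0 converges to 0, as
    [<u n, u n> = <u n, u n - u m> + <u n, u m>] with [m] large and then [n]
    large. *)
Lemma represented_null u : represented u (fun=> 0) -> null_seq u.
Proof.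
move=> [cu uf] e e0; have e2 : 0 < e / 2 by rewrite divr_gt0.
have [M M0 [N0 H0]] := vcauchy_bounded cu.
have [d d0 hd] := pdot_small V e2 M0.
have [N1 H1] := cu _ d0; pose m := maxn N0 N1.
have [N2 H2] := uf (u m) _ e2.
exists (maxn m N2) => n; rewrite !geq_max => /andP[/andP[n0 n1] n2].
rewrite -(ger0_norm (pdot_ge0 (u n))).
rewrite (_ : q (u n) = B (u n) (u n - u m) + B (u n) (u m)); last first.
  by rewrite -pdotDr subrK.
apply: le_lt_trans (ler_normD _ _) _; rewrite [e]splitr ltrD //.
  rewrite norm_pdotC hd ?H0 // H1 //; exact: leq_maxr.
by have := H2 n n2; rewrite subr0.
Qed.

Lemma null_dot u w : null_seq u -> vcauchy w ->
  clim (fun n => B (u n) (w n)) 0.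
Proof.
move=> nu cw e e0; have [M M0 [N0 H0]] := vcauchy_bounded cw.
have [d d0 hd] := pdot_small V e0 M0; have [N1 H1] := nu _ d0.
exists (maxn N0 N1) => n; rewrite geq_max => /andP[n0 n1].
by rewrite subr0 hd ?H0 ?H1.
Qed.

Lemma represented_sub u u' (f : V -> C) :
  represented u f -> represented u' f -> null_seq (fun n => u n - u' n).
Proof.
move=> uf u'f; apply: represented_null.
have := represented_lin (-1) u'f uf.
congr represented; first by apply/funext => n; rewrite scaleN1r addrC.
by apply/funext => v; rewrite mulN1r addNr.
Qed.

Lemma dot_clim_unique u u' w w' (f g : V -> C) l :
  represented u f -> represented u' f -> represented w g -> represented w' g ->
  clim (fun n => B (u n) (w n)) l -> clim (fun n => B (u' n) (w' n)) l.
Proof.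
move=> uf u'f wg w'g ul.
have c1 := null_dot (represented_sub u'f uf) w'g.1.
have c2 := clim_conj (null_dot (represented_sub w'g wg) uf.1).
have := clim_lin 1 c1 (clim_lin 1 c2 ul).
rewrite rmorph0 !mul1r !add0r; congr clim; apply/funext => n.
rewrite !mul1r -pdot_herm pdotBl pdotBr; ring.
Qed.

Lemma dot_clim_exists u w : vcauchy u -> vcauchy w ->
  exists l, clim (fun n => B (u n) (w n)) l.
Proof.
move=> cu cw; apply: clim_exists => e e0.
have e2 : 0 < e / 2 by rewrite divr_gt0.
have [M1 M10 [N1 H1]] := vcauchy_bounded cu.
have [M2 M20 [N2 H2]] := vcauchy_bounded cw.
have [d1 d10 hd1] := pdot_small V e2 M10.
have [d2 d20 hd2] := pdot_small V e2 M20.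
have [N3 H3] := cw _ d10; have [N4 H4] := cu _ d20.
exists (maxn (maxn N1 N2) (maxn N3 N4)) => i j.
rewrite !geq_max => /andP[/andP[i1 i2] /andP[i3 i4]].
move=> /andP[/andP[j1 j2] /andP[j3 j4]].
rewrite (_ : _ - _ = B (u i - u j) (w i) + B (u j) (w i - w j)); last first.
  rewrite pdotBl pdotBr; ring.
apply: le_lt_trans (ler_normD _ _) _; rewrite [e]splitr ltrD //.
  by rewrite hd2 ?H2 // H4.
by rewrite norm_pdotC hd1 ?H1 // H3.
Qed.

Lemma cdot_exists f g : exists l, clim (fun n => B (rep f n) (rep g n)) l.
Proof. by apply: dot_clim_exists; [case: (repP f)|case: (repP g)]. Qed.

Definition cdot f g : C := sval (cid (cdot_exists f g)).

Lemma cdotP u w f g :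
  represented u (functional f) -> represented w (functional g) ->
  clim (fun n => B (u n) (w n)) (cdot f g).
Proof.
move=> uf wg; have cl := svalP (cid (cdot_exists f g)).
exact: dot_clim_unique (repP f) uf (repP g) wg cl.
Qed.

Lemma cdot_lin a f g h : cdot (a *: f + g) h = a * cdot f h + cdot g h.
Proof.
have r := represented_lin a (repP f) (repP g).
have c := cdotP (f := a *: f + g) r (repP h).
apply: clim_unique c _.
have := clim_lin a (cdotP (repP f) (repP h)) (cdotP (repP g) (repP h)).
by congr clim; apply/funext => n; rewrite pdot_lin.
Qed.

Lemma cdot_herm f g : cdot f g = Num.conj (cdot g f).
Proof.
apply: clim_unique (cdotP (repP f) (repP g)) _.
have := clim_conj (cdotP (repP g) (repP f)).
by congr clim; apply/funext => n; rewrite -pdot_herm.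
Qed.

Lemma cdot_gt0 f : f != 0 -> 0 < cdot f f.
Proof.
move=> f0; rewrite lt_def; apply/andP; split; last first.
  by apply: clim_ge0 (cdotP (repP f) (repP f)) _ => n; exact: pdot_ge0.
apply: contra_neq f0 => d0.
have nu : null_seq (rep f).
  move=> e /(cdotP (repP f) (repP f))[N H]; exists N => n /H.
  by rewrite d0 subr0 ger0_norm // pdot_ge0.
apply: val_inj; apply/funext => v /=; have [_ /(_ v) cf] := repP f.
apply: clim_unique cf _; apply: null_dot nu _.
exact: (represented_cst v).1.
Qed.

Lemma cdot_bilinear : bilinear_for
  (GRing.Scale.Law.clone _ _ ( *%R ) _)
  (GRing.Scale.Law.clone _ _ (Num.conj \; *%R ) _) cdot.
Proof.
split=> [f a g h|f a g h]; first exact: cdot_lin.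
rewrite cdot_herm cdot_lin rmorphD rmorphM /=.
by rewrite -!cdot_herm.
Qed.

HB.instance Definition _ := bilinear_isBilinear.Build C H H C
  (GRing.Scale.Law.clone _ _ ( *%R ) _)
  (GRing.Scale.Law.clone _ _ (Num.conj \; *%R ) _) cdot cdot_bilinear.

Lemma cdot_hermitian f g : cdot f g = (-1) ^+ false * Num.conj (cdot g f).
Proof. by rewrite mul1r cdot_herm. Qed.

HB.instance Definition _ :=
  isHermitianSesquilinear.Build C H false Num.conj cdot cdot_hermitian.
HB.instance Definition _ := isDotProduct.Build C H cdot cdot_gt0.

End CompletionDot.

Section CompletionComplete.
Variables (R : realType) (V : prehilbert R).
Local Notation C := R[i].
Local Notation B := (@pdot R V).
Local Notation q u := (B u u).
Local Notation H := (completion V).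
Implicit Types (f g : H) (u w : nat -> V).

Lemma completion_of (u : nat -> V) : vcauchy u ->
  exists f : H, represented u (functional f).
Proof.
move=> cu.
have lim v : exists l, clim (fun n => B (u n) v) l.
  exact: dot_clim_exists cu (represented_cst v).1.
pose F v : C^o := sval (cid (lim v)).
have uF : represented u F by split=> // v; exact: svalP (cid (lim v)).
have inF : F \in @in_completion R V by apply/asboolP; exists u.
by exists (Completion inF).
Qed.

Lemma embed_in v : (B v : V -> C^o) \in @in_completion R V.
Proof. by apply/asboolP; exists (fun=> v); exact: represented_cst. Qed.

Definition embed v : H := Completion (embed_in v).

Lemma embed_rep v : represented (fun=> v) (functional (embed v)).
Proof. exact: represented_cst. Qed.

Lemma cdot_embed v v' : cdot (embed v) (embed v') = B v v'.
Proof.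
exact: clim_unique (cdotP (embed_rep v) (embed_rep v')) (clim_cst _).
Qed.

Lemma embedB v v' : embed (v - v') = embed v - embed v'.
Proof. by apply: val_inj; apply/funext => x /=; rewrite pdotBl. Qed.

(** This makes the inequalities proved above available for the completion. *)
Definition cprehilbert : prehilbert R :=
  {| pcar := H; pdot := @cdot R V; pdot_lin := @cdot_lin R V;
     pdot_herm := @cdot_herm R V;
     pdot_ge0 := fun f => dnorm_ge0 (@cdot R V) f |}.

Lemma cdot_add_le f g : cdot (f + g) (f + g) <= 2 * (cdot f f + cdot g g).
Proof. exact: (pdot_add_le (V := cprehilbert)). Qed.

Lemma cdotN f : cdot (- f) (- f) = cdot f f.
Proof. by rewrite linearNl linearNr opprK. Qed.

Lemma embed_dense (u : nat -> V) f : represented u (functional f) ->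
  forall e : C, 0 < e -> exists N, forall n, (N <= n)%N ->
    cdot (f - embed (u n)) (f - embed (u n)) < e.
Proof.
move=> uf e e0; have e2 : 0 < e / 2 by rewrite divr_gt0.
have [N HN] := uf.1 _ e2; exists N => n Nn.
have r : represented (fun m => u m - u n) (functional (f - embed (u n))).
  have := represented_lin (-1) (embed_rep (u n)) uf.
  congr represented; first by apply/funext => m; rewrite scaleN1r addrC.
  by apply/funext => v; rewrite /= mulN1r addrC.
apply: (@le_lt_trans _ _ (e / 2)); last by rewrite ltr_pdivrMr // ltr_pMr // ltr1n.
rewrite -subr_ge0.
have cl := clim_lin (-1) (cdotP r r) (clim_cst (e / 2)).
rewrite [X in 0 <= X](_ : _ = -1 * cdot (f - embed (u n)) (f - embed (u n)) + e / 2);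
  last by rewrite mulN1r addrC.
have shift_lim (v : nat -> C) l : clim v l -> clim (fun m => v (m + N)%N) l.
  move=> vl d /vl[M HM]; exists M => m Mm; apply: HM.
  exact: leq_trans Mm (leq_addr _ _).
apply: clim_ge0 (shift_lim _ _ cl) _ => m.
by rewrite mulN1r addrC subr_ge0 ltW // HN // leq_addl.
Qed.

(** Replacing each term of the sequence by a vector of [V] at distance tending
    to 0, one gets a Cauchy sequence in [V], whose class is the limit. *)
Lemma completion_complete (u : nat -> H) :
  (forall e : C, 0 < e -> exists N, forall i j, (N <= i)%N -> (N <= j)%N ->
     cdot (u i - u j) (u i - u j) < e) ->
  exists l, forall e : C, 0 < e -> exists N, forall i, (N <= i)%N ->
     cdot (u i - l) (u i - l) < e.
Proof.
move=> cu.
have approx k : exists v, cdot (u k - embed v) (u k - embed v) < k.+1%:R^-1.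
  have [|N HN] := embed_dense (repP (u k)) (e := k.+1%:R^-1).
    by rewrite invr_gt0 ltr0n.
  by exists (rep (u k) N); exact: HN.
pose w k := sval (cid (approx k)).
have wP k : cdot (u k - embed (w k)) (u k - embed (w k)) < k.+1%:R^-1.
  exact: svalP (cid (approx k)).
have small e : 0 < e :> C -> exists N, forall k, (N <= k)%N ->
    cdot (u k - embed (w k)) (u k - embed (w k)) < e.
  move=> e0; have [e1 e1E] : exists e1 : R, e = e1%:C%C.
    by exists (complex.Re e); rewrite RRe_real // gtr0_real.
  have e10 : 0 < e1 by rewrite -ltcR -e1E.
  exists (Num.truncn e1^-1) => k Nk; apply: lt_le_trans (wP k) _.
  rewrite e1E (_ : k.+1%:R = k.+1%:R%:C%C); last by rewrite rmorph_nat.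
  rewrite -fmorphV lecR -[leRHS]invrK lef_pV2 ?posrE ?ltr0n ?invr_gt0 //.
  apply/ltW/(lt_le_trans (truncnS_gt _)).
  by rewrite ler_nat.
have cw : vcauchy w.
  move=> e e0.
  (* the parallelogram inequality is used twice: 2 (1 + 2 (1 + 1)) = 10 *)
  have e8 : 0 < e / 10 by rewrite divr_gt0 // ltr0n.
  have [N1 H1] := small _ e8; have [N2 H2] := cu _ e8.
  exists (maxn N1 N2) => i j; rewrite !geq_max => /andP[i1 i2] /andP[j1 j2].
  rewrite -cdot_embed embedB.
  have -> : embed (w i) - embed (w j) =
      - (u i - embed (w i)) + ((u i - u j) + (u j - embed (w j))).
    by rewrite opprB !subrKA.
  apply: le_lt_trans (cdot_add_le _ _) _.
  rewrite cdotN.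
  have h1 := H1 _ i1; have h2 := H2 _ _ i2 j2; have h3 := H1 _ j1.
  have h4 := cdot_add_le (u i - u j) (u j - embed (w j)).
  have h5 : cdot (u i - embed (w i)) (u i - embed (w i)) +
    cdot (u i - u j + (u j - embed (w j))) (u i - u j + (u j - embed (w j))) <
    e / 10 + 2 * (e / 10 + e / 10).
    rewrite ltrD //; apply: le_lt_trans h4 _.
    by rewrite ltr_pM2l ?ltr0n // ltrD.
  have -> : e = 2 * (e / 2) by field.
  rewrite ltr_pM2l ?ltr0n //; apply: lt_le_trans h5 _.
  rewrite le_eqVlt; apply/orP; left; apply/eqP.
  by field; rewrite ?pnatr_eq0.
have [l wl] := completion_of cw; exists l => e e0.
have e4 : 0 < e / 4 by rewrite divr_gt0 // ltr0n.
have [N1 H1] := small _ e4; have [N2 H2] := embed_dense wl e4.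
exists (maxn N1 N2) => i; rewrite geq_max => /andP[i1 i2].
rewrite -[u i](subrK (embed (w i))) -addrA.
apply: le_lt_trans (cdot_add_le _ _) _; rewrite -[embed _ - l]opprB cdotN.
have -> : e = 2 * (e / 4 + e / 4) by field.
by rewrite ltr_pM2l ?ltr0n //; apply: ltrD; [exact: H1|exact: H2].
Qed.

Definition completion_hilbert : hilbert R :=
  @Hilbert R H (@cdot R V) completion_complete.

End CompletionComplete.

(** An isometric action on a pre-Hilbert space extends to the completion: on
    functionals it is composition with the inverse. *)
Theorem unitary_extension (R : realType) (V : prehilbert R) (G : groupType)
    (K : set G) (act : G -> V -> V) (xi : V)
    (K1 : K 1%g) (KM : forall g h, K g -> K h -> K (g * h)%g)
    (KV : forall g, K g -> K (g^-1)%g)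
    (act_lin : forall g, K g -> linear (act g))
    (act_iso : forall g, K g -> forall u v, pdot (act g u) (act g v) = pdot u v)
    (act1 : act 1%g =1 id)
    (actM : forall g h, K g -> K h -> act (g * h)%g =1 act g \o act h) :
  exists (H : hilbert R) (rho : G -> H -> H) (x : H),
    unitary_representation K rho /\
    forall g, K g -> hdot H (rho g x) x = pdot (act g xi) xi.
Proof.
have actVK g : K g -> cancel (act g) (act g^-1%g).
  by move=> Kg v; have := actM _ _ (KV _ Kg) Kg v; rewrite mulVg act1.
have actKV g : K g -> cancel (act g^-1%g) (act g).
  by move=> Kg v; have := actM _ _ Kg (KV _ Kg) v; rewrite mulgV act1.
have adj g : K g -> forall u v, pdot (act g u) v = pdot u (act g^-1%g v).
  by move=> Kg u v; rewrite -{1}(actKV g Kg v) act_iso.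
have move_rep g u (f : V -> R[i]) : K g -> represented u f ->
    represented (act g \o u) (f \o act g^-1%g).
  move=> Kg [cu uf]; split=> [e e0|v].
    have [N HN] := cu e e0; exists N => i j Ni Nj /=.
    have -> : act g (u i) - act g (u j) = act g (u i - u j).
      rewrite -scaleN1r addrC -act_lin // scaleN1r addrC //.
    by rewrite act_iso // HN.
  have := uf (act g^-1%g v); congr clim.
  by apply/funext => n; rewrite /= adj.
pose H := completion_hilbert V.
have inr g (f : H) : K g ->
    ((functional f \o act g^-1%g) : V -> R[i]^o) \in @in_completion R V.
  move=> Kg; apply/asboolP; exists (act g \o rep f).
  exact: move_rep Kg (repP f).
pose rho g (f : H) : H := insubd (0 : H) (functional f \o act g^-1%g).
have rhoE g f : K g -> functional (rho g f) = functional f \o act g^-1%g.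
  by move=> Kg; exact: (insubdK (0 : H) (inr g f Kg)).
have rho_rep g u f : K g -> represented u (functional f) ->
    represented (act g \o u) (functional (rho g f)).
  by move=> Kg uf; rewrite rhoE //; exact: move_rep.
exists H, rho, (embed xi); split; last first.
  move=> g Kg; rewrite -(cdot_embed (act g xi) xi).
  apply: (@clim_unique R (fun=> pdot (act g xi) xi)).
    exact: cdotP (rho_rep _ _ _ Kg (embed_rep xi)) (embed_rep xi).
  exact: cdotP (embed_rep _) (embed_rep _).
have rhoM g h : K g -> K h -> rho (g * h)%g =1 rho g \o rho h.
  move=> Kg Kh f; apply: val_inj; apply/funext => v /=.
  rewrite (rhoE _ _ (KM _ _ Kg Kh)) (rhoE _ _ Kg) /= (rhoE _ _ Kh) /= invMg.
  by rewrite (actM _ _ (KV _ Kh) (KV _ Kg)).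
have rho1 : rho 1%g =1 id.
  by move=> f; apply: val_inj; apply/funext => v /=; rewrite rhoE //= invg1 act1.
split=> // g Kg; split.
- move=> a f h; apply: val_inj; apply/funext => v /=.
  by rewrite rhoE //= !rhoE.
- move=> f h; apply: clim_unique (cdotP (repP f) (repP h)).
  have := cdotP (rho_rep _ _ _ Kg (repP f)) (rho_rep _ _ _ Kg (repP h)).
  by congr clim; apply/funext => n /=; rewrite act_iso.
move=> f; exists (rho g^-1%g f).
by have := rhoM _ _ Kg (KV _ Kg) f; rewrite mulgV rho1 /= => <-.
Qed.

(** The sum is the square of the norm of [\sum_j c_j rho(g_j) x]. *)
Lemma coefficient_positive_type (R : realType) (G : groupType) (K : set G)
    (H : hilbert R) (rho : G -> H -> H) (x : H)
    (KM : forall g h, K g -> K h -> K (g * h)%g)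
    (KV : forall g, K g -> K (g^-1)%g) :
  unitary_representation K rho ->
  positive_type K (fun g => hdot H (rho g x) x).
Proof.
move=> [rhoU rho1 rhoM] m g c Kg.
pose y := \sum_(j < m) c j *: rho (g j) x.
suff -> : \sum_(i < m) \sum_(j < m) Num.conj (c i) * c j *
    hdot H (rho ((g i)^-1 * g j)%g x) x = hdot H y y by exact: dnorm_ge0.
rewrite linear_sumr; apply: eq_bigr => i _.
rewrite linear_sumlz; apply: eq_bigr => j _.
rewrite [RHS]linearZr_LR [in RHS]linearZl_LR /= mulrA; congr (_ * _).
have [_ iso _] := rhoU _ (Kg i).
have := rhoM _ _ (Kg i) (KM _ _ (KV _ (Kg i)) (Kg j)) x.
by rewrite mulgA mulgV mul1g /= => ->; rewrite iso.
Qed.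

(** * Functions of finitely many colors *)

Section Cylinder.
Variables (R : realType) (X : choiceType) (q : nat).
Local Notation C := R[i].
Local Notation color := 'I_q.+1.
Local Notation config := (X -> color).
Implicit Types (f : config -> C) (c : config) (E : seq X).

Definition depends_on (E : seq X) (f : config -> C) : Prop :=
  forall c c', {in E, c =1 c'} -> f c = f c'.

Definition recolor c (x : X) (a : color) : config :=
  fun y => if y == x then a else c y.

Definition avg (x : X) f : config -> C :=
  fun c => q.+1%:R^-1 * \sum_(a < q.+1) f (recolor c x a).

Definition avg_seq E f : config -> C := foldr avg f E.

Lemma qS0 : q.+1%:R != 0 :> C.
Proof. by rewrite pnatr_eq0. Qed.

Lemma depends_on_sub E E' f : {subset E <= E'} ->
  depends_on E f -> depends_on E' f.
Proof. by move=> EE' fE c c' cc'; apply: fE => x /EE'/cc'. Qed.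

Lemma recolor_recolor c x a b : recolor (recolor c x a) x b = recolor c x b.
Proof. by apply/funext => y; rewrite /recolor; case: eqP. Qed.

Lemma recolorC c x y a b : x != y ->
  recolor (recolor c x a) y b = recolor (recolor c y b) x a.
Proof.
move=> xy; apply/funext => z; rewrite /recolor.
by case: eqP => [->|//]; rewrite eq_sym (negbTE xy).
Qed.

Lemma avg_indep x f : (forall c a, f (recolor c x a) = f c) -> avg x f = f.
Proof.
move=> fx; apply/funext => c; rewrite /avg (eq_bigr (fun=> f c)) //.
by rewrite sumr_const card_ord -(mulr_natl (f c)) mulKf // qS0.
Qed.

Lemma avg_idem x f : avg x (avg x f) = avg x f.
Proof.
apply: avg_indep => c a; rewrite /avg; congr (_ * _).
by apply: eq_bigr => b _; rewrite recolor_recolor.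
Qed.

Lemma avgC x y f : avg x (avg y f) = avg y (avg x f).
Proof.
case: (eqVneq x y) => [->//|xy]; apply/funext => c; rewrite /avg.
congr (_ * _); rewrite -!mulr_sumr; congr (_ * _); rewrite exchange_big.
by apply: eq_bigr => a _; apply: eq_bigr => b _; rewrite recolorC.
Qed.

Lemma avg_avg_seq x E f : avg_seq E (avg x f) = avg x (avg_seq E f).
Proof. by elim: E => //= y E ->; rewrite avgC. Qed.

Lemma avg_seqC E E' f :
  avg_seq E (avg_seq E' f) = avg_seq E' (avg_seq E f).
Proof. by elim: E' => //= x E' IH; rewrite avg_avg_seq IH. Qed.

Lemma avg_seq_absorb x E f : x \in E -> avg x (avg_seq E f) = avg_seq E f.
Proof.
elim: E => //= y E IH; rewrite inE => /orP[/eqP->|xE]; first exact: avg_idem.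
by rewrite avgC IH.
Qed.

Lemma depends_on_avg x E f :
  depends_on E f -> depends_on [seq y <- E | y != x] (avg x f).
Proof.
move=> fE c c' cc'; congr (_ * _); apply: eq_bigr => a _; apply: fE => y yE.
by rewrite /recolor; case: eqP => [//|/eqP yx]; apply: cc'; rewrite mem_filter yx.
Qed.

Lemma avg_seq_const E f : depends_on E f ->
  forall c c', avg_seq E f c = avg_seq E f c'.
Proof.
move=> fE c c'.
have dep S : depends_on [seq y <- E | y \notin S] (avg_seq S f).
  elim: S => [|x S IH] /=; first by rewrite filter_predT.
  refine (depends_on_sub _ (depends_on_avg (x := x) IH)) => y.
  by rewrite !mem_filter inE negb_or andbA.
apply: (dep E) => x; rewrite mem_filter => /andP[xE xE'].
by rewrite xE' in xE.
Qed.

Lemma avg_seq_enlarge E E' f : depends_on E f ->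
  avg_seq E (avg_seq E' f) = avg_seq E f.
Proof.
move=> fE; rewrite avg_seqC; elim: E' => //= x E' ->.
case: (boolP (x \in E)) => [|xE]; first exact: avg_seq_absorb.
by apply: avg_indep => c a; apply: avg_seq_const.
Qed.

(** The average does not depend on the finite set of coordinates, as both sides
    are the average over the union. *)
Lemma avg_seq_uniform E E' f c c' : depends_on E f -> depends_on E' f ->
  avg_seq E f c = avg_seq E' f c'.
Proof.
move=> fE fE'; rewrite -(avg_seq_enlarge E' fE) avg_seqC avg_seq_enlarge //.
exact: avg_seq_const.
Qed.

(** The integral for the uniform product measure, for a function of finitely
    many coordinates. *)
Definition mean f : C :=
  avg_seq (xget [::] [set E | depends_on E f]%classic) f (fun=> ord0).

Lemma meanE E f c : depends_on E f -> mean f = avg_seq E f c.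
Proof.
move=> fE; apply: avg_seq_uniform => //.
exact: (xgetPex [::] (ex_intro (fun E => depends_on E f) E fE)).
Qed.

Definition cylinder f : Prop := exists E, depends_on E f.

Lemma cylinder2 f g : cylinder f -> cylinder g ->
  exists E, depends_on E f /\ depends_on E g.
Proof.
move=> [E fE] [E' gE']; exists (E ++ E'); split.
  by refine (depends_on_sub _ fE) => x xE; rewrite mem_cat xE.
by refine (depends_on_sub _ gE') => x xE; rewrite mem_cat xE orbT.
Qed.

Lemma cylinder_map2 (op : C -> C -> C) f g : cylinder f -> cylinder g ->
  cylinder (fun c => op (f c) (g c)).
Proof.
move=> fc gc; have [E [fE gE]] := cylinder2 fc gc; exists E => c c' cc'.
by rewrite (fE _ _ cc') (gE _ _ cc').
Qed.

Lemma cylinder_cst a : cylinder (fun=> a).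
Proof. by exists [::]. Qed.

Lemma mean_cst a : mean (fun=> a) = a.
Proof. exact: (@meanE [::] _ (fun=> ord0)). Qed.

Lemma mean_lin a f g : cylinder f -> cylinder g ->
  mean (fun c => a * f c + g c) = a * mean f + mean g.
Proof.
move=> fc gc; have [E [fE gE]] := cylinder2 fc gc.
pose c0 : config := fun=> ord0.
rewrite (meanE c0 fE) (meanE c0 gE) (@meanE E _ c0); last first.
  by move=> c c' cc'; rewrite (fE _ _ cc') (gE _ _ cc').
elim: E {fE gE} c0 => //= x E IH c0.
rewrite /avg (eq_bigr _ (fun b _ => IH (recolor c0 x b))).
rewrite big_split /= -mulr_sumr; ring.
Qed.

Lemma mean_conj f : cylinder f ->
  mean (fun c => Num.conj (f c)) = Num.conj (mean f).
Proof.
move=> [E fE]; pose c0 : config := fun=> ord0.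
rewrite (meanE c0 fE) (@meanE E _ c0); last first.
  by move=> c c' cc'; rewrite (fE _ _ cc').
elim: E {fE} c0 => //= x E IH c0.
rewrite /avg (eq_bigr _ (fun b _ => IH (recolor c0 x b))).
by rewrite rmorphM rmorph_sum fmorphV rmorph_nat.
Qed.

Lemma mean_ge0 f : (forall c, 0 <= f c) -> 0 <= mean f.
Proof.
move=> f0; rewrite /mean; pose c0 : config := fun=> ord0; rewrite -/c0.
elim: (xget _ _) c0 => //= x E IH c0.
by rewrite mulr_ge0 ?invr_ge0 ?ler0n // sumr_ge0.
Qed.

Lemma mean_comp (h : X -> X) f : injective h -> cylinder f ->
  mean (fun c => f (c \o h)) = mean f.
Proof.
move=> hinj [E fE]; pose c0 : config := fun=> ord0.
rewrite (@meanE (map h E) _ c0); last first.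
  by move=> c c' cc'; apply: fE => x xE /=; apply: cc'; apply: map_f.
rewrite (meanE (c0 \o h) fE); elim: E {fE} c0 => //= x E IH c0.
rewrite /avg; congr (_ * _); apply: eq_bigr => a _.
rewrite IH; congr (avg_seq _ _ _); apply/funext => y.
by rewrite /recolor /= (inj_eq hinj).
Qed.

End Cylinder.

Section MeanFinite.
Variables (R : realType) (X : choiceType) (q : nat).
Local Notation C := R[i].
Local Notation color := 'I_q.+1.
Local Notation config := (X -> color).
Implicit Types (f : config -> C) (c : config) (E : seq X).

Lemma avg_seq_mull E f (h : config -> C) :
  (forall x, x \in E -> forall c a, f (recolor c x a) = f c) ->
  avg_seq E (fun c => f c * h c) = (fun c => f c * avg_seq E h c).
Proof.
elim: E => //= x E IH fE; rewrite IH; last first.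
  by move=> y yE; apply: fE; rewrite inE yE orbT.
apply/funext => c; rewrite /avg [RHS]mulrCA [in RHS]mulr_sumr; congr (_ * _).
by apply: eq_bigr => a _; rewrite fE // mem_head.
Qed.

Lemma avg_seq_prod (I : eqType) (y : I -> X) (F : I -> color -> C) (s : seq I) c :
  injective y -> uniq s ->
  avg_seq (map y s) (fun c => \prod_(i <- s) F i (c (y i))) c =
  \prod_(i <- s) (q.+1%:R^-1 * \sum_a F i a).
Proof.
move=> yinj; elim: s c => [|i s IH] c /=; first by rewrite !big_nil.
case/andP=> ins us.
rewrite (_ : (fun c => _) = (fun c => F i (c (y i)) *
    \prod_(j <- s) F j (c (y j)))); last first.
  by apply/funext => d; rewrite big_cons.
rewrite avg_seq_mull => [|x /mapP[j js ->] d a]; last first.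
  rewrite /recolor (inj_eq yinj).
  by case: eqP => // ij; rewrite ij js in ins.
rewrite /avg big_cons -[RHS]mulrA; congr (_ * _); rewrite mulr_suml.
apply: eq_bigr => a _; rewrite IH //.
by rewrite /recolor eqxx.
Qed.

Lemma mean_sum (I : Type) (s : seq I) (F : I -> config -> C) :
  (forall i, cylinder (F i)) ->
  cylinder (fun c => \sum_(i <- s) F i c) /\
  mean (fun c => \sum_(i <- s) F i c) = \sum_(i <- s) mean (F i).
Proof.
move=> Fc; elim: s => [|i s [IHc IH]].
  rewrite big_nil (_ : (fun c => _) = (fun=> 0)).
    by split; [exact: cylinder_cst|exact: mean_cst].
  by apply/funext => c; rewrite big_nil.
have -> : (fun c => \sum_(j <- i :: s) F j c) =
    (fun c => 1 * F i c + \sum_(j <- s) F j c).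
  by apply/funext => c; rewrite big_cons mul1r.
split; first exact: (cylinder_map2 (fun a b => 1 * a + b) (Fc i) IHc).
by rewrite mean_lin // IH mul1r big_cons.
Qed.

(** By linearity it suffices to consider the indicator of one coloring of the
    [n] points, which is a product of functions of one coordinate. *)
Lemma mean_finite (n : nat) (y : 'I_n -> X) (Phi : {ffun 'I_n -> color} -> C) :
  injective y -> mean (fun c => Phi [ffun i => c (y i)]) =
  q.+1%:R ^- n * \sum_d Phi d.
Proof.
move=> yinj.
pose ind (d : {ffun 'I_n -> color}) c : C :=
  \prod_(i <- enum 'I_n) (c (y i) == d i)%:R.
have indE d c : ind d c = ([ffun i => c (y i)] == d)%:R.
  rewrite /ind big_enum /=; case: eqP => [<-|/eqP dc].
    by rewrite big1 // => i _; rewrite ffunE eqxx.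
  have [i ci] : exists i, c (y i) != d i.
    apply/existsP; apply: contraNT dc => /existsPn h; apply/eqP/ffunP => i.
    by rewrite ffunE; apply/eqP; rewrite -[_ == _]negbK h.
  by rewrite (bigD1 i) //= (negbTE ci) mul0r.
have ind_dep d : depends_on (map y (enum 'I_n)) (ind d).
  move=> c c' cc'; apply: eq_bigr => i _; rewrite cc' // map_f //.
  by rewrite mem_enum.
have ind_cyl d : cylinder (ind d) by exists (map y (enum 'I_n)).
have mean_ind d : mean (ind d) = q.+1%:R ^- n.
  rewrite (meanE (fun=> ord0) (ind_dep d)).
  rewrite (avg_seq_prod (fun i a => (a == d i)%:R)) ?enum_uniq //.
  rewrite big_enum /= (eq_bigr (fun=> q.+1%:R^-1)) => [|i _].
    by rewrite prodr_const card_ord exprVn.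
  rewrite (bigD1 (d i)) //= eqxx big1 ?addr0 ?mulr1 // => a /negbTE->.
  by [].
have -> : (fun c => Phi [ffun i => c (y i)]) =
    (fun c => \sum_(d <- index_enum {ffun 'I_n -> color}) (Phi d * ind d c + 0)).
  apply/funext => c; rewrite (bigD1_seq [ffun i => c (y i)]) ?mem_index_enum
    ?index_enum_uniq //= indE eqxx mulr1 addr0 big1 ?addr0 // => d dc.
  by rewrite indE eq_sym (negbTE dc) mulr0 addr0.
have cyl d : cylinder (fun c => Phi d * ind d c + 0).
  have [E dE] := ind_cyl d; exists E => c c' cc'.
  by rewrite (dE _ _ cc').
have [] := mean_sum (index_enum {ffun 'I_n -> color}) cyl.
move=> _ ->; rewrite mulr_sumr; apply: eq_bigr => d _.
by rewrite mean_lin // ?mean_cst ?mean_ind ?addr0 1?mulrC //; exact: cylinder_cst.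
Qed.

End MeanFinite.

(** * The representation defined by a nearest neighbour weight *)

Section CylinderSpace.
Variables (R : realType) (X : choiceType) (q : nat).
Local Notation C := R[i].
Local Notation config := (X -> 'I_q.+1).

Definition cylinders : {pred config -> C^o} := fun f => `[< cylinder f >].

Lemma cylinders_submod : GRing.submod_closed cylinders.
Proof.
split; first by apply/asboolP; exact: cylinder_cst.
move=> a f g /asboolP fc /asboolP gc; apply/asboolP.
exact: (cylinder_map2 (fun x y => a * x + y) fc gc).
Qed.

HB.instance Definition _ :=
  GRing.isSubmodClosed.Build C (config -> C^o) cylinders cylinders_submod.

Record cylfun := Cylfun { cfun :> config -> C^o; _ : cfun \in cylinders }.
HB.instance Definition _ := [isSub for cfun].
HB.instance Definition _ := gen_eqMixin cylfun.
HB.instance Definition _ := gen_choiceMixin cylfun.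
HB.instance Definition _ := [SubChoice_isSubLmodule of cylfun by <:].

Lemma cylfunP (f : cylfun) : cylinder f.
Proof. by apply/asboolP; case: f. Qed.

Definition cyldot (f g : cylfun) : C := mean (fun c => f c * Num.conj (g c)).

Lemma cylinder_dot (f g : cylfun) : cylinder (fun c => f c * Num.conj (g c)).
Proof.
exact: (cylinder_map2 (fun x y => x * Num.conj y) (cylfunP f) (cylfunP g)).
Qed.

Lemma cyldot_lin a (f g h : cylfun) :
  cyldot (a *: f + g) h = a * cyldot f h + cyldot g h.
Proof.
rewrite /cyldot -mean_lin; try exact: cylinder_dot.
congr mean; apply/funext => c /=.
by rewrite mulrDl -mulrA.
Qed.

Lemma cyldot_herm (f g : cylfun) : cyldot f g = Num.conj (cyldot g f).
Proof.
rewrite /cyldot -mean_conj; last exact: cylinder_dot.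
by congr mean; apply/funext => c; rewrite rmorphM /= conjCK mulrC.
Qed.

Lemma cyldot_ge0 (f : cylfun) : 0 <= cyldot f f.
Proof. by apply: mean_ge0 => c; exact: mul_conjC_ge0. Qed.

Definition cyl_prehilbert : prehilbert R :=
  {| pcar := cylfun; pdot := cyldot; pdot_lin := cyldot_lin;
     pdot_herm := cyldot_herm; pdot_ge0 := cyldot_ge0 |}.

End CylinderSpace.

Section Cocycle.
Variables (R : realType) (X : choiceType) (q : nat).
Local Notation C := R[i].
Local Notation color := 'I_q.+1.
Local Notation config := (X -> color).
Variables (p : X -> X) (w : color -> color -> C).
Hypothesis w1 : forall a b, w a b * Num.conj (w a b) = 1.
Implicit Types (g h : selfbij X) (E : seq X) (c : config).

Definition commutes_off E g : Prop := forall m, m \notin E -> g (p m) = p (g m).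

(** The group of the automorphisms of the graph with edges [(m, p m)], up to
    finitely many defects. *)
Definition almost_commuting : set (selfbij X) :=
  [set g | exists E, commutes_off E g]%classic.

(** The ratio of the weights of the edge [(m, p m)] transported by [g] and of
    the edge at [g m]. *)
Definition ratio g c m : C := w (c (g m)) (c (g (p m))) *
  Num.conj (w (c (g m)) (c (p (g m)))).

Definition cocycle g c : C :=
  \prod_(m <- undup (xget [::] [set E | commutes_off E g]%classic)) ratio g c m.

(** At a point where [g] commutes with [p] the ratio is 1, so any finite set
    containing the defects gives the same product. *)
Lemma cocycleE E g c : uniq E -> commutes_off E g ->
  cocycle g c = \prod_(m <- E) ratio g c m.
Proof.
move=> uE gE; have gE' : commutes_off (undup (xget [::]
    [set E | commutes_off E g]%classic)) g.
  move=> m; rewrite mem_undup.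
  exact: (xgetPex [::] (ex_intro (fun E => commutes_off E g) E gE)).
rewrite /cocycle; set E' := undup _ in gE' *.
have uE' : uniq E' by exact: undup_uniq.
have cut S : \prod_(m <- S) ratio g c m =
    \prod_(m <- [seq m <- S | g (p m) != p (g m)]) ratio g c m.
  rewrite [RHS]big_filter [RHS]big_mkcond; apply: eq_bigr => m _.
  by case: eqP => //= e; rewrite /ratio e w1.
rewrite (cut E') (cut E); apply: perm_big; apply: uniq_perm; rewrite ?filter_uniq //.
have mem S m : commutes_off S g -> g (p m) != p (g m) -> m \in S.
  by move=> gS; apply: contraNT => /gS/eqP.
move=> m; rewrite !mem_filter.
by apply/idP/idP => /andP[e _]; apply/andP; split=> //; exact: mem e.
Qed.

Lemma cocycle_norm g c : cocycle g c * Num.conj (cocycle g c) = 1.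
Proof.
rewrite /cocycle rmorph_prod -big_split big1 //= => m _.
rewrite /ratio rmorphM /= conjCK mulrACA w1 mul1r mulrC; exact: w1.
Qed.

Lemma commutes_off_sub E E' g : {subset E <= E'} ->
  commutes_off E g -> commutes_off E' g.
Proof. by move=> EE' gE m mE'; apply: gE; apply: contraNN mE' => /EE'. Qed.

Lemma almost_commuting_one : almost_commuting 1%g.
Proof. by exists [::]. Qed.

Lemma commutes_offM E E' g h : commutes_off E g -> commutes_off E' h ->
  commutes_off (E' ++ map (bwd h) E) (g * h)%g.
Proof.
move=> gE hE' m; rewrite mem_cat negb_or => /andP[mE' mE].
rewrite /= hE' // gE //; apply: contraNN mE => hm; apply/mapP.
by exists (h m); rewrite // fwdK.
Qed.

Lemma almost_commutingM g h : almost_commuting g -> almost_commuting h ->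
  almost_commuting (g * h)%g.
Proof.
move=> [E gE] [E' hE']; exists (E' ++ map (bwd h) E).
exact: commutes_offM.
Qed.

Lemma almost_commutingV g : almost_commuting g -> almost_commuting (g^-1)%g.
Proof.
move=> [E gE]; exists (map g E) => m mE /=; apply: (can_inj (@fwdK _ g)).
rewrite bwdK gE ?bwdK //; apply: contraNN mE => mE.
by rewrite -(bwdK g m) map_f.
Qed.

(** Over a set [E] containing the defects of [h] and of [g * h], whose image by
    [h] contains those of [g], the identity holds factor by factor. *)
Lemma cocycleM g h c : almost_commuting g -> almost_commuting h ->
  cocycle (g * h)%g c = cocycle g c * cocycle h (c \o g).
Proof.
move=> [Eg gE] [Eh hE]; pose E := undup (Eh ++ map (bwd h) Eg).
have uE : uniq E by exact: undup_uniq.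
have gh : commutes_off E (g * h)%g.
  apply: (commutes_off_sub _ (commutes_offM gE hE)) => m.
  by rewrite mem_undup.
have hE' : commutes_off E h.
  by apply: (commutes_off_sub _ hE) => m mE; rewrite mem_undup mem_cat mE.
have gE' : commutes_off (map h E) g.
  apply: (commutes_off_sub _ gE) => m mE; rewrite -(bwdK h m); apply: map_f.
  by rewrite mem_undup mem_cat map_f ?orbT.
rewrite (cocycleE _ uE gh) (cocycleE _ uE hE').
rewrite (cocycleE _ _ gE') ?(map_inj_uniq (can_inj (@fwdK _ h))) //.
rewrite big_map -big_split; apply: eq_bigr => m _; rewrite /ratio /=.
set a := c (g (h m)); set b := c (g (h (p m))); set d := c (g (p (h m))).
set e := c (p (g (h m))).
rewrite [RHS](_ : _ = (w a d * Num.conj (w a d)) * (w a b * Num.conj (w a e))).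
  by rewrite w1 mul1r.
ring.
Qed.

Lemma cylinder_comp (g : X -> X) (f : config -> C) :
  cylinder f -> cylinder (fun c => f (c \o g)).
Proof.
move=> [E fE]; exists (map g E) => c c' cc'; apply: fE => m mE /=.
by apply: cc'; apply: map_f.
Qed.

Lemma cylinder_cocycle g : cylinder (cocycle g).
Proof.
rewrite /cocycle; elim: (undup _) => [|m E IH].
  by exists [::] => c c' _; rewrite !big_nil.
have cm : cylinder (fun c => ratio g c m).
  exists [:: g m; g (p m); p (g m)] => c c' cc'.
  by rewrite /ratio !cc' // !inE eqxx ?orbT.
have [E' hE'] := cylinder_map2 *%R cm IH.
by exists E' => c c' cc'; rewrite !big_cons; exact: hE'.
Qed.

Local Notation V := (cyl_prehilbert R X q).

Definition twist g (f : V) : V :=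
  insubd (0 : V) (fun c => cocycle g c * (f : cylfun R X q) (c \o g)).

Lemma twistE g (f : V) :
  cfun (twist g f) = (fun c => cocycle g c * cfun f (c \o g)).
Proof.
apply: (insubdK (0 : V)); apply/asboolP.
exact: (cylinder_map2 (fun x y => x * y) (cylinder_cocycle g) (cylinder_comp g (cylfunP f))).
Qed.

Lemma cst1_cylinder : ((fun=> 1) : config -> C^o) \in @cylinders R X q.
Proof. by apply/asboolP; exact: cylinder_cst. Qed.

Definition vacuum : V := Cylfun cst1_cylinder.

(** The operators [twist g] are isometries because the cocycle has modulus 1 and
    the product measure is invariant under permutations of the coordinates. *)
Theorem cocycle_representation : exists (H : hilbert R)
    (rho : selfbij X -> H -> H) (x : H),
  unitary_representation almost_commuting rho /\
  forall g, almost_commuting g -> hdot H (rho g x) x = mean (cocycle g).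
Proof.
have [||||H [rho [x [rhoU rhoE]]]] := @unitary_extension R V (selfbij X)
    almost_commuting twist vacuum almost_commuting_one almost_commutingM
    almost_commutingV.
- move=> g _ a f h; apply: val_inj; apply/funext => c.
  by rewrite /= !twistE /= mulrDr; congr (_ + _); rewrite [RHS]mulrCA.
- move=> g _ f h; rewrite /= /cyldot !twistE.
  rewrite -(mean_comp (can_inj (@fwdK _ g)) (cylinder_dot f h)).
  congr mean; apply/funext => c; rewrite rmorphM /= mulrACA cocycle_norm.
  by rewrite mul1r.
- move=> f; apply: val_inj; apply/funext => c; rewrite /= twistE.
  by rewrite (@cocycleE [::] 1%g) // big_nil mul1r.
- move=> g h gK hK f; apply: val_inj; apply/funext => c; rewrite /= !twistE /=.
  by rewrite cocycleM // -mulrA.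
exists H, rho, x; split=> // g gK; rewrite rhoE //= /cyldot twistE /=.
by congr mean; apply/funext => c; rewrite mulr1 rmorph1 mulr1.
Qed.

End Cocycle.

(** * Dyadic intervals and homeomorphisms *)

Section DyadicIntervals.
Variable R : realType.
Implicit Types (g h : selfbij (circle R)) (x : circle R).

Definition dy (a b : nat) : R := a%:R / 2 ^+ b.

Definition in_dyadic (a b : nat) (x : R) : Prop := dy a b <= x < dy a.+1 b.

Lemma exp2_gt0 k : 0 < 2 ^+ k :> R.
Proof. by rewrite exprn_gt0. Qed.

Lemma exp2_neq0 k : 2 ^+ k != 0 :> R.
Proof. by rewrite gt_eqF // exp2_gt0. Qed.

Lemma dy_ge0 a b : 0 <= dy a b.
Proof. by rewrite divr_ge0 // ltW // exp2_gt0. Qed.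

Lemma dy_scale a b k : dy (a * 2 ^ k) (b + k) = dy a b.
Proof.
rewrite /dy natrM natrX exprD; field.
by rewrite !exp2_neq0.
Qed.

Lemma ler_dy a a' b : (dy a b <= dy a' b) = (a <= a')%N.
Proof. by rewrite ler_pM2r ?invr_gt0 ?exp2_gt0 // ler_nat. Qed.

Lemma ltr_dy a a' b : (dy a b < dy a' b) = (a < a')%N.
Proof. by rewrite ltr_pM2r ?invr_gt0 ?exp2_gt0 // ltr_nat. Qed.

Lemma dy_eq a b a' b' : (dy a b == dy a' b') = (a * 2 ^ b' == a' * 2 ^ b)%N.
Proof.
rewrite -(dy_scale a b b') -(dy_scale a' b' b) [(b' + b)%N]addnC /dy.
rewrite (inj_eq (mulIf _)) ?eqr_nat // invr_neq0 // exp2_neq0.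
Qed.

Lemma dy_lt1 a b : (dy a b < 1) = (a < 2 ^ b)%N.
Proof.
have -> : 1 = dy (2 ^ b) b by rewrite /dy natrX divff // exp2_neq0.
by rewrite ltr_dy.
Qed.

Lemma dy_le1 a b : (dy a b <= 1) = (a <= 2 ^ b)%N.
Proof.
have -> : 1 = dy (2 ^ b) b by rewrite /dy natrX divff // exp2_neq0.
by rewrite ler_dy.
Qed.

Lemma circle_ge0 x : 0 <= cval x. Proof. by case: x => x /= /andP[]. Qed.
Lemma circle_lt1 x : cval x < 1. Proof. by case: x => x /= /andP[]. Qed.
Lemma circle_inj : injective (@cval R). Proof. exact: val_inj. Qed.

Lemma circle_of (x : R) : 0 <= x < 1 -> exists y : circle R, cval y = x.
Proof. by move=> h; exists (Circle h). Qed.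

Lemma in_dyadic_exists x b : exists2 a, (a < 2 ^ b)%N & in_dyadic a b (cval x).
Proof.
have x0 : 0 <= cval x * 2 ^+ b by rewrite mulr_ge0 ?circle_ge0 // ltW ?exp2_gt0.
have /andP[h1 h2] := truncn_itv x0.
exists (Num.truncn (cval x * 2 ^+ b)).
  rewrite -(ltr_nat R) natrX; apply: le_lt_trans h1 _.
  by rewrite gtr_pMl ?exp2_gt0 // circle_lt1.
by rewrite /in_dyadic /dy ler_pdivrMr ?exp2_gt0 // ltr_pdivlMr ?exp2_gt0 // h1.
Qed.

Lemma in_dyadic_left a b : in_dyadic a b (dy a b).
Proof. by rewrite /in_dyadic lexx ltr_dy ltnSn. Qed.

Lemma in_dyadic_sub a b a' k (x : R) : in_dyadic a' (b + k) x ->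
  (a * 2 ^ k <= a' < a.+1 * 2 ^ k)%N -> in_dyadic a b x.
Proof.
move=> /andP[h1 h2] /andP[h3 h4]; apply/andP.
rewrite -(dy_scale a b k) -(dy_scale a.+1 b k); split.
  by apply: le_trans h1; rewrite ler_dy.
by apply: lt_le_trans h2 _; rewrite ler_dy.
Qed.

Lemma in_dyadic_nested a b a' k (x : R) : in_dyadic a b x -> in_dyadic a' (b + k) x ->
  (a * 2 ^ k <= a' < a.+1 * 2 ^ k)%N.
Proof.
rewrite /in_dyadic -(dy_scale a b k) -(dy_scale a.+1 b k).
move=> /andP[h1 h2] /andP[h3 h4]; apply/andP; split.
  by rewrite -ltnS -(ltr_dy _ _ (b + k)) (le_lt_trans h1).
by rewrite -(ltr_dy _ _ (b + k)) (le_lt_trans h3).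
Qed.

Lemma in_dyadic_lt1 a b (x : R) : (a < 2 ^ b)%N -> in_dyadic a b x -> 0 <= x < 1.
Proof.
move=> ab /andP[h1 h2]; rewrite (le_trans (dy_ge0 a b)) //=.
by apply: lt_le_trans h2 _; rewrite dy_le1.
Qed.

(** [g] maps the interval [[a / 2 ^ b, (a + 1) / 2 ^ b[] affinely onto
    [[c / 2 ^ d, (c + 1) / 2 ^ d[], for [c < 2 ^ d]. *)
Definition dyadic_map g (a b c d : nat) : Prop := forall x,
  in_dyadic a b (cval x) ->
  cval (g x) = dy c d + (2 ^+ b / 2 ^+ d) * (cval x - dy a b).

Lemma dyS a b : dy a.+1 b = dy a b + 1 / 2 ^+ b.
Proof. by rewrite /dy -addn1 natrD mulrDl. Qed.

Lemma in_dyadic_affine a b c d (x : R) : in_dyadic a b x ->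
  in_dyadic c d (dy c d + (2 ^+ b / 2 ^+ d) * (x - dy a b)).
Proof.
move=> /andP[h1 h2].
have p0 : 0 < 2 ^+ b / 2 ^+ d :> R by rewrite divr_gt0 ?exp2_gt0.
apply/andP; rewrite dyS lerDl ltrD2l; split.
  by rewrite mulr_ge0 ?subr_ge0 // ltW.
rewrite -ltr_pdivlMl // invf_div.
have -> : 2 ^+ d / 2 ^+ b * (1 / 2 ^+ d) = 1 / 2 ^+ b :> R.
  by field; rewrite !exp2_neq0.
by rewrite ltrBlDl -dyS.
Qed.

Lemma dyadic_map_in g a b c d x : dyadic_map g a b c d ->
  in_dyadic a b (cval x) -> in_dyadic c d (cval (g x)).
Proof. by move=> gm xI; rewrite (gm x xI); exact: in_dyadic_affine. Qed.

Lemma dyadic_map_left g a b c d x : dyadic_map g a b c d -> cval x = dy a b ->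
  cval (g x) = dy c d.
Proof.
move=> gm xa; rewrite gm xa ?subrr ?mulr0 ?addr0 //; exact: in_dyadic_left.
Qed.

Lemma dyadic_map_sub g a b c d a' k : dyadic_map g a b c d ->
  (a * 2 ^ k <= a' < a.+1 * 2 ^ k)%N ->
  dyadic_map g a' (b + k) (c * 2 ^ k + (a' - a * 2 ^ k)) (d + k).
Proof.
move=> gm ha' x xI; rewrite gm; last exact: in_dyadic_sub xI ha'.
case/andP: ha' => ha' _; rewrite /dy natrD natrB // !natrM natrX !exprD.
by field; rewrite !exp2_neq0.
Qed.

Lemma dyadic_sub_lt a b c k : (c < 2 ^ b)%N -> (a < 2 ^ k)%N ->
  (c * 2 ^ k + a < 2 ^ (b + k))%N.
Proof. rewrite expnD => cb ak; nia. Qed.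

Lemma dyadic_mapV g a b c d : (a < 2 ^ b)%N -> dyadic_map g a b c d ->
  dyadic_map (g^-1)%g c d a b.
Proof.
move=> ab gm y yI.
set z := dy a b + _; have zI : in_dyadic a b z by exact: in_dyadic_affine.
have [x xz] := circle_of (in_dyadic_lt1 ab zI).
have -> : y = g x.
  apply: circle_inj; rewrite gm xz // /z; field.
  by rewrite !exp2_neq0.
by rewrite /= fwdK.
Qed.

Lemma dyadic_map_comp g h a b c d e f : dyadic_map h a b c d ->
  dyadic_map g c d e f -> dyadic_map (g * h)%g a b e f.
Proof.
move=> hm gm x xI; rewrite /= gm; last exact: dyadic_map_in hm xI.
rewrite hm //; field.
by rewrite !exp2_neq0.
Qed.

(** The images of the left end and of the midpoint determine [c] and [d]. *)
Lemma dyadic_map_unique g a b c d c' d' : (a < 2 ^ b)%N ->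
  dyadic_map g a b c d -> dyadic_map g a b c' d' -> (c, d) = (c', d').
Proof.
move=> ab gm gm'.
have [x xa] := circle_of (in_dyadic_lt1 ab (in_dyadic_left a b)).
have yI : in_dyadic a b (dy a.*2.+1 b.+1).
  rewrite -[b.+1]addn1; apply: in_dyadic_sub (in_dyadic_left _ _) _.
  by rewrite expn1; lia.
have [y ya] := circle_of (in_dyadic_lt1 ab yI).
have c1 := dyadic_map_left gm xa; have c2 := dyadic_map_left gm' xa.
have e1 := gm y; have e2 := gm' y; rewrite ya in e1 e2.
have := e1 yI; rewrite (e2 yI) -c2 c1 => /addrI.
have d0 : dy a.*2.+1 b.+1 - dy a b != 0.
  by rewrite subr_eq0 dy_eq expnS; apply/eqP; have := expn_gt0 2 b; nia.
move=> /(mulIf d0)/(mulfI (exp2_neq0 b))/invr_inj dd.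
have {}dd : d = d'.
  apply/eqP; rewrite -(@eqn_exp2l 2) // -(eqr_nat R) !natrX; exact/eqP/esym.
congr (_, _) => //; move: c2; rewrite c1 dd => /eqP.
by rewrite dy_eq eqn_pmul2r ?expn_gt0 // => /eqP.
Qed.

End DyadicIntervals.

Section DyadicGroup.
Variable R : realType.
Implicit Types (g h : selfbij (circle R)) (F : R -> R).

Definition increasing_lift g F : Prop :=
  [/\ {homo F : x y / x < y}, (forall x, F (x + 1) = F x + 1) &
      forall x : circle R, exists m : int, F (cval x) = cval (g x) + m%:~R].

Definition level g (N : nat) : Prop := forall a, (a < 2 ^ N)%N ->
  exists c d, (c < 2 ^ d)%N /\ dyadic_map g a N c d.

(** The elements of [T]: this form of the definition is stable under products
    and inverses by refining the intervals, without any continuity argument. *)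
Definition dyadic_homeo : set (selfbij (circle R)) :=
  [set g | (exists F, increasing_lift g F) /\ (exists N, level g N)]%classic.

Lemma lift_int F : (forall x, F (x + 1) = F x + 1) ->
  forall x (m : int), F (x + m%:~R) = F x + m%:~R.
Proof.
move=> F1 x m; have Fn y k : F (y + k%:R) = F y + k%:R.
  elim: k => [|k IH]; first by rewrite !addr0.
  by rewrite -natr1 addrA F1 IH addrA.
case: m => k; first exact: Fn.
rewrite NegzE mulrNz; apply: (addIr (k.+1%:~R)).
by rewrite subrK -[LHS]Fn subrK.
Qed.

Lemma lift_mono F : {homo F : x y / x < y} -> {mono F : x y / x < y}.
Proof.
move=> Fh x y; apply/idP/idP => [|/Fh//]; apply: contraTT.
rewrite -!leNgt le_eqVlt => /orP[/eqP->//|/Fh]; exact: ltW.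
Qed.

Lemma lift_inj F : {homo F : x y / x < y} -> injective F.
Proof.
move=> Fh x y xy; apply/eqP; rewrite eq_le !leNgt -(lift_mono Fh y x).
by rewrite -(lift_mono Fh x y) xy ltxx.
Qed.

Lemma liftM g h F F' : increasing_lift g F -> increasing_lift h F' ->
  increasing_lift (g * h)%g (F \o F').
Proof.
move=> [Fh F1 Fg] [F'h F'1 F'g]; split.
- by move=> x y /F'h/Fh.
- by move=> x; rewrite /= F'1 F1.
move=> x; have [m Fm] := F'g x; have [k Fk] := Fg (h x).
by exists (k + m); rewrite /= Fm lift_int // Fk -addrA -intrD.
Qed.

Lemma liftV g F : increasing_lift g F -> exists F', increasing_lift (g^-1)%g F'.
Proof.
move=> [Fh F1 Fg]; have Finj := lift_inj Fh.
have surj y : exists x, F x = y.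
  have /circle_of[z zE] : 0 <= y - (Num.floor y)%:~R < 1.
    rewrite subr_ge0 ltrBlDl [_ + 1]addrC; have := floor_itv y.
    by rewrite intrD addrC => /andP[-> ->].
  have [m Fm] := Fg (bwd g z); rewrite bwdK in Fm.
  exists (cval (bwd g z) + (Num.floor y - m)%:~R).
  by rewrite lift_int // Fm zE intrB; ring.
pose G y := sval (cid (surj y)).
have FG y : F (G y) = y by exact: svalP (cid (surj y)).
exists G; split.
- by move=> x y xy; rewrite -(lift_mono Fh) !FG.
- by move=> x; apply: Finj; rewrite FG F1 FG.
move=> y; have [m Fm] := Fg (bwd g y); exists (- m); apply: Finj.
by rewrite FG lift_int // Fm /= bwdK mulrNz addrK.
Qed.

Lemma divn_pow_bounds a k : (a %/ 2 ^ k * 2 ^ k <= a < (a %/ 2 ^ k).+1 * 2 ^ k)%N.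
Proof. by rewrite leq_divM -ltn_divLR ?expn_gt0 // ltnSn. Qed.

Lemma dyadic_map_refine g a k b c d : (c < 2 ^ d)%N ->
  dyadic_map g (a %/ 2 ^ k) b c d ->
  exists2 c', (c' < 2 ^ (d + k))%N & dyadic_map g a (b + k) c' (d + k).
Proof.
move=> cd gm; have ha := divn_pow_bounds a k.
exists (c * 2 ^ k + (a - a %/ 2 ^ k * 2 ^ k))%N.
  by apply: dyadic_sub_lt => //; move: ha; rewrite mulSn => /andP[]; lia.
exact: dyadic_map_sub gm ha.
Qed.

Lemma level_le g N N' : (N <= N')%N -> level g N -> level g N'.
Proof.
move=> /subnKC <-; move: (N' - N)%N => k gN a ak.
have [|c [d [cd gm]]] := gN (a %/ 2 ^ k)%N.
  by rewrite ltn_divLR ?expn_gt0 // -expnD.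
have [c' c'd gm'] := dyadic_map_refine cd gm.
by exists c', (d + k)%N.
Qed.

Lemma levelM g h N M : level g N -> level h M -> level (g * h)%g (M + N).
Proof.
move=> gN hM a aMN; have [|c [d [cd hm]]] := hM (a %/ 2 ^ N)%N.
  by rewrite ltn_divLR ?expn_gt0 // -expnD.
have [c' c'd hm'] := dyadic_map_refine cd hm.
have [e [f [ef gm]]] := level_le (leq_addl d N) gN c'd.
by exists e, f; split=> //; exact: dyadic_map_comp hm' gm.
Qed.

(** The images of the intervals of level [N] cover the circle, so every interval
    of a level exceeding all of theirs lies inside of one of them. *)
Lemma levelV g N : level g N -> exists M, level (g^-1)%g M.
Proof.
move=> gN; have [f fP] : exists f : nat -> nat * nat, forall a, (a < 2 ^ N)%N ->
    ((f a).1 < 2 ^ (f a).2)%N /\ dyadic_map g a N (f a).1 (f a).2.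
  have ex a : exists cd : nat * nat, (a < 2 ^ N)%N ->
      (cd.1 < 2 ^ cd.2)%N /\ dyadic_map g a N cd.1 cd.2.
    case: (ltnP a (2 ^ N)) => [/gN[c [d cd]]|]; last by exists (0, 0)%N.
    by exists (c, d).
  by exists (fun a => sval (cid (ex a))) => a; exact: svalP (cid (ex a)).
pose M := (\max_(a < 2 ^ N) (f a).2)%N; exists M => b bM.
have [y yb] := circle_of (in_dyadic_lt1 bM (in_dyadic_left R b M)).
have [a aN xa] := in_dyadic_exists (bwd g y) N.
have [cd gm] := fP a aN.
have yI := dyadic_map_in gm xa; rewrite bwdK in yI.
have dM : ((f a).2 <= M)%N by exact: (leq_bigmax (Ordinal aN)).
have gV := dyadic_mapV aN gm.
move: dM bM yb => /subnKC <-; move: (M - _)%N => k bM yb.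
have bI := in_dyadic_left R b ((f a).2 + k); rewrite -yb in bI.
have nb := in_dyadic_nested yI bI.
exists (a * 2 ^ k + (b - (f a).1 * 2 ^ k))%N, (N + k)%N; split.
  by apply: dyadic_sub_lt => //; move: nb; rewrite mulSn => /andP[]; lia.
exact: dyadic_map_sub gV nb.
Qed.

Lemma dyadic_homeoM g h : dyadic_homeo g -> dyadic_homeo h ->
  dyadic_homeo (g * h)%g.
Proof.
move=> [[F gF] [N gN]] [[F' hF'] [M hM]]; split.
  by exists (F \o F'); exact: liftM.
by exists (M + N)%N; exact: levelM.
Qed.

Lemma dyadic_homeoV g : dyadic_homeo g -> dyadic_homeo (g^-1)%g.
Proof. by move=> [[F /liftV gF] [N /levelV gN]]; split. Qed.

(** On an interval of level [N0] the lift is [F x = F a + 2 ^ m (x - a)] with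
    [F a] of the form [u / 2 ^ v]; at level [N] the images of the intervals
    start at multiples of [2 ^ -(N - m)] as soon as [v <= N - m]. *)
Lemma affine_level g F (a N0 : nat) (u m : int) (v : nat) :
  increasing_lift g F ->
  (forall x, dy R a N0 <= x <= dy R a.+1 N0 ->
     F x = u%:~R / 2 ^+ v + 2 ^ m * (x - dy R a N0)) ->
  forall k b, (v%:Z <= (N0 + k)%:Z - m) -> (b %/ 2 ^ k = a)%N ->
  exists c d, (c < 2 ^ d)%N /\ dyadic_map g b (N0 + k) c d.
Proof.
move=> [_ _ Fg] Fa k b vL ba.
have [L LE] : exists L : nat, (N0 + k)%:Z - m = L.
  by move: vL; case: (_ - m) => L // _; exists L.
rewrite LE lez_nat in vL.
have m2 : 2 ^ m = 2 ^+ (N0 + k) / 2 ^+ L :> R.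
  have -> : m = (N0 + k)%:Z + (- L%:Z) by rewrite -LE opprB subrKC.
  by rewrite expfzDr ?pnatr_eq0 // exprnN.
have bb := divn_pow_bounds b k; rewrite ba in bb.
pose W : int := u * 2 ^+ (L - v) + (b%:Z - (a * 2 ^ k)%:Z).
pose c := `|(W %% (2 ^ L)%:Z)%Z|%N; pose Z := (W %/ (2 ^ L)%:Z)%Z.
have L0 : (2 ^ L)%:Z != 0 by rewrite eqz_nat -lt0n expn_gt0.
have cE : c%:Z = (W %% (2 ^ L)%:Z)%Z by rewrite /c gez0_abs // modz_ge0.
have WE : W = Z * (2 ^ L)%:Z + c%:Z by rewrite cE; exact: divz_eq.
have cL : (c < 2 ^ L)%N.
  by rewrite -ltz_nat cE ltz_pmod // ltz_nat expn_gt0.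
exists c, L; split=> // x xI.
have [j Fj] := Fg x.
have xa : in_dyadic a N0 (cval x) by exact: in_dyadic_sub xI bb.
have Fx : F (cval x) = Z%:~R + (dy R c L + (2 ^+ (N0 + k) / 2 ^+ L) *
    (cval x - dy R b (N0 + k))).
  rewrite Fa; last by case/andP: xa => -> /ltW ->.
  have : W%:~R = Z%:~R * 2 ^+ L + c%:R :> R.
    by rewrite WE intrD intrM /= -natrX.
  rewrite /W intrD intrM rmorphXn /= intrB -[b%:~R]/(b%:R) -[(a * _)%:~R]/((a * 2 ^ k)%:R).
  have L2 : 2 ^+ L = 2 ^+ (L - v) * 2 ^+ v :> R by rewrite -exprD subnK.
  rewrite natrM natrX m2 /dy exprD L2 => E.
  transitivity ((u%:~R * 2 ^+ (L - v) + (b%:R - a%:R * 2 ^+ k) +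
      (2 ^+ N0 * 2 ^+ k * cval x - b%:R)) / (2 ^+ (L - v) * 2 ^+ v)).
    by field; rewrite !exp2_neq0.
  by rewrite E; field; rewrite !exp2_neq0.
have yI := @in_dyadic_affine R b (N0 + k) c L (cval x) xI.
have := in_dyadic_lt1 cL yI; set y := _ + _ * _ in Fx *.
have := circle_ge0 (g x); have := circle_lt1 (g x).
move: Fx; rewrite Fj => E g1 g0 /andP[y0 y1].
have : cval (g x) - y = (Z - j)%:~R.
  by rewrite intrB; move: E => /eqP; rewrite -subr_eq0 => /eqP E; apply/eqP; rewrite -subr_eq0 -E; apply/eqP; ring.
move: (Z - j) => i gy.
have : i = 0.
  have : -1 < i%:~R :> R by rewrite -gy; lra.
  have : i%:~R < 1 :> R by rewrite -gy; lra.
  rewrite -[1]/(1%:~R) -mulrNz !ltr_int; lia.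
by move=> i0; apply/eqP; rewrite -subr_eq0 gy i0.
Qed.

(** At a level where all the breakpoints are multiples of the length of the
    intervals, the lift is affine on them; refining further makes the images
    standard, by [affine_level]. *)
Lemma thompsonT_dyadic g : thompsonT g -> dyadic_homeo g.
Proof.
move=> [gdy [F [Fc Fh F1 Fg] [B [Bdy Baff]]]].
have gF : increasing_lift g F by [].
split; first by exists F.
have [N0 BN] : exists N0, forall x, x \in B -> exists z : int, x = z%:~R / 2 ^+ N0.
  elim: B Bdy {Baff} => [|x B IH] Bdy; first by exists 0%N.
  have [|N0 HN] := IH; first by move=> y yB; apply: Bdy; rewrite inE yB orbT.
  have [|z [b xz]] := Bdy x; first by rewrite inE eqxx.
  exists (N0 + b)%N => y; rewrite inE => /orP[/eqP->|/HN[t ->]].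
    exists (z * 2 ^+ N0); rewrite xz intrM rmorphXn /= exprD; field.
    by rewrite !exp2_neq0.
  exists (t * 2 ^+ b); rewrite intrM rmorphXn /= exprD; field.
  by rewrite !exp2_neq0.
have loc a : exists M, (a < 2 ^ N0)%N -> forall k b, (M <= k)%N ->
    (b %/ 2 ^ k = a)%N ->
    exists c d, (c < 2 ^ d)%N /\ dyadic_map g b (N0 + k) c d.
  case: (ltnP a (2 ^ N0)) => aN; last by exists 0%N.
  have [|||y yB|m Fm] := Baff (dy R a N0) (dy R a.+1 N0).
  - exact: dy_ge0.
  - by rewrite ltr_dy.
  - by rewrite dy_le1.
  - have [z ->] := BN _ yB; apply/negP => /andP[].
    rewrite !ltr_pM2r ?invr_gt0 ?exp2_gt0 //.
    rewrite -[a%:R]/(a%:~R) -[a.+1%:R]/(a.+1%:~R) !ltr_int; lia.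
  have [x xa] := circle_of (in_dyadic_lt1 aN (in_dyadic_left R a N0)).
  have /gdy[u [v guv]] : dyadic (cval x) by exists a%:Z, N0.
  have [j Fj] := Fg x.
  exists (v + `|m|)%N => _ k b kb ba.
  apply: (@affine_level g F a N0 (u + j * 2 ^+ v) m v) => //.
    move=> y /Fm->; congr (_ + _); rewrite -xa Fj guv intrD intrM rmorphXn /=.
    by field; rewrite exp2_neq0.
  lia.
pose M := (\max_(a < 2 ^ N0) sval (cid (loc a)))%N.
exists (N0 + M)%N => b bM.
have bN : (b %/ 2 ^ M < 2 ^ N0)%N by rewrite ltn_divLR ?expn_gt0 // -expnD.
have := svalP (cid (loc (b %/ 2 ^ M)%N)) bN M b; apply=> //.
exact: (leq_bigmax (Ordinal bN)).
Qed.

End DyadicGroup.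

(** * Reduced triples *)

Section TreeIntervals.
Variable R : realType.
Local Notation dy := (dy R).

Lemma size_dyadic_intervals t a b : size (dyadic_intervals t a b) = leaves t.
Proof. by elim: t a b => //= l IHl r IHr a b; rewrite size_cat IHl IHr. Qed.

Lemma dyadic_intervals_sub t a b I : I \in dyadic_intervals t a b ->
  exists2 k, I.2 = (b + k)%N & (a * 2 ^ k <= I.1 < a.+1 * 2 ^ k)%N.
Proof.
elim: t a b => [|l IHl r IHr] a b /=.
  by rewrite inE => /eqP-> /=; exists 0%N; rewrite ?addn0 // !muln1 leqnn ltnSn.
rewrite mem_cat => /orP[/IHl|/IHr] [k -> h]; exists k.+1; rewrite ?addnS //;
  move: h; rewrite expnS; move: (I.1) (2 ^ k)%N => x K; nia.
Qed.

Lemma tree_intervals_lt t I : I \in tree_intervals t -> (I.1 < 2 ^ I.2)%N.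
Proof. by case/dyadic_intervals_sub => k -> /=; rewrite add0n mul1n. Qed.

Lemma dyadic_intervals_cover t a b (x : R) : in_dyadic a b x ->
  exists2 I, I \in dyadic_intervals t a b & in_dyadic I.1 I.2 x.
Proof.
elim: t a b => [|l IHl r IHr] a b /= xI.
  by exists (a, b); rewrite ?inE.
have e1 : dy a b = dy a.*2 b.+1.
  by rewrite -(dy_scale R a b 1) addn1 expn1 muln2.
have e2 : dy a.+1 b = dy a.*2.+2 b.+1.
  by rewrite -(dy_scale R a.+1 b 1) addn1 expn1 muln2 doubleS.
case/andP: xI; rewrite e1 e2 => h1 h2.
case: (ltP x (dy a.*2.+1 b.+1)) => h3.
  have [|I IL xI] := IHl a.*2 b.+1; first by rewrite /in_dyadic h1.
  by exists I; rewrite // mem_cat IL.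
have [|I IL xI] := IHr a.*2.+1 b.+1; first by rewrite /in_dyadic h3.
by exists I; rewrite // mem_cat IL orbT.
Qed.

Lemma dyadic_intervals_sorted t a b :
  pairwise (fun I J => dy I.1 I.2 < dy J.1 J.2) (dyadic_intervals t a b).
Proof.
elim: t a b => //= l IHl r IHr a b; rewrite pairwise_cat IHl IHr !andbT.
apply/allrelP => I J /dyadic_intervals_sub[k Ik hI] /dyadic_intervals_sub[m Jm hJ].
apply: (@lt_le_trans _ _ (dy a.*2.+1 b.+1)).
  rewrite -(dy_scale R a.*2.+1 b.+1 k) Ik ltr_dy.
  by case/andP: hI.
rewrite -(dy_scale R a.*2.+1 b.+1 m) Jm ler_dy.
by case/andP: hJ.
Qed.

Lemma dyadic_intervals_head t a b :
  dy (nth (0, 0)%N (dyadic_intervals t a b) 0).1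
     (nth (0, 0)%N (dyadic_intervals t a b) 0).2 = dy a b.
Proof.
elim: t a b => //= l IHl r _ a b; rewrite nth_cat size_dyadic_intervals.
rewrite leaves_gt0 IHl -(dy_scale R a b 1) addn1 expn1 muln2 //.
Qed.

Lemma carets_intervals t o a b i : i \in carets t o ->
  exists c d, [/\ (o <= i)%N, (i.+1 < o + leaves t)%N,
    nth (0, 0)%N (dyadic_intervals t a b) (i - o) = (c.*2, d.+1) &
    nth (0, 0)%N (dyadic_intervals t a b) (i.+1 - o) = (c.*2.+1, d.+1)].
Proof.
elim: t o a b => // l IHl r IHr o a b.
have key : i \in carets l o ++ carets r (o + leaves l) ->
  exists c d, [/\ (o <= i)%N, (i.+1 < o + leaves (Node l r))%N,
    nth (0, 0)%N (dyadic_intervals (Node l r) a b) (i - o) = (c.*2, d.+1) &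
    nth (0, 0)%N (dyadic_intervals (Node l r) a b) (i.+1 - o) = (c.*2.+1, d.+1)].
  rewrite mem_cat => /orP[/(IHl _ a.*2 b.+1)|/(IHr _ a.*2.+1 b.+1)];
    case=> c [d [h1 h2 h3 h4]]; exists c, d; split=> //=; try lia.
  - by rewrite nth_cat size_dyadic_intervals ifT ?h3 //; lia.
  - by rewrite nth_cat size_dyadic_intervals ifT ?h4 //; lia.
  - rewrite nth_cat size_dyadic_intervals ifF; last by lia.
    by rewrite -subnDA h3.
  - rewrite nth_cat size_dyadic_intervals ifF; last by lia.
    by rewrite -subnDA h4.
case: l r IHl IHr key => [|l1 l2] [|r1 r2] //= _ _ _.
rewrite inE => /eqP->; exists a, b; rewrite subnn subSnn; split=> //.
by rewrite addn2.
Qed.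

(** The subdivision, stopping at the first intervals satisfying [P] or at the
    depth [k]. *)
Fixpoint grow (P : nat -> nat -> bool) (k a b : nat) : btree :=
  if k is k'.+1 then
    if P a b then Leaf else Node (grow P k' a.*2 b.+1) (grow P k' a.*2.+1 b.+1)
  else Leaf.

Lemma grow_spec (P : nat -> nat -> bool) k a b :
  (forall a', (a * 2 ^ k <= a' < a.+1 * 2 ^ k)%N -> P a' (b + k)%N) ->
  forall I, I \in dyadic_intervals (grow P k a b) a b ->
    P I.1 I.2 /\ (I = (a, b) \/ (b < I.2)%N /\ ~~ P (I.1 %/ 2)%N I.2.-1).
Proof.
elim: k a b => [|k IH] a b Pk I /=.
  rewrite inE => /eqP-> /=; split; last by left.
  by rewrite -[b]addn0; apply: Pk; rewrite !muln1 leqnn ltnSn.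
case: ifP => Pab /=.
  by rewrite inE => /eqP-> /=; split; last by left.
have Pab' := negbT Pab.
rewrite mem_cat => /orP[] IL.
  have [|PI h] := IH _ _ _ _ IL.
    by move=> a' h; rewrite addSnnS; apply: Pk; rewrite expnS; nia.
  split=> //; right; case: h => [->|[bI nP]]; last by split=> //; exact: ltnW.
  by rewrite /= -muln2 mulnK.
have [|PI h] := IH _ _ _ _ IL.
  by move=> a' h; rewrite addSnnS; apply: Pk; rewrite expnS; nia.
split=> //; right; case: h => [->|[bI nP]]; last by split=> //; exact: ltnW.
by rewrite /= -muln2 -[(a * 2).+1]addn1 divnMDl //= addn0.
Qed.

End TreeIntervals.

Section ReducedTriple.
Variable R : realType.
Local Notation dy := (dy R).
Implicit Types (g h : selfbij (circle R)).

Definition standard_on g (a b : nat) : bool :=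
  `[< exists c d, (c < 2 ^ d)%N /\ dyadic_map g a b c d >].

Lemma standard_on_sub g a b c d a' k : (c < 2 ^ d)%N -> dyadic_map g a b c d ->
  (a * 2 ^ k <= a' < a.+1 * 2 ^ k)%N -> standard_on g a' (b + k)%N.
Proof.
move=> cd gm h; apply/asboolP.
exists (c * 2 ^ k + (a' - a * 2 ^ k))%N, (d + k)%N; split.
  by apply: dyadic_sub_lt => //; move: h; rewrite mulSn => /andP[]; lia.
exact: dyadic_map_sub gm h.
Qed.

Lemma half_bounds a a' k : (a * 2 ^ k.+1 <= a' < a.+1 * 2 ^ k.+1)%N ->
  (a * 2 ^ k <= a' %/ 2 < a.+1 * 2 ^ k)%N.
Proof.
move=> h; rewrite leq_divRL // ltn_divLR //; move: h; rewrite expnS.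
by move: (2 ^ k)%N => K; nia.
Qed.

(** The leaves of [t] are the maximal intervals mapped affinely to standard
    dyadic intervals. *)
Definition maximal_tree g t : Prop := forall I, I \in tree_intervals t ->
  standard_on g I.1 I.2 /\
  (I.2 = 0 \/ ~~ standard_on g (I.1 %/ 2) I.2.-1)%N.

Lemma maximal_tree_exists g N : level g N -> exists t, maximal_tree g t.
Proof.
move=> gN; exists (grow (standard_on g) N 0 0) => I IL.
have [|gI h] := grow_spec _ IL.
  move=> a; rewrite mul0n mul1n => aN; apply/asboolP.
  exact: gN.
by split=> //; case: h => [->|[_]]; [left|right].
Qed.

(** If [g] maps [I] onto [J], a standard interval larger than [J] on which
    [g^-1] is affine onto a standard interval has as its image one larger than
    [I] on which [g] is so, and conversely. *)
Lemma maximal_tree_match g s t : maximal_tree g s -> maximal_tree (g^-1)%g t ->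
  forall I, I \in tree_intervals s ->
  exists2 J, J \in tree_intervals t & dyadic_map g I.1 I.2 J.1 J.2.
Proof.
move=> gs gt [a b] Is /=; have ab := tree_intervals_lt Is.
have [/asboolP[c [d [/= cd gm]]] Imax] := gs _ Is; rewrite /= in ab gm Imax.
have gV := dyadic_mapV ab gm.
have cI : in_dyadic 0 0 (dy c d).
  rewrite /in_dyadic /dy mul0r divr1 dy_lt1 cd andbT.
  exact: dy_ge0.
have [[c' d'] Jt yJ] := dyadic_intervals_cover t cI; rewrite /= in yJ.
have cd' := tree_intervals_lt Jt; rewrite /= in cd'.
have [/asboolP[e [f [/= ef gJ]]] Jmax] := gt _ Jt; rewrite /= in gJ Jmax.
have gJV := dyadic_mapV cd' gJ; rewrite invgK in gJV.
case: (leqP d d') => dd.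
  move: dd yJ Jt Jmax {cd' gJ gJV} => /subnKC <-; move: (d' - d)%N => k.
  case: k => [|k] yJ Jt Jmax.
    move: (in_dyadic_nested (k := 0) (in_dyadic_left R c d) yJ).
    rewrite muln1 muln1 => cc; have cE : c' = c by lia.
    by exists (c', (d + 0)%N); rewrite // addn0 cE.
  have := in_dyadic_nested (in_dyadic_left R c d) yJ.
  case: Jmax => [|/negP nJ cc]; first by rewrite addnS.
  case: nJ; rewrite addnS /=; apply: standard_on_sub ab gV _.
  exact: half_bounds cc.
have [k dE] : exists k, d = (d' + k.+1)%N by exists (d - d'.+1)%N; lia.
subst d; have cc := in_dyadic_nested yJ (in_dyadic_left R c (d' + k.+1)).
have gsub := dyadic_map_sub gJ cc.
have [aE bE] := dyadic_map_unique cd gV gsub.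
case: Imax => [|/negP nI]; first by rewrite bE addnS.
case: nI; rewrite bE addnS /=; apply: standard_on_sub cd' gJV _.
apply: half_bounds; rewrite aE; move: cc; rewrite !mulSn.
by move: (2 ^ k.+1)%N => K; lia.
Qed.

Definition circ (x : R) : circle R :=
  odflt (Circle (introT andP (conj (lexx 0) ltr01))) (insub x).

Lemma circK x : 0 <= x < 1 -> cval (circ x) = x.
Proof. by move=> x01; rewrite /circ; case: insubP => [y _ <-|/negP]. Qed.

Lemma dy01 (I : nat * nat) t : I \in tree_intervals t -> 0 <= dy I.1 I.2 < 1.
Proof. by move=> /tree_intervals_lt It; rewrite dy_ge0 dy_lt1. Qed.

Definition ends t : seq R := [seq dy J.1 J.2 | J <- tree_intervals t].

Lemma size_ends t : size (ends t) = leaves t.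
Proof. by rewrite size_map size_dyadic_intervals. Qed.

Lemma ends_sorted t : sorted <%R (ends t).
Proof.
apply: pairwise_sorted; rewrite pairwise_map; exact: dyadic_intervals_sorted.
Qed.

Lemma ends01 t x : x \in ends t -> 0 <= x < 1.
Proof. by case/mapP => I It ->; exact: dy01 It. Qed.

Lemma nth_ends0 t : nth 0 (ends t) 0 = 0.
Proof.
rewrite (nth_map (0, 0)%N) ?size_dyadic_intervals ?leaves_gt0 //.
by rewrite dyadic_intervals_head /Defs.dyadic /dy mul0r.
Qed.

Lemma int01 (i : int) : -1 < i -> i < 1 + 1 -> i = 0 \/ i = 1.
Proof. lia. Qed.

(** An increasing lift cuts the circle at one point, so that a
    homeomorphism acts on a sorted finite set as a rotation. *)
Lemma sorted_rotation g (xs ys : seq R) : (exists F, increasing_lift g F) ->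
  sorted <%R xs -> sorted <%R ys -> (0 < size xs)%N -> nth 0 xs 0 = 0 ->
  (forall x, x \in xs -> 0 <= x < 1) ->
  (forall y, (y \in ys) = (y \in [seq cval (g (circ x)) | x <- xs])) ->
  exists2 k, (0 < k <= size xs)%N &
    ys = rot k [seq cval (g (circ x)) | x <- xs].
Proof.
move=> [F0 [F0h F01 F0g]] xss yss xs0 x0 xs01 ysE.
have z01 : 0 <= (0 : R) < 1 by rewrite lexx ltr01.
have [m0 Fm0] := F0g (circ 0); rewrite circK // in Fm0.
pose F x := F0 x - m0%:~R.
have Fh : {homo F : x y / x < y} by move=> x y /F0h; rewrite ltrD2r.
have Fm := lift_mono Fh.
have F0E : F 0 = cval (g (circ 0)) by rewrite /F Fm0 addrK.
have F1 : F 1 = F 0 + 1 by rewrite /F -[1]add0r F01 add0r addrAC.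
pose z x := cval (g (circ x)).
have zE x : 0 <= x < 1 -> z x = if F x < 1 then F x else F x - 1.
  move=> x01; have [j Fj] := F0g (circ x); rewrite circK // in Fj.
  have := circle_ge0 (g (circ x)); have := circle_lt1 (g (circ x)).
  have := circle_ge0 (g (circ 0)); have := circle_lt1 (g (circ 0)).
  have Fx1 : F x < F 1 by rewrite Fm; case/andP: x01.
  have Fx0 : F 0 <= F x by rewrite leNgt Fm -leNgt; case/andP: x01.
  rewrite -F0E -/(z x) => a1 a0 b1 b0; rewrite F1 in Fx1.
  have Fz : F x = z x + (j - m0)%:~R by rewrite /F Fj intrB /z; ring.
  move: (j - m0) Fz => i Fz.
  have i0 : (-1) %:~R < i%:~R :> R by rewrite mulrN1z; lra.
  have i2 : i%:~R < (1 + 1)%:~R :> R by rewrite intrD; lra.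
  have : i = 0 \/ i = 1 by apply: int01; rewrite -(ltr_int R).
  case=> iE; rewrite iE ?mulr0z ?mulr1z in Fz.
    by rewrite Fz addr0 b1.
  by case: ltP => h; lra.
pose k := find (fun x => 1 <= F x) xs.
have k0 : (0 < k)%N.
  rewrite lt0n; apply/negP => /eqP kE; move: (kE); rewrite /k.
  case: xs xss xs0 x0 {ysE k kE xs01} => //= x xs _ _ ->.
  by case: ifP => //; rewrite F0E leNgt circle_lt1.
have kn : (k <= size xs)%N by exact: find_size.
exists k; first by rewrite k0.
apply: lt_sorted_eq => //.
  have pw : pairwise <%R xs by rewrite -sorted_pairwise //; exact: lt_trans.
  rewrite -map_rot /rot; apply: pairwise_sorted; rewrite pairwise_map.
  have ltk x : x \in take k xs -> F x < 1.
    move=> xk; rewrite ltNge; apply/negP => Fx.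
    have : has (fun x => 1 <= F x) (take k xs) by apply/hasP; exists x.
    by rewrite has_take_leq // /k ltnn.
  have [pt pd] : pairwise <%R (take k xs) /\ pairwise <%R (drop k xs).
    by move: pw; rewrite -[X in pairwise _ X](cat_take_drop k) pairwise_cat
      => /and3P[].
  have gek x : x \in drop k xs -> 1 <= F x.
    move=> xk; case dk: (drop k xs) xk pd => [//|y r] xk /= /andP[/allP yr _].
    have kxs : (k < size xs)%N.
      by rewrite ltnNge; apply/negP => /drop_oversize; rewrite dk.
    have Fy : 1 <= F y.
      have -> : y = nth 0 xs k by rewrite -[k]addn0 -nth_drop dk.
      by apply: (nth_find 0 (a := fun x => 1 <= F x)); rewrite has_find.
    move: xk; rewrite inE => /orP[/eqP->//|/yr yx].
    by apply: le_trans Fy _; rewrite ltW // Fm.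
  have zt x : x \in take k xs -> z x = F x.
    by move=> xk; rewrite zE ?ltk // xs01 // (mem_take xk).
  have zd x : x \in drop k xs -> z x = F x - 1.
    move=> xk; rewrite zE ?xs01 ?(mem_drop xk) //.
    by rewrite ltNge gek.
  rewrite pairwise_cat; apply/and3P; split.
  - apply/allrelP => x y xd yt; rewrite /= -/(z x) -/(z y) zd // zt //.
    have /andP[_ x1] := xs01 x (mem_drop xd).
    have /andP[y0 _] := xs01 y (mem_take yt).
    have Fx : F x < F 1 by rewrite Fm.
    have Fy : F 0 <= F y by rewrite leNgt Fm -leNgt.
    rewrite F1 in Fx; lra.
  - apply: (sub_in_pairwise (P := mem (drop k xs)) _ _ pd); last exact/allP.
    by move=> x y xd yd xy; rewrite /= -/(z x) -/(z y) !zd // ltrD2r Fm.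
  apply: (sub_in_pairwise (P := mem (take k xs)) _ _ pt); last exact/allP.
  by move=> x y xd yd xy; rewrite /= -/(z x) -/(z y) !zt // Fm.
by move=> y; rewrite mem_rot ysE.
Qed.

End ReducedTriple.

Lemma nth_rot_mod (T : Type) (d : T) k (zs : seq T) i :
  (0 < k <= size zs)%N -> (i < size zs)%N ->
  nth d (rot k zs) ((i + (size zs - k)) %% size zs) = nth d zs i.
Proof.
move=> /andP[k0 kn] iz; rewrite /rot nth_cat size_drop; case: (ltnP i k) => ik.
  rewrite modn_small; last by lia.
  rewrite ifF; last by lia.
  by rewrite addnK nth_take.
have -> : (i + (size zs - k) = i - k + size zs)%N by lia.
rewrite modnDr modn_small; last by lia.
rewrite ifT; last by lia.
by rewrite nth_drop subnKC.
Qed.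

Section ReducedTripleExists.
Variable R : realType.
Local Notation dy := (dy R).
Implicit Types (g h : selfbij (circle R)).

Lemma nth_ends t i : (i < leaves t)%N ->
  nth 0 (ends R t) i = dy (nth (0, 0)%N (tree_intervals t) i).1
                          (nth (0, 0)%N (tree_intervals t) i).2.
Proof.
by move=> it; rewrite (nth_map (0, 0)%N) // size_dyadic_intervals.
Qed.

(** The maximal trees of [g] and of its inverse have matching leaves, in
    cyclically rotated order.  A cancelling caret would make [g] affine on the
    interval of the parent, against maximality. *)
Lemma reduced_triple_exists g : dyadic_homeo g -> exists p,
  [/\ wf_triple p, reduced p & represents p g].
Proof.
move=> gD; have [gF [N gN]] := gD; have [M gM] := levelV gN.
have [s gs] := maximal_tree_exists gN; have [t gt] := maximal_tree_exists gM.
have match_st := maximal_tree_match gs gt.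
have match_ts : forall J, J \in tree_intervals t -> exists2 J',
    J' \in tree_intervals s & dyadic_map (g^-1)%g J.1 J.2 J'.1 J'.2.
  by apply: maximal_tree_match gt _; rewrite invgK.
have [|||y|k kn rotE] := sorted_rotation gF (ends_sorted R s) (ends_sorted R t).
- by rewrite size_ends leaves_gt0.
- exact: nth_ends0.
- exact: ends01.
- apply/mapP/mapP => [[J Jt ->]|[x /mapP[J Js ->] ->]].
    have [J' J's gm] := match_ts J Jt.
    exists (dy J'.1 J'.2); first by apply: map_f.
    have cJ := circK (dy01 R Jt).
    have := dyadic_map_left gm cJ => gJ.
    rewrite (_ : circ _ = bwd g (circ (dy J.1 J.2))) ?bwdK ?cJ //.
    by apply: circle_inj; rewrite circK ?(dy01 R J's).
  have [J' J't gm] := match_st J Js.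
  exists J' => //; apply: dyadic_map_left gm _.
  exact: circK (dy01 R Js).
rewrite size_map in kn; rewrite size_dyadic_intervals in kn.
set n := leaves s in kn.
have tn : leaves t = n.
  have := congr1 size rotE; rewrite size_rot !size_map !size_dyadic_intervals.
  by [].
pose p := Triple s t (n - k).+1.
have repr i : (i < n)%N -> let J := nth (0, 0)%N (tree_intervals s) i in
    let J' := nth (0, 0)%N (tree_intervals t) (leaf_match p i) in
    dyadic_map g J.1 J.2 J'.1 J'.2.
  move=> it J J'; have Js : J \in tree_intervals s.
    by rewrite mem_nth ?size_dyadic_intervals.
  have [K Kt gm] := match_st J Js.
  have gJ := dyadic_map_left gm (circK (dy01 R Js)).
  have mt : (leaf_match p i < leaves t)%N by rewrite tn ltn_pmod // leaves_gt0.
  suff -> : J' = K by [].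
  have tt := nth_rot_mod 0 (zs := [seq cval (g (circ x)) | x <- ends R s]) (k := k).
  rewrite size_map size_map size_dyadic_intervals -rotE in tt.
  have := tt i kn it; rewrite -/(leaf_match p i) nth_ends //.
  rewrite (nth_map 0) ?size_ends // nth_ends // -/J gJ -/J'.
  have Kn : K = nth (0, 0)%N (tree_intervals t) (index K (tree_intervals t)).
    by rewrite nth_index.
  move=> E; rewrite Kn; congr nth.
  have iK : (index K (tree_intervals t) < leaves t)%N.
    by rewrite -(size_dyadic_intervals t 0 0) index_mem.
  apply/eqP; rewrite -(nth_uniq 0 (s := ends R t)) ?size_ends //.
    by rewrite !nth_ends // -Kn -/J' E.
  exact: (sorted_uniq lt_trans (@ltxx _ _)) (ends_sorted R t).
exists p; split.
- rewrite /wf_triple /= tn eqxx /=; have := leaves_gt0 s; rewrite -/n; lia.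
- apply/allP => i ic; apply/negP => jc.
  have [a [b [_ in' I1 I2]]] := carets_intervals 0 0 ic.
  have [c [d [_ jn J1 J2]]] := carets_intervals 0 0 jc.
  rewrite !subn0 add0n in in' I1 I2; rewrite !subn0 add0n in jn J1 J2.
  rewrite -/(tree_intervals _) in I1 I2 J1 J2; rewrite /= tn in jn.
  have r1 := repr i (ltnW in').
  have r2 := repr i.+1 in'.
  have mS : leaf_match p i.+1 = (leaf_match p i).+1.
    rewrite {1}/leaf_match addSn -addn1 -modnDml addn1 modn_small //.
  rewrite /= I1 J1 /= in r1; rewrite /= I2 mS J2 /= in r2.
  have Js : (a.*2, b.+1) \in tree_intervals s.
    by rewrite -I1 mem_nth ?size_dyadic_intervals // ltnW.
  have [_ /=] := gs _ Js; case=> // /negP[].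
  rewrite -muln2 mulnK //; apply/asboolP; exists c, d.
  have Jt : (c.*2, d.+1) \in tree_intervals t.
    by rewrite -J1 mem_nth ?size_dyadic_intervals // tn ltnW.
  have := tree_intervals_lt Jt; rewrite /= expnS => cd; split; first by lia.
  move=> x xI.
  have hx : (cval x < dy a.*2.+1 b.+1) \/ (dy a.*2.+1 b.+1 <= cval x).
    by case: (ltP (cval x)); [left|right].
  case: hx => hx.
    rewrite r1; last first.
      rewrite /in_dyadic hx andbT -(dy_scale R a b 1) addn1 expn1 muln2 in xI *.
      by case/andP: xI.
    by rewrite /dy -!muln2 !natrM !exprS; field; rewrite !exp2_neq0 ?pnatr_eq0.
  rewrite r2; last first.
    move: xI; rewrite /in_dyadic hx -(dy_scale R a.+1 b 1) addn1 expn1 muln2.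
    by case/andP.
  rewrite /dy !exprS -[a.*2.+1%:R]natr1 -[c.*2.+1%:R]natr1 -!muln2 !natrM.
  move: (2 ^+ b) (2 ^+ d) (exp2_neq0 R b) (exp2_neq0 R d) => B D B0 D0.
  by field; rewrite B0 D0.
move=> i it; have := repr i it.
case: (nth _ _ i) => a b; case: (nth _ _ _) => c d /= gm x xI.
exact: gm.
Qed.

End ReducedTripleExists.

(** * The tree of dyadic points *)

Section DyadicTree.
Variable R : realType.
Local Notation dy := (dy R).
Implicit Types (g : selfbij (circle R)) (m : circle R).

Lemma odd_dy_inj u v u' v' : dy u.*2.+1 v.+1 = dy u'.*2.+1 v'.+1 ->
  u = u' /\ v = v'.
Proof.
move=> /eqP; rewrite dy_eq => /eqP E.
have odd2 (x y z k : nat) : (x.*2.+1 * 2 ^ (y + k.+1) = z.*2.+1 * 2 ^ y -> False)%N.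
  rewrite expnD mulnCA [RHS]mulnC => /eqP.
  rewrite eqn_pmul2l ?expn_gt0 // expnS mulnCA => /eqP/(congr1 odd).
  by rewrite /= odd_double mul2n odd_double.
case: (ltngtP v v') => vv.
- case: (@odd2 u v.+1 u' (v' - v.+1)%N); rewrite -E; congr (_ * 2 ^ _)%N; lia.
- case: (@odd2 u' v'.+1 u (v - v'.+1)%N); rewrite E; congr (_ * 2 ^ _)%N; lia.
split=> //; move: E; rewrite vv => /eqP; rewrite eqn_pmul2r ?expn_gt0 //.
by move/eqP; lia.
Qed.

(** The edges of the graph of a tree join the dyadic points
    [(2 u + 1) / 2 ^ (v + 1)] to [u / 2 ^ v]. *)
Definition parent m : circle R := xget m
  [set m' | exists u v, cval m = dy u.*2.+1 v.+1 /\ cval m' = dy u v]%classic.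

Lemma parentE m u v : cval m = dy u.*2.+1 v.+1 -> cval (parent m) = dy u v.
Proof.
move=> mE; have [m' m'E] : exists m' : circle R, cval m' = dy u v.
  apply: circle_of; rewrite dy_ge0 dy_lt1.
  have := circle_lt1 m; rewrite mE dy_lt1 expnS; lia.
have [u' [v' [E ->]]] := xgetPex m (ex_intro (fun m' : circle R =>
    exists u v, cval m = dy u.*2.+1 v.+1 /\ cval m' = dy u v) m'
    (ex_intro _ u (ex_intro _ v (conj mE m'E)))).
by have [-> ->] := odd_dy_inj (etrans (esym mE) E).
Qed.

Lemma parent_id m : (forall u v, cval m <> dy u.*2.+1 v.+1) -> parent m = m.
Proof. by move=> h; apply: xgetPN => m' [u [v [/h]]]. Qed.

Lemma dy_half a b : dy a.*2 b.+1 = dy a b.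
Proof. by rewrite -(dy_scale R a b 1) addn1 expn1 muln2. Qed.

Lemma dyadic_point m a b : cval m = dy a b -> cval m = 0 \/
  exists u v, (v < b)%N /\ cval m = dy u.*2.+1 v.+1.
Proof.
elim: b a => [|b IH] a mE.
  left; have := circle_lt1 m; rewrite mE dy_lt1 ltnS leqn0 => /eqP->.
  by rewrite /dy mul0r.
have := odd_double_half a; case: (odd a) => aE; last first.
  have [|h|[u [v [vb h]]]] := IH (a./2); first by rewrite mE -{1}aE add0n dy_half.
    by left.
  by right; exists u, v; split=> //; exact: ltnW.
by right; exists a./2, b; split=> //; rewrite mE -{1}aE.
Qed.

Lemma dyadic_map_dyadic g a b c d m A B : dyadic_map g a b c d ->
  in_dyadic a b (cval m) -> cval m = dy A B ->
  exists A' B', cval (g m) = dy A' B'.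
Proof.
move=> gm mI mE; have mE' : cval m = dy (A * 2 ^ b) (b + B).
  by rewrite addnC dy_scale.
have mI' : in_dyadic (A * 2 ^ b) (b + B) (cval m).
  by rewrite mE'; exact: in_dyadic_left.
have gm' := dyadic_map_sub gm (in_dyadic_nested mI mI').
by do 2!eexists; exact: dyadic_map_left gm' mE'.
Qed.

(** Taking the parent erases the last binary digit of a dyadic number, which
    inside of a standard interval is a digit beyond those fixing the interval;
    the affine map only replaces the latter. *)
Lemma dyadic_map_parent g a b c d m : (a < 2 ^ b)%N -> dyadic_map g a b c d ->
  in_dyadic a b (cval m) -> cval m != dy a b -> g (parent m) = parent (g m).
Proof.
move=> ab gm mI ma.
case: (pselect (exists u v, cval m = dy u.*2.+1 v.+1)) => [[u [v mE]]|no].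
  have bv : (b <= v)%N.
    rewrite leqNgt; apply/negP => vb; case/negP: ma.
    have mE' : cval m = dy (u.*2.+1 * 2 ^ (b - v.+1)) b.
      by rewrite -{2}(subnKC vb) dy_scale.
    move: mI; rewrite mE' => /andP[]; rewrite ler_dy ltr_dy ltnS => h1 h2.
    by rewrite eq_le !ler_dy h1 h2.
  move: bv mE => /subnKC <-; move: (v - b)%N => k mE.
  have mI' := in_dyadic_left R u.*2.+1 (b + k).+1; rewrite -mE -addnS in mI'.
  have h1 := in_dyadic_nested mI mI'.
  have h0 : (a * 2 ^ k <= u < a.+1 * 2 ^ k)%N.
    by move: h1; rewrite expnS; move: (2 ^ k)%N => K; nia.
  have pm := parentE mE.
  rewrite -addnS in mE.
  have gmE := dyadic_map_left (dyadic_map_sub gm h1) mE.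
  have gpE := dyadic_map_left (dyadic_map_sub gm h0) pm.
  apply: circle_inj; rewrite gpE; apply/esym/parentE; rewrite gmE addnS.
  congr (dy _ _); case/andP: h0 => h0 _; rewrite expnS.
  by move: (2 ^ k)%N h0 => K; nia.
rewrite parent_id => [|u v mE]; last by apply: no; exists u, v.
rewrite parent_id // => u v gmE.
have gV := dyadic_mapV ab gm.
have [A [B]] := dyadic_map_dyadic gV (dyadic_map_in gm mI) gmE.
rewrite /= fwdK => mE; case: (dyadic_point mE) => [m0|[u' [v' [_ mE']]]].
  case/negP: ma; move: mI; rewrite m0 => /andP[h _].
  by rewrite eq_le h dy_ge0.
by apply: no; exists u', v'.
Qed.

Lemma represents_map p g i : wf_triple p -> represents p g ->
  (i < leaves (dom p))%N ->
  dyadic_map g (nth (0, 0)%N (tree_intervals (dom p)) i).1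
    (nth (0, 0)%N (tree_intervals (dom p)) i).2
    (nth (0, 0)%N (tree_intervals (cod p)) (leaf_match p i)).1
    (nth (0, 0)%N (tree_intervals (cod p)) (leaf_match p i)).2.
Proof.
move=> wf gp ip; have := gp i ip; case: (nth _ _ i) => a b.
case: (nth _ _ (leaf_match _ _)) => c d gm x xI.
exact: gm.
Qed.

Definition end_points t : seq (circle R) := [seq circ x | x <- ends R t].

Lemma represents_parent p g : wf_triple p -> represents p g ->
  commutes_off parent (end_points (dom p)) g.
Proof.
move=> wf gp m mE.
have mI0 : in_dyadic 0 0 (cval m).
  by rewrite /in_dyadic /dy mul0r divr1 circle_ge0 circle_lt1.
have [J Jt mJ] := dyadic_intervals_cover (dom p) mI0.
have JE : nth (0, 0)%N (tree_intervals (dom p)) (index J (tree_intervals (dom p))) = J.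
  by rewrite nth_index.
have iJ : (index J (tree_intervals (dom p)) < leaves (dom p))%N.
  by rewrite -(size_dyadic_intervals (dom p) 0 0) index_mem.
have := represents_map wf gp iJ; rewrite JE => gm.
apply: (dyadic_map_parent (tree_intervals_lt Jt) gm mJ).
apply: contraNneq mE => mE; apply/mapP; exists (cval m).
  by rewrite mE; apply: (map_f (fun J => dy J.1 J.2)).
by apply: circle_inj; rewrite circK // circle_ge0 circle_lt1.
Qed.

(** Thue-Morse parity of the number of binary digits 1: it alternates along
    the edges of the tree of dyadic points. *)
Fixpoint thue_morse_rec (k a : nat) : bool :=
  if k is k'.+1 then odd a (+) thue_morse_rec k' a./2 else false.

Definition thue_morse (a : nat) : bool := thue_morse_rec a a.

Lemma thue_morse_fuel k a : (a <= k)%N -> thue_morse_rec k a = thue_morse a.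
Proof.
suff H k1 k2 : (a <= k1)%N -> (a <= k2)%N -> thue_morse_rec k1 a = thue_morse_rec k2 a.
  by move=> ak; apply: H.
have z j : thue_morse_rec j 0 = false by elim: j => //= j ->.
elim: k1 k2 a {k} => [|k1 IH] [|k2] a; rewrite ?leqn0.
- by [].
- by move=> /eqP-> _; rewrite z.
- by move=> _ /eqP->; rewrite z.
by move=> h1 h2 /=; congr (_ (+) _); apply: IH; lia.
Qed.

Lemma thue_morse_half a : thue_morse a = odd a (+) thue_morse a./2.
Proof.
rewrite -(@thue_morse_fuel a.+1 a) // -(@thue_morse_fuel a a./2) //.
by rewrite -divn2 leq_div.
Qed.

Lemma thue_morse_double a : thue_morse a.*2 = thue_morse a.
Proof. by rewrite thue_morse_half odd_double doubleK. Qed.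

Lemma thue_morse_doubleS a : thue_morse a.*2.+1 = ~~ thue_morse a.
Proof. by rewrite thue_morse_half /= odd_double uphalf_double. Qed.

Lemma thue_morse_pow a k : thue_morse (a * 2 ^ k) = thue_morse a.
Proof.
elim: k => [|k IH]; first by rewrite muln1.
by rewrite expnS mulnCA mul2n thue_morse_double.
Qed.

Definition tm_color m : bool :=
  `[< exists a b, cval m = dy a b /\ thue_morse a >].

Lemma tm_colorE m a b : cval m = dy a b -> tm_color m = thue_morse a.
Proof.
move=> mE; apply/asboolP/idP => [[a' [b' [mE' ta']]]|ta]; last by exists a, b.
move: mE; rewrite mE' => /eqP; rewrite dy_eq => /eqP E.
by rewrite -(thue_morse_pow a b') -E thue_morse_pow.
Qed.

Lemma tm_color_parent m u v : cval m = dy u.*2.+1 v.+1 ->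
  tm_color m = ~~ tm_color (parent m).
Proof.
move=> mE; rewrite (tm_colorE mE) (tm_colorE (parentE mE)).
exact: thue_morse_doubleS.
Qed.

End DyadicTree.

(** * The coefficient as a Potts partition function *)

Section EndPoints.
Variable R : realType.
Local Notation dy := (dy R).

Definition end_point t i : circle R := circ (nth 0 (ends R t) i).

Lemma cval_end_point t i : (i < leaves t)%N ->
  cval (end_point t i) = nth 0 (ends R t) i.
Proof.
by move=> it; rewrite circK // (ends01 (mem_nth _ _)) // size_ends.
Qed.

Lemma end_point_inj t i j : (i < leaves t)%N -> (j < leaves t)%N ->
  end_point t i = end_point t j -> i = j.
Proof.
move=> it jt /(congr1 (@cval R)); rewrite !cval_end_point // => /eqP.
rewrite nth_uniq ?size_ends // => [/eqP//|].
exact: (sorted_uniq lt_trans (@ltxx _ _)) (ends_sorted R t).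
Qed.

Lemma end_pointsE t : end_points R t = [seq end_point t i | i <- iota 0 (leaves t)].
Proof. by rewrite /end_points -{1}(mkseq_nth 0 (ends R t)) size_ends -map_comp. Qed.

Lemma end_points_uniq t : uniq (end_points R t).
Proof.
rewrite end_pointsE map_inj_in_uniq ?iota_uniq // => i j.
by rewrite !mem_iota add0n => /andP[_ it] /andP[_ jt]; exact: end_point_inj.
Qed.

Lemma tree_nodes_dyadic t o a b N : N \in tree_nodes t o ->
  exists u v,
    dy (nth (0, 0)%N (dyadic_intervals t a b) (N.1.2 - o)).1
       (nth (0, 0)%N (dyadic_intervals t a b) (N.1.2 - o)).2 =
      dy u.*2.+1 v.+1 /\
    dy (nth (0, 0)%N (dyadic_intervals t a b) (N.1.1 - o)).1
       (nth (0, 0)%N (dyadic_intervals t a b) (N.1.1 - o)).2 = dy u v.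
Proof.
case: N => -[n1 n2] n3 /=; elim: t o a b => //= l IHl r IHr o a b.
have l0 := leaves_gt0 l.
rewrite inE mem_cat => /orP[/eqP[-> -> _]|/orP[Nl|Nr]] /=.
- exists a, b; rewrite subnn !nth_cat size_dyadic_intervals addKn ltnn subnn.
  by rewrite l0 !dyadic_intervals_head dy_half.
- have [/= h1 h2 h3 h4] := tree_nodes_bound Nl.
  have [u [v [e1 e2]]] := IHl o a.*2 b.+1 Nl; exists u, v.
  rewrite !nth_cat size_dyadic_intervals.
  have -> : (n1 - o < leaves l)%N by lia.
  by have -> : (n2 - o < leaves l)%N by lia.
have [/= h1 h2 h3 h4] := tree_nodes_bound Nr.
have [u [v [e1 e2]]] := IHr _ a.*2.+1 b.+1 Nr; exists u, v.
rewrite !nth_cat size_dyadic_intervals -!subnDA.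
have -> : (n1 - o < leaves l)%N = false by lia.
by have -> : (n2 - o < leaves l)%N = false by lia.
Qed.

Lemma tree_edges_dyadic t e : e \in tree_edges t 0 ->
  [/\ (e.1 < e.2)%N, (e.2 < leaves t)%N & exists u v,
     cval (end_point t e.2) = dy u.*2.+1 v.+1 /\
     parent (end_point t e.2) = end_point t e.1].
Proof.
rewrite tree_edgesE => /mapP[N Nt ->].
have [_ h2 h3 h4] := tree_nodes_bound Nt; rewrite add0n in h4.
have lt2 : (N.1.2 < leaves t)%N by exact: leq_trans h3 h4.
split=> //; have [u [v [e1 e2]]] := tree_nodes_dyadic 0 0 Nt.
rewrite !subn0 in e1 e2.
have E2 : cval (end_point t N.1.2) = dy u.*2.+1 v.+1.
  by rewrite cval_end_point // nth_ends.
exists u, v; split=> //; apply: circle_inj; rewrite (parentE E2).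
by rewrite cval_end_point ?(ltn_trans h2) // nth_ends ?(ltn_trans h2).
Qed.

Lemma parent_end0 t : parent (end_point t 0) = end_point t 0.
Proof.
apply: parent_id => u v; rewrite cval_end_point ?leaves_gt0 // nth_ends0.
by move/esym/eqP; rewrite mulf_eq0 invr_eq0 pnatr_eq0 (negbTE (exp2_neq0 _ _)).
Qed.

Lemma big_tree (F : comNzRingType) t (h : nat -> F) :
  \prod_(j < leaves t) h j = h 0 * \prod_(e <- tree_edges t 0) h e.2.
Proof.
rewrite -(big_mkord predT) -[leaves t]prednK ?leaves_gt0 //.
rewrite big_nat_recl // tree_edgesE big_map /=; congr (_ * _).
rewrite -[RHS](big_map (fun N : nat * nat * nat => N.1.2) predT h).
rewrite [RHS](perm_big _ (tree_nodes_inner t 0)) /= (iotaDl 1 0) big_map.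
by rewrite /index_iota subn0.
Qed.

Lemma represents_end p (g : selfbij (circle R)) i :
  wf_triple p -> represents p g -> (i < leaves (dom p))%N ->
  g (end_point (dom p) i) = end_point (cod p) (leaf_match p i).
Proof.
move=> wf gp ip; have /andP[/eqP lE _] := wf.
have im : (leaf_match p i < leaves (cod p))%N.
  by rewrite -lE ltn_pmod // leaves_gt0.
apply: circle_inj; rewrite cval_end_point // nth_ends //.
apply: dyadic_map_left (represents_map wf gp ip) _.
by rewrite cval_end_point // nth_ends.
Qed.

End EndPoints.

Section CocyclePotts.
Variables (R : realType) (q : nat) (A : R[i]) (conv : bool).
Hypothesis A1 : A * Num.conj A = 1.
Local Notation C := R[i].
Local Notation color := 'I_q.+1.

Definition edge_weight (a b : color) : C := potts_weight A conv (a == b).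

Lemma potts_weight_conj b :
  Num.conj (potts_weight A conv b) = potts_weight A (~~ conv) b.
Proof.
have A0 : A != 0 by apply: contra_eq_neq A1 => ->; rewrite mul0r eq_sym oner_eq0.
have cA : Num.conj A = A^-1 by apply: (mulfI A0); rewrite A1 divff.
rewrite /potts_weight; case: conv; case: b => /=.
- by rewrite rmorphN fmorphV rmorphXn /= cA.
- exact: cA.
- by rewrite rmorphN fmorphV rmorphXn /= fmorphV /= cA invrK.
by rewrite fmorphV /= cA invrK.
Qed.

Lemma edge_weight_norm a b : edge_weight a b * Num.conj (edge_weight a b) = 1.
Proof.
have A0 : A != 0 by apply: contra_eq_neq A1 => ->; rewrite mul0r eq_sym oner_eq0.
rewrite potts_weight_conj /edge_weight /potts_weight.
by case: conv; case: (a == b) => /=; field.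
Qed.

Variables (p : triple) (g : selfbij (circle R)).
Hypotheses (wf : wf_triple p) (gp : represents p g).
Local Notation n := (leaves (dom p)).
Local Notation G := (thompson_graph p).

Lemma leaf_match_bij : {on [pred i : 'I_n | true],
  bijective (fun i : 'I_n => pt p (leaf_match p i))}.
Proof.
apply: onW_bij; apply: injF_bij => i j ij; apply: val_inj.
move: ij; rewrite /leaf_match !pt_mod; exact: pt_inj.
Qed.

(** The defects of [g] are among the left ends of the leaves of the domain,
    and [g] maps them to those of the range.  The edges carried by [g] are the
    upper edges, the edges at the images are the lower ones; the factors at
    the point 0, which has no parent, cancel out. *)
Lemma cocycle_edges (c : circle R -> color) :
  cocycle (@parent R) edge_weight g c =
  \prod_(e : edge G) potts_weight A (positive e == conv)
    ([ffun i : 'I_n => c (end_point R (cod p) i)] (base (inl (e, false))) ==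
     [ffun i : 'I_n => c (end_point R (cod p) i)] (base (inl (e, true)))).
Proof.
have /andP[/eqP lE _] := wf.
rewrite (cocycleE edge_weight_norm c (end_points_uniq R (dom p)) (represents_parent wf gp)).
have iotaE : iota 0 n = index_iota 0 n by rewrite /index_iota subn0.
rewrite end_pointsE big_map iotaE big_mkord.
pose up i := edge_weight (c (g (end_point R (dom p) i)))
  (c (g (parent (end_point R (dom p) i)))).
pose low j := Num.conj (edge_weight (c (end_point R (cod p) j))
  (c (parent (end_point R (cod p) j)))).
transitivity ((\prod_(i < n) up i) * \prod_(j < leaves (cod p)) low j).
  rewrite -lE [X in _ = _ * X](reindex _ leaf_match_bij) -big_split; apply: eq_bigr => i _.
  rewrite /ratio /up /low represents_end // /=.
  by rewrite /leaf_match modn_mod.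
have loops a b : edge_weight a a * Num.conj (edge_weight b b) = 1.
  by rewrite -(edge_weight_norm b b) /edge_weight !eqxx.
rewrite !big_tree /up /low !parent_end0 mulrACA.
rewrite loops mul1r big_sumType /=; congr (_ * _).
  rewrite (big_nth (0, 0)%N) big_mkord; apply: eq_bigr => e _.
  have et : nth (0, 0)%N (tree_edges (dom p) 0) e \in tree_edges (dom p) 0.
    exact: mem_nth.
  rewrite /edge_weight; have [h1 h2 [u [v [_ ->]]]] := tree_edges_dyadic R et.
  rewrite !represents_end ?(ltn_trans h1) //.
  move: h1 h2; case: (nth _ _ e) => x y /= h1 h2; rewrite !ffunE /=.
  by rewrite /leaf_match !modn_mod eq_sym; case: conv.
rewrite (big_nth (0, 0)%N) big_mkord; apply: eq_bigr => e _.
have et : nth (0, 0)%N (tree_edges (cod p) 0) e \in tree_edges (cod p) 0.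
  exact: mem_nth.
have [h1 h2 [u [v [_ ->]]]] := tree_edges_dyadic R et.
rewrite potts_weight_conj; move: h1 h2.
case: (nth _ _ e) => x y /= h1 h2; rewrite !ffunE /= lE !modn_small ?(ltn_trans h1) //.
by rewrite eq_sym; case: conv.
Qed.

Theorem mean_cocycle_potts : mean (cocycle (@parent R) edge_weight g) =
  q.+1%:R ^- n * \sum_(c : {ffun vertex G -> color})
    \prod_(e : edge G) potts_weight A (positive e == conv)
      (c (base (inl (e, false))) == c (base (inl (e, true)))).
Proof.
have /andP[/eqP lE _] := wf.
pose Phi (c : {ffun 'I_n -> color}) := \prod_(e : edge G)
  potts_weight A (positive e == conv)
    (c (base (inl (e, false))) == c (base (inl (e, true)))).
rewrite (_ : cocycle _ _ _ =
    fun c => Phi [ffun i : 'I_n => c (end_point R (cod p) i)]).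
  apply: (mean_finite Phi) => i j ij; apply: val_inj.
  by apply: end_point_inj ij; rewrite -lE.
by apply/funext => c; exact: cocycle_edges.
Qed.

End CocyclePotts.

(** * The oriented subgroup *)

Section TwoColorings.
Variable p : triple.
Local Notation G := (thompson_graph p).

Lemma proper_coloringP (C : finType) (o : {ffun vertex G -> C}) :
  proper_coloring o <->
  (forall e, e \in tree_edges (dom p) 0 ->
     o (pt p (leaf_match p e.1)) != o (pt p (leaf_match p e.2))) /\
  (forall e, e \in tree_edges (cod p) 0 -> o (pt p e.1) != o (pt p e.2)).
Proof.
split=> [/forallP po|[up low]].
  split=> e et.
    have it : (index e (tree_edges (dom p) 0) < size (tree_edges (dom p) 0))%N.
      by rewrite index_mem.
    by have := po (inl (Ordinal it)); rewrite /= nth_index //; case: (e).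
  have it : (index e (tree_edges (cod p) 0) < size (tree_edges (cod p) 0))%N.
    by rewrite index_mem.
  by have := po (inr (Ordinal it)); rewrite /= nth_index //; case: (e).
apply/forallP => -[e|e].
  have := up _ (mem_nth (0, 0)%N (ltn_ord e)).
  by rewrite /=; case: (nth _ _ e).
have := low _ (mem_nth (0, 0)%N (ltn_ord e)).
by rewrite /=; case: (nth _ _ e).
Qed.

End TwoColorings.

Lemma tree_edge_to t x : (0 < x < leaves t)%N ->
  exists2 e, e \in tree_edges t 0 & (e.2 = x /\ (e.1 < x)%N).
Proof.
move=> /andP[x0 xt].
have : x \in [seq N.1.2 | N <- tree_nodes t 0].
  by rewrite (perm_mem (tree_nodes_inner _ _)) mem_iota x0 /=; lia.
case/mapP => N Nt ->; have [_ h _ _] := tree_nodes_bound Nt.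
by exists N.1; rewrite // tree_edgesE map_f.
Qed.

(** A tree has only one proper two-coloring, up to exchange of the colors. *)
Lemma tree_two_colorings t (h h' : nat -> bool) :
  (forall e, e \in tree_edges t 0 -> h e.2 = ~~ h e.1) ->
  (forall e, e \in tree_edges t 0 -> h' e.2 = ~~ h' e.1) ->
  forall x, (x < leaves t)%N -> h x (+) h' x = h 0 (+) h' 0.
Proof.
move=> hE h'E x; elim: x {-2}x (leqnn x) => [|m IH] x xm xt.
  by move: xm; rewrite leqn0 => /eqP->.
case: (posnP x) => [->//|x0].
have [|[i j] et [/= ji ix]] := @tree_edge_to t x; first by rewrite x0.
have := IH i; rewrite -ji (hE _ et) (h'E _ et) /= addNb addbN negbK; apply; lia.
Qed.

Lemma ord2_neq (x y : 'I_2) : (x != y) = (x == y + 1).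
Proof.
by apply/idP/idP; case: x => -[|[|//]] i; case: y => -[|[|//]] j.
Qed.

Section Alternating.
Variable R : realType.
Local Notation dy := (dy R).
Implicit Types (g h : selfbij (circle R)).

(** [g] preserves or exchanges the two color classes of the tree of dyadic
    points. *)
Definition alternating g : Prop := exists b, forall m a k,
  cval m = dy a k -> tm_color (g m) = tm_color m (+) b.

Lemma dyadic_homeo_dyadic g m a k : dyadic_homeo g -> cval m = dy a k ->
  exists a' k', cval (g m) = dy a' k'.
Proof.
move=> [_ [N gN]] mE; have [b bN mb] := in_dyadic_exists m N.
have [c [d [_ gm]]] := gN b bN.
exact: dyadic_map_dyadic gm mb mE.
Qed.

Lemma alternatingM g h : dyadic_homeo h -> alternating g -> alternating h ->
  alternating (g * h)%g.
Proof.
move=> hD [b gb] [b' hb]; exists (b' (+) b) => m a k mE /=.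
have [a' [k' hmE]] := dyadic_homeo_dyadic hD mE.
by rewrite (gb _ _ _ hmE) (hb _ _ _ mE) addbA.
Qed.

Lemma alternatingV g : dyadic_homeo g -> alternating g -> alternating (g^-1)%g.
Proof.
move=> gD [b gb]; exists b => m a k mE /=.
have [a' [k' gmE]] := dyadic_homeo_dyadic (dyadic_homeoV gD) mE.
by rewrite -{2}(bwdK g m) (gb _ _ _ gmE) addbK.
Qed.

Lemma end_point_tm t e : e \in tree_edges t 0 ->
  tm_color (end_point R t e.2) = ~~ tm_color (end_point R t e.1).
Proof.
by move=> /(tree_edges_dyadic R)[_ _ [u [v [eE pE]]]]; rewrite (tm_color_parent eE) pE.
Qed.

Lemma end_point0_tm t : tm_color (end_point R t 0) = false.
Proof.
rewrite (@tm_colorE R _ 0 0) // cval_end_point ?leaves_gt0 // nth_ends0.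
by rewrite /dy mul0r.
Qed.

Variables (p : triple) (g : selfbij (circle R)).
Hypotheses (wf : wf_triple p) (gp : represents p g).
Local Notation n := (leaves (dom p)).
Local Notation G := (thompson_graph p).

Let lE : leaves (cod p) = n. Proof. by case/andP: wf => /eqP. Qed.

Let match_lt i : (leaf_match p i < n)%N.
Proof. by rewrite ltn_pmod // leaves_gt0. Qed.

(** A two-coloring of the graph of the triple agrees with the Thue-Morse coloring
    up to a constant along the lower tree, and after transport by [g] along the
    upper tree, since a tree has one two-coloring up to exchange.  This compares
    [tm_color \o g] with [tm_color] at the ends of the leaves; elsewhere [g]
    commutes with the parent. *)
Lemma colorable_alternating :
  (exists o : {ffun vertex G -> bool}, proper_coloring o) -> alternating g.
Proof.
case=> o /proper_coloringP[up low].
pose hl j := o (pt p j); pose hu i := o (pt p (leaf_match p i)).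
have hlE e : e \in tree_edges (cod p) 0 -> hl e.2 = ~~ hl e.1.
  by move=> /low; rewrite /hl; do 2!case: (o _).
have huE e : e \in tree_edges (dom p) 0 -> hu e.2 = ~~ hu e.1.
  by move=> /up; rewrite /hu; do 2!case: (o _).
have cl := tree_two_colorings (h' := fun i => tm_color (end_point R (cod p) i)) hlE (@end_point_tm (cod p)).
have cu := tree_two_colorings (h' := fun i => tm_color (end_point R (dom p) i)) huE (@end_point_tm (dom p)).
rewrite /= !end_point0_tm !addbF lE in cl cu.
exists (hl 0 (+) hu 0)%N.
have ends_ok i : (i < n)%N -> tm_color (g (end_point R (dom p) i)) =
    tm_color (end_point R (dom p) i) (+) (hl 0 (+) hu 0)%N.
  move=> it; rewrite (represents_end wf gp it).
  rewrite -(cl _ (match_lt i)) -(cu _ it) /hl /hu.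
  by case: (o _); do 2!case: (tm_color _).
move=> m a k; elim/ltn_ind: k m a => k IH m a mE.
case: (boolP (m \in end_points R (dom p))) => [|mp].
  rewrite end_pointsE => /mapP[k0]; rewrite mem_iota add0n => /andP[_ it] ->.
  exact: ends_ok.
case: (dyadic_point mE) => [m0|[u [v [vk mE']]]].
  case/negP: mp; rewrite end_pointsE; apply/mapP; exists 0%N.
    by rewrite mem_iota add0n leaves_gt0.
  by apply: circle_inj; rewrite m0 cval_end_point ?leaves_gt0 // nth_ends0.
have gpm := represents_parent wf gp mp.
have tmm := tm_color_parent mE'.
case: (pselect (exists u v, cval (g m) = dy u.*2.+1 v.+1)) => [[u' [v' gmE]]|no].
  rewrite (tm_color_parent gmE) -gpm (IH v vk _ _ (parentE mE')) tmm.
  by rewrite addNb.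
have gm_id : parent (g m) = g m.
  by apply: parent_id => u' v' gmE; apply: no; exists u', v'.
have pm : parent m = m by apply: (can_inj (@fwdK _ g)); rewrite gpm.
by move: tmm; rewrite pm; case: (tm_color m).
Qed.

(** The proper two-colorings are the Thue-Morse coloring and its opposite. *)
Lemma alternating_chromatic : alternating g -> chromatic G 2 = 2%N.
Proof.
move=> [b gb].
have tm_match i : (i < n)%N -> tm_color (end_point R (cod p) (leaf_match p i)) =
    tm_color (end_point R (dom p) i) (+) b.
  move=> it; rewrite -(represents_end wf gp it).
  by apply: (gb _ _ _ _); rewrite cval_end_point // nth_ends.
pose F (a : 'I_2) : {ffun vertex G -> 'I_2} :=
  [ffun j : 'I_n => if tm_color (end_point R (cod p) j) then a + 1 else a].
have a1 (a : 'I_2) : a != a + 1 by case: a => -[|[|//]].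
have Fpt a j : (j < n)%N -> F a (pt p j) =
    if tm_color (end_point R (cod p) j) then a + 1 else a.
  by move=> jn; rewrite ffunE /= modn_small.
have F0 a : F a (pt p 0) = a by rewrite Fpt ?leaves_gt0 // end_point0_tm.
have Finj : injective F by move=> x y xy; rewrite -(F0 x) xy F0.
have Fproper a : proper_coloring (F a).
  apply/proper_coloringP; split=> e et.
    have [h1 h2 _] := tree_edges_dyadic R et; have h3 := ltn_trans h1 h2.
    rewrite !Fpt // !tm_match // (end_point_tm et).
    by case: (tm_color _); case: b {gb tm_match} => //=; rewrite 1?eq_sym.
  have [h1 h2 _] := tree_edges_dyadic R et; have h3 := ltn_trans h1 h2.
  rewrite !Fpt -?lE // (end_point_tm et).
  by case: (tm_color _) => //=; rewrite eq_sym.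
rewrite /chromatic -[RHS]card_ord -(card_codom Finj).
apply: eq_card => c; rewrite inE; apply/idP/codomP => [pc|[a ->]] //.
have [_ low] := (proper_coloringP c).1 pc.
exists (c (pt p 0)); apply/ffunP => j; rewrite -(pt_id j) Fpt ?ltn_ord //.
pose h i := c (pt p i) == c (pt p 0).
have hE e : e \in tree_edges (cod p) 0 -> h e.2 = ~~ h e.1.
  move=> /low; rewrite /h; move: (c _) (c _) (c _) => x y z.
  rewrite ord2_neq => /eqP->.
  by case: x => -[|[|//]] i1; case: z => -[|[|//]] i2; case: y => -[|[|//]] i3.
have := tree_two_colorings (h' := fun i => tm_color (end_point R (cod p) i)) hE (@end_point_tm (cod p)) (x := j).
rewrite lE ltn_ord => /(_ isT); rewrite /h eqxx end_point0_tm /= pt_id.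
case: (tm_color _) => /=; last by rewrite addbF => /eqP.
by rewrite addbT ord2_neq => /eqP.
Qed.

Lemma chromatic_colorable : chromatic G 2 = 2%N ->
  exists o : {ffun vertex G -> bool}, proper_coloring o.
Proof.
move=> c2; have /card_gt0P[c] : (0 < chromatic G 2)%N by rewrite c2.
rewrite inE => pc; exists [ffun v => c v == 0].
apply/forallP => e; have /forallP/(_ e) := pc; rewrite !ffunE.
by rewrite ord2_neq => /eqP->; case: (c _) => -[|[|//]].
Qed.

End Alternating.

(** * The four values of t *)

Section Values.
Variable R : realType.
Local Notation C := R[i].

Lemma cos_pi3 : cos (pi / 3) = 1 / 2 :> R.
Proof.
set x := pi / 3.
have c0 : 0 < cos x.
  apply: cos_gt0_pihalf; have := pi_gt0 R; rewrite /x => p0.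
  apply/andP; split; lra.
have c3 : cos (x + (x + x)) = - 1.
  by rewrite (_ : x + (x + x) = pi) ?cospi // /x; lra.
have := cos2Dsin2 x => cs; move: c3; rewrite !cosD sinD.
set c := cos x in cs c0 *; set s := sin x in cs *.
move=> c3; have : (c + 1) * (2 * c - 1) ^+ 2 = 0.
  have s2 : s ^+ 2 = 1 - c ^+ 2 by rewrite -cs addrC addKr.
  have -> : (c + 1) * (2 * c - 1) ^+ 2 =
    (c * (c * c - s * s) - s * (s * c + c * s)) + 1 + 3 * c * (s ^+ 2 - (1 - c ^+ 2)) by ring.
  by rewrite s2 subrr mulr0 addr0 c3 addNr.
move/eqP; rewrite mulf_eq0 sqrf_eq0 => /orP[]/eqP; lra.
Qed.

Lemma expi_conj a : Num.conj (expi a) = expi (- a) :> C.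
Proof. by rewrite /expi cosN sinN. Qed.

Lemma expi_norm a : expi a * Num.conj (expi a) = 1 :> C.
Proof.
rewrite expi_conj /expi cosN sinN; apply/eqP; rewrite eq_complex /=.
rewrite mulrN opprK -!expr2 cos2Dsin2 eqxx /=; apply/eqP; ring.
Qed.

(** At the four values of the parameter [t] has modulus 1 and
    [loop_value A ^+ 2 = t + t ^-1 + 2] is the integer 4, 2 or 3. *)
Lemma parameter_values (t A : C) :
  t \in [:: 1; 'i; expi (pi / 3); expi (- (pi / 3))] -> t = A ^- 4 ->
  A * Num.conj A = 1 /\
  exists2 q, (0 < q)%N & loop_value A ^+ 2 = q.+1%:R.
Proof.
move=> ht hA.
have tt : t * Num.conj t = 1.
  move: ht; rewrite !inE => /or4P[]/eqP->.
  - by rewrite rmorph1 mulr1.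
  - by rewrite conjCi mulrN -expr2 sqrCi opprK.
  - exact: expi_norm.
  - exact: expi_norm.
have t0 : t != 0 by apply: contra_eq_neq tt => ->; rewrite mul0r eq_sym oner_eq0.
have A0 : A != 0.
  by apply: contraNneq t0 => A0; rewrite hA A0 expr0n /= invr0.
have nA : `|A| = 1.
  have : `|t| ^+ 2 = 1 by rewrite normCK.
  rewrite hA normfV normrX exprVn -exprM => /(congr1 (fun x => x^-1)).
  rewrite invrK invr1 => /eqP; rewrite pexpr_eq1 //; by move/eqP.
split; first by rewrite -normCK nA expr1n.
have d2 : loop_value A ^+ 2 = t + Num.conj t + 2.
  have -> : Num.conj t = t^-1 by apply: (mulfI t0); rewrite tt divff.
  by rewrite hA /loop_value; field.
rewrite d2; move: ht; rewrite !inE => /or4P[]/eqP->.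
- by exists 3%N; rewrite // rmorph1; ring.
- by exists 1%N; rewrite // conjCi subrr add0r.
- exists 2%N => //; rewrite expi_conj /expi cosN sinN cos_pi3.
  by apply/eqP; rewrite eq_complex /=; apply/andP; split; apply/eqP; lra.
exists 2%N => //; rewrite expi_conj opprK /expi cosN sinN cos_pi3.
by apply/eqP; rewrite eq_complex /=; apply/andP; split; apply/eqP; lra.
Qed.

End Values.

(** * The normalized polynomial as a coefficient *)

Section OrientedJones.
Variable R : realType.
Local Notation C := R[i].
Implicit Types (g h : selfbij (circle R)).

Lemma reduced_tripleP g : dyadic_homeo g ->
  wf_triple (reduced_triple g) /\ represents (reduced_triple g) g.
Proof.
move=> /reduced_triple_exists[p pP].
by have [] := xgetPex (Triple Leaf Leaf 1) (ex_intro (fun p =>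
  [/\ wf_triple p, reduced p & represents p g]) p pP).
Qed.

Lemma dyadic_homeo_almost g : dyadic_homeo g -> almost_commuting (@parent R) g.
Proof.
move=> /reduced_tripleP[wf gp]; eexists.
exact: represents_parent wf gp.
Qed.

Lemma orientedT_alternating g : orientedT g -> dyadic_homeo g /\ alternating g.
Proof.
move=> [/thompsonT_dyadic gD c2]; split=> //.
have [wf gp] := reduced_tripleP gD.
exact: colorable_alternating wf gp (chromatic_colorable c2).
Qed.

(** With writhe 0 the normalized polynomial is [d ^- n] times the bracket, and the
    bracket is [d ^- n] times the partition function, where [d ^ 2 = q]. *)
Lemma jones_mean_cocycle (conv : bool) (A : C) q g : (0 < q)%N ->
  A * Num.conj A = 1 -> loop_value A ^+ 2 = q.+1%:R ->
  dyadic_homeo g -> alternating g ->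
  normalized_jones conv A g =
  mean (cocycle (@parent R) (@edge_weight R q A conv) g).
Proof.
move=> q0 A1 d2 gD gA; have [wf gp] := reduced_tripleP gD.
have col := chromatic_colorable (alternating_chromatic wf gp gA).
have A0 : A != 0 by apply: contra_eq_neq A1 => ->; rewrite mul0r eq_sym oner_eq0.
have d0 : loop_value A != 0.
  by apply: contra_eq_neq d2 => ->; rewrite expr0n eq_sym pnatr_eq0.
rewrite (mean_cocycle_potts q conv A1 wf gp).
rewrite -(bracket_potts conv (q := q.+1) _ A0 d0 d2 (thompson_connected wf (q := q.+1))
  (thompson_euler wf)) // ?card_ord ?leaves_gt0 //.
rewrite /normalized_jones /link_jones /annular_jones thompson_writhe //.
rewrite oppr0 expr0z mulr1 -d2 /nleaves; move: (kauffman_bracket _ _ _ _) => K.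
set n := leaves _; rewrite expfzDr // expr1z -exprnN -exprM mulnC exprM.
by field; rewrite d0 expf_neq0.
Qed.

End OrientedJones.

Theorem corollary1p2 (R : realType) (conv : bool) (t A : R[i])
    (ht : t \in [:: 1; 'i; expi (pi / 3); expi (- (pi / 3))])
    (hA : t = A ^- 4) :
  positive_type (@orientedT R) (normalized_jones conv A) /\
  exists (H : hilbert R) (rho : selfbij (circle R) -> H -> H) (xi eta : H),
    unitary_representation (@orientedT R) rho /\
    forall g, orientedT g ->
      normalized_jones conv A g = hdot H (rho g xi) eta /\
      link_jones conv A g =
        loop_value A ^ ((nleaves g)%:Z - 1) * hdot H (rho g xi) eta.
Proof.
have [A1 [q q0 d2]] := parameter_values ht hA.
have d0 : loop_value A != 0.
  by apply: contra_eq_neq d2 => ->; rewrite expr0n eq_sym pnatr_eq0.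
have [H [rho [xi [rhoU rhoE]]]] := cocycle_representation (@parent R)
  (edge_weight_norm (q := q) conv A1).
have jonesE g : dyadic_homeo g -> alternating g ->
    normalized_jones conv A g = hdot H (rho g xi) xi.
  move=> gD gA; rewrite (jones_mean_cocycle conv q0 A1 d2) // rhoE //.
  exact: dyadic_homeo_almost.
have inK g : orientedT g -> almost_commuting (@parent R) g.
  by move=> /orientedT_alternating[gD _]; exact: dyadic_homeo_almost.
split.
  move=> m g c gT.
  have pos : positive_type (almost_commuting (@parent R))
      (fun g => hdot H (rho g xi) xi).
    apply: coefficient_positive_type rhoU.
      exact: almost_commutingM.
    exact: almost_commutingV.
  have := pos m g c (fun i => inK _ (gT i)).
  congr (0 <= _); apply: eq_bigr => i _; apply: eq_bigr => j _; congr (_ * _).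
  have [iD iA] := orientedT_alternating (gT i).
  have [jD jA] := orientedT_alternating (gT j).
  have iVD := dyadic_homeoV iD.
  rewrite jonesE //; first exact: dyadic_homeoM.
  exact: alternatingM jD (alternatingV iD iA) jA.
exists H, rho, xi, xi; split.
  by case: rhoU => U r1 rM; split=> // [g /inK/U//|g h /inK gK /inK hK]; exact: rM.
move=> g gT; have [gD gA] := orientedT_alternating gT.
split; first exact: jonesE.
rewrite -(jonesE g gD gA) /normalized_jones mulrCA -expfzDr //.
by rewrite (_ : (nleaves g)%:Z - 1 + (1 - (nleaves g)%:Z) = 0) ?expr0z ?mulr1 //; lia.
Qed.
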